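(* Let $d\ge 1$, let $(P_n)_{n\ge 1}$ be a sequence of elements of $\mathscr{P}_d$ such that $\sum_{n\ge 1}\bigl(1-|\alpha(P_n)|\bigr)=\infty$, and set $B_n=P_n^*/P_n$ for $n\ge 1$. Let $f\in\mathsf{H}^2_d$ and define recursively $f_0=f$ and, for $n\ge 0$, $$g_n=\mathrm{proj}\bigl(f_n,(B_{n+1}\mathsf{H}^2_d)^\perp\bigr),\qquad f_{n+1}=\frac{f_n-g_n}{B_{n+1}} .$$ Then, for every $n\ge 0$, $$f=g_0+B_1g_1+B_1B_2g_2+\dots+B_1B_2\cdots B_n g_n+B_1B_2\cdots B_{n+1}f_{n+1},$$ the terms of this sum being mutually orthogonal, and $$f=\sum_{n\ge 0} g_n\prod_{1\le j\le n}B_j ,$$ where the series is a series of mutually orthogonal terms converging in $\mathsf{H}^2_d$.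
   Context: $\mathbb{D}=\{z\in\mathbb{C}: |z|<1\}$, and $\partial^*\mathbb{D}^d=\{z\in\mathbb{C}^d: |z_1|=\dots=|z_d|=1\}$ is the distinguished boundary of the polydisk $\mathbb{D}^d$. $\mathsf{H}^2_d=\mathsf{H}^2(\mathbb{D}^d)$ is the Hardy space of the polydisk, with inner product $\langle f,g\rangle=(2\pi)^{-d}\int_{\partial^*\mathbb{D}^d} f(e^{i\theta_1},\dots,e^{i\theta_d})\overline{g(e^{i\theta_1},\dots,e^{i\theta_d})}\,d\theta_1\cdots d\theta_d$ (boundary values). For a closed subspace $V\subset\mathsf{H}^2_d$, $V^\perp$ is its orthogonal complement in $\mathsf{H}^2_d$ and $\mathrm{proj}(f,V)$ is the orthogonal projection of $f$ on $V$. For a nonzero polynomial $P\in\mathbb{C}[z_1,\dots,z_d]$, let $\mathrm{d}^\circ P=(m_1,\dots,m_d)$, where $m_i$ is the degree of $P$ with respect to $z_i$; let $\overline{P}$ be the polynomial obtained from $P$ by replacing each coefficient by its complex conjugate; and let $P^*(z)=z_1^{m_1}\cdots z_d^{m_d}\,\overline{P}(z_1^{-1},\dots,z_d^{-1})$. The set $\mathscr{P}_d$ consists of the non-constant polynomials $P\in\mathbb{C}[z_1,\dots,z_d]$ that have no zeros in $\mathbb{D}^d\cup\partial^*\mathbb{D}^d$ and have no (non-constant) common factor with $P^*$. For $P\in\mathscr{P}_d$, $\alpha(P)=P^*(0)/P(0)$. For $P\in\mathscr{P}_d$ the function $P^*/P$ is inner, so $\frac{P^*}{P}\mathsf{H}^2_d$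 is a closed subspace of $\mathsf{H}^2_d$. The empty product equals $1$. *)

(* Defs.v *)
(* MathComp-Analysis, with R[i] (real-closed) as the complex field over a
   realType and multinomials for polynomials.  The notations of mpoly are not
   imported because they clash with those of MathComp-Analysis. *)
From HB Require Import structures.
From mathcomp Require Import all_boot all_order all_algebra.
From mathcomp Require Import -(notations) mpoly.
From mathcomp Require Import all_classical all_reals all_analysis.
From mathcomp Require Import complex.

Set Implicit Arguments.
Unset Strict Implicit.
Unset Printing Implicit Defensive.

Import Order.TTheory GRing.Theory Num.Theory.
Import numFieldNormedType.Exports.

Local Open Scope classical_set_scope.
Local Open Scope ring_scope.

Section angle_measure.
Context (R : realType).
Local Notation T := (measurableTypeR R).

Definition angle_interval : set T := [set x : R | 0 <= x <= 2 * pi].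

Lemma measurable_angle_interval : measurable angle_interval.
Proof.
rewrite (_ : angle_interval = `[0, 2 * pi]%classic); first exact: measurable_itv.
by apply/seteqP; split => x; rewrite /= in_itv.
Qed.

Lemma angle_interval_lty : (@lebesgue_measure R angle_interval < +oo)%E.
Proof.
rewrite (_ : angle_interval = `[0, 2 * pi]%classic).
  by rewrite lebesgue_measure_itv/=; case: ifP => // _; rewrite ltry.
by apply/seteqP; split => x; rewrite /= in_itv.
Qed.

Definition angle_measure1 : set T -> \bar R :=
  mfrestr measurable_angle_interval angle_interval_lty.

HB.instance Definition _ := FiniteMeasure.on angle_measure1.

Section cons.
Context (d : nat) (mu : {finite_measure set (d.-tuple T) -> \bar R}).

Definition angle_cons (x : T * d.-tuple T) : d.+1.-tuple T :=
  [tuple of x.1 :: x.2].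

Let measurable_angle_cons : measurable_fun [set: T * d.-tuple T] angle_cons.
Proof. exact: measurable_cons. Qed.

Definition angle_measure_cons : set (d.+1.-tuple T) -> \bar R :=
  pushforward (angle_measure1 \x mu)%E angle_cons.

Let angle_measure_cons0 : angle_measure_cons set0 = 0%E.
Proof. by rewrite /angle_measure_cons /pushforward preimage_set0 measure0. Qed.

Let angle_measure_cons_ge0 A : (0 <= angle_measure_cons A)%E.
Proof. exact: measure_ge0. Qed.

Let angle_measure_cons_sigma_additive : semi_sigma_additive angle_measure_cons.
Proof.
move=> F mF tF mUF; rewrite /angle_measure_cons /pushforward preimage_bigcup.
apply: measure_semi_sigma_additive.
- by move=> n; rewrite -[X in measurable X]setTI; exact: measurable_angle_cons.
- apply/trivIsetP => /= i j _ _ ij; rewrite -preimage_setI.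
  by move/trivIsetP : tF => /(_ _ _ _ _ ij) ->//; rewrite preimage_set0.
- by rewrite -preimage_bigcup -[X in measurable X]setTI;
    exact: measurable_angle_cons.
Qed.

HB.instance Definition _ := isMeasure.Build _ _ _ angle_measure_cons
  angle_measure_cons0 angle_measure_cons_ge0 angle_measure_cons_sigma_additive.

Let angle_measure_cons_fin : fin_num_fun angle_measure_cons.
Proof.
move=> A mA; rewrite ge0_fin_numE//.
apply: (@le_lt_trans _ _ ((angle_measure1 \x mu)%E setT)).
  rewrite /angle_measure_cons /pushforward; apply: le_measure => //.
    by rewrite inE -[X in measurable X]setTI; exact: measurable_angle_cons.
  by rewrite inE; exact: measurableT.
rewrite -setXTT product_measure1E//.
by rewrite lte_mul_pinfty// -?ge0_fin_numE// fin_num_measure.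
Qed.

HB.instance Definition _ :=
  Measure_isFinite.Build _ _ _ angle_measure_cons angle_measure_cons_fin.

End cons.

(* d\theta_1 ... d\theta_d on [0, 2\pi]^d: the d-fold product of Lebesgue
   measure on [0, 2\pi], carried by d.-tuple T *)
Fixpoint angle_measure (d : nat) : {finite_measure set (d.-tuple T) -> \bar R} :=
  match d with
  | 0 => \d_ [tuple]
  | d'.+1 => angle_measure_cons (angle_measure d')
  end.

End angle_measure.

Section hardy_space.
Context (R : realType) (d : nat).
Local Notation C := R[i].
Local Notation normc := (@Normc.normc R).

Definition polydisk : set ('I_d -> C) := [set z | forall i, `|z i| < 1].

Definition distinguished_boundary : set ('I_d -> C) :=
  [set z | forall i, `|z i| = 1].

(* the point (r e^{i\theta_1}, ..., r e^{i\theta_d}) *)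
Definition torus_point (r : R) (theta : d.-tuple (measurableTypeR R)) : 'I_d -> C :=
  fun i => Complex (r * cos (tnth theta i)) (r * sin (tnth theta i)).

(* Holomorphic functions are total functions of which only the values on the
   polydisk matter.  On the polydisk, holomorphy is the same as being the sum of
   an absolutely convergent power series \sum_k a_k z^k, k ranging over N^d; the
   sum is taken as the limit of the partial sums over the total degree, which
   is immaterial since the series is absolutely convergent. *)
Definition holomorphic (F : ('I_d -> C) -> C) : Prop :=
  exists a : multinom d -> C, forall z, polydisk z ->
    (\esum_(k in [set: multinom d]) (normc (a k * mmap1 z k))%:E < +oo)%E /\
    (fun N => normc (F z - \sum_(k : bmultinom d N) a k * mmap1 z k))
      @ \oo --> (0 : R).

Definition hardy2 (F : ('I_d -> C) -> C) : Prop :=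
  holomorphic F /\
  exists M : R, forall r : R, 0 <= r < 1 ->
    (\int[angle_measure R d]_theta (normc (F (torus_point r theta)) ^+ 2)%:E
      <= M%:E)%E.

(* phi is the boundary function theta |-> F(e^{i\theta_1}, ..., e^{i\theta_d}),
   i.e. the limit in L^2 of theta |-> F(r e^{i\theta}) as r -> 1-; it is unique
   up to a null set *)
Definition is_boundary_value (F : ('I_d -> C) -> C) (phi : d.-tuple (measurableTypeR R) -> C) :
    Prop :=
  [/\ measurable_fun setT (fun theta => complex.Re (phi theta)),
      measurable_fun setT (fun theta => complex.Im (phi theta)) &
      (fun r : R => \int[angle_measure R d]_theta
         (normc (F (torus_point r theta) - phi theta) ^+ 2)%:E)%E
        @ (1 : R)^'- --> 0%E].

Definition boundary_value (F : ('I_d -> C) -> C) : d.-tuple (measurableTypeR R) -> C :=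
  xget (fun=> 0) [set phi | is_boundary_value F phi].

Definition angle_integral (phi : d.-tuple (measurableTypeR R) -> C) : C :=
  Complex (\int[angle_measure R d]_theta complex.Re (phi theta))
          (\int[angle_measure R d]_theta complex.Im (phi theta)).

Definition hardy_inner (F G : ('I_d -> C) -> C) : C :=
  ((2 * pi) ^- d)%:C%C *
  angle_integral (fun theta =>
    boundary_value F theta * conjc (boundary_value G theta)).

Definition hardy_norm (F : ('I_d -> C) -> C) : R :=
  Num.sqrt (complex.Re (hardy_inner F F)).

Definition hardy_orth (V : set (('I_d -> C) -> C)) : set (('I_d -> C) -> C) :=
  [set G | hardy2 G /\ forall H, V H -> hardy_inner G H = 0].

Definition hardy_proj (F : ('I_d -> C) -> C) (V : set (('I_d -> C) -> C)) :
    ('I_d -> C) -> C :=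
  xget (fun=> 0)
    [set G | V G /\ forall H, V H -> hardy_inner (fun z => F z - G z) H = 0].

(* the subspace B H^2 *)
Definition hardy_mul (B : ('I_d -> C) -> C) : set (('I_d -> C) -> C) :=
  [set G | exists2 H, hardy2 H & forall z, polydisk z -> G z = B z * H z].

(* F / B as a holomorphic function: the pointwise quotient would be wrong at the
   zeros of B in the polydisk, which are removable singularities *)
Definition holomorphic_div (F B : ('I_d -> C) -> C) : ('I_d -> C) -> C :=
  xget (fun=> 0)
    [set H | holomorphic H /\ forall z, polydisk z -> B z * H z = F z].

End hardy_space.

Section reflection.
Context (R : realType) (d : nat).
Local Notation C := R[i].
Implicit Types P Q D : mpoly d C.

Definition multidegree P : multinom d :=
  Multinom [tuple (\max_(k <- msupp P) k i)%N | i < d].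

(* z^m \bar P(1/z) for m the multidegree, expanded: the term c z^k of P yields
   the term \bar c z^(m - k) *)
Definition reflect_poly P : mpoly d C :=
  \sum_(k <- msupp P) conjc (mcoeff k P) *: mpolyX C (mnm_sub (multidegree P) k).

Definition nonconstant P : Prop := forall c : C, P <> mpolyC d c.

Definition mdivides D P : Prop := exists Q, P = D * Q.

Definition poly_class P : Prop :=
  [/\ nonconstant P,
      forall z, (@polydisk R d `|` @distinguished_boundary R d) z ->
        meval z P != 0 &
      ~ exists D, [/\ nonconstant D, mdivides D P & mdivides D (reflect_poly P)]].

Definition alpha P : C :=
  meval (fun=> 0) (reflect_poly P) / meval (fun=> 0) P.

Definition inner_quotient P (z : 'I_d -> C) : C :=
  meval z (reflect_poly P) / meval z P.

End reflection.

(* Main.v *)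
Require Import Defs.
From mathcomp Require Import all_boot all_order all_algebra.
From mathcomp Require Import -(notations) mpoly.
From mathcomp Require Import all_classical all_reals all_analysis.
From mathcomp Require Import complex.
From mathcomp Require Import measurable_realfun ring lra.

Set Implicit Arguments.
Unset Strict Implicit.
Unset Printing Implicit Defensive.

Import Order.TTheory GRing.Theory Num.Theory.
Import numFieldNormedType.Exports.

Local Open Scope classical_set_scope.
Local Open Scope ring_scope.

(* A function of H^2 is identified with its square summable family of Taylor
   coefficients; hardy_inner becomes the l2 product, boundary values being
   obtained from Parseval's identity and a Riesz-Fischer argument.
   For P in the class, 1/P is a power series c with |c_k| <= K_s s^-|k| for every
   s < 1 (factor the one-variable polynomials P(l z), z on the torus), and
   P(z)/P(rz) is bounded by 2^deg on the torus and tends to 1 as r -> 1, so that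
   P H^2 is dense.  Since |P*| = |P| on the torus, multiplication by B = P*/P is
   an isometry, with adjoint (T f)_l = <f, z^l B>; hence the projection of f on
   (B H^2)^perp is f - B T f, and f_n = T_n ... T_1 f.  The term orthogonality
   follows.  The remainder has norm |f_n|, and f_n --> 0: on polynomials the T_n
   are triangular contractions for the grading by degree, with diagonal the
   conjugate of alpha(P_n), and the product of the |alpha(P_n)| vanishes. *)

(** * Absolutely summable families on N^d *)

(** The coefficient bound on 1/P gives absolute convergence inside the polydisk only, so the torus
    is reached along radii r -> 1, where every series is absolutely summable and Parseval's identity
    follows by dominated convergence. What makes the limit uniform is |1 - w| <= 2 |1 - r w| for |w|
    <= 1, applied to each linear factor of l -> P(l z). The coefficients of B = P*/P are first known
    only as a formal product, so |B| = 1 on the torus cannot be integrated directly. Lower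
    semicontinuity of the norm under coefficientwise limits shows that B is a contraction; only then
    does B act continuously, and |P* w_j| = |P w_j| passes to the limit as an equality. The decay of
    f_n is an induction on the degree that restarts at a later index. The products of |alpha(P_n)|
    must therefore vanish along every tail, which a single zero factor would not ensure; divergence
    of the series does, being inherited by tails. Projections and quotients are selected by [xget]
    among functions that may differ off the polydisk; they are controlled through their Taylor
    coefficients, which are unique. *)

Section truncated_sum.
Variables (d : nat).
Local Notation M := (multinom d).

Definition tsum (V : nmodType) (N : nat) (x : M -> V) : V :=
  \sum_(k : bmultinom d N) x k.

(** Coefficients of z^m times the series x. The guard matters because [mnm_sub] is a truncated
    subtraction. *)
Definition mshift (V : nmodType) (m : M) (x : M -> V) : M -> V :=
  fun k => if mpoly.lem m k then x (mnm_sub k m) else 0.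

(** A bounded multi-index carries the proof of its degree bound, so a bijection of N^d does not act
    on the index types directly. The hypotheses describe it on bare multi-indices, and the inverse
    becomes a partial map through [insub]. *)
Lemma tsum_reindex (V : nmodType) (N N' : nat) (P : pred M) (f g : M -> M)
    (x : M -> V) :
  (forall k, (mdeg k < N')%N -> P k -> (mdeg (g k) < N)%N /\ f (g k) = k) ->
  (forall j, (mdeg j < N)%N -> [/\ (mdeg (f j) < N')%N, P (f j) & g (f j) = j]) ->
  \sum_(k : bmultinom d N' | P k) x k = \sum_(j : bmultinom d N) x (f j).
Proof.
move=> gP fP.
have fN (j : bmultinom d N) : (mdeg (f j) < N')%N by case: (fP _ (bmdeg j)).
pose h (j : bmultinom d N) : bmultinom d N' := BMultinom (fN j).
pose h' (k : bmultinom d N') : option (bmultinom d N) := insub (g k).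
rewrite (reindex_omap h h') /=.
  apply: eq_bigl => j; have [_ Pj gj] := fP _ (bmdeg j).
  rewrite Pj /h' /= gj insubT ?bmdeg // => jN.
  by apply/eqP; congr Some; apply/val_inj.
move=> k Pk; have [gN fg] := gP _ (bmdeg k) Pk.
by rewrite /h' insubT /=; congr Some; apply/val_inj.
Qed.

Lemma tsum_widen (V : nmodType) (N N' : nat) (x : M -> V) : (N <= N')%N ->
  tsum N' (fun k => if (mdeg k < N)%N then x k else 0) = tsum N x.
Proof.
move=> NN'; rewrite /tsum -big_mkcond /=.
apply: (@tsum_reindex _ _ _ (fun k => mdeg k < N)%N id id) => // j jN.
by split => //; exact: leq_trans NN'.
Qed.

(** Multiplication by z^m raises every degree by exactly [mdeg m], hence the displaced cut-off;
    letting N grow, the shift preserves sums. *)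
Lemma tsum_mshift (V : nmodType) (N : nat) (m : M) (x : M -> V) :
  tsum (mdeg m + N) (mshift m x) = tsum N x.
Proof.
rewrite /tsum /mshift -big_mkcond /=.
have -> : \sum_(j : bmultinom d N) x j =
    \sum_(j : bmultinom d N) x (mnm_sub (mnm_add m j) m).
  by apply: eq_bigr => j _; rewrite addmC addmK.
apply: (@tsum_reindex _ N _ (mpoly.lem m) (fun j => mnm_add m j)
  (fun k => mnm_sub k m) (fun k => x (mnm_sub k m))).
- move=> k kN mk; split; last by rewrite addmC submK.
  by rewrite -(ltn_add2l (mdeg m)) -mdegD addmC submK.
- by move=> j jN; rewrite mdegD ltn_add2l lem_addr addmC addmK.
Qed.

Lemma tsumD (V : nmodType) N (x y : M -> V) :
  tsum N (fun k => x k + y k) = tsum N x + tsum N y.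
Proof. exact: big_split. Qed.

Lemma tsumN (V : zmodType) N (x : M -> V) :
  tsum N (fun k => - x k) = - tsum N x.
Proof. exact: sumrN. Qed.

Lemma eq_tsum (V : nmodType) N (x y : M -> V) :
  (forall k, (mdeg k < N)%N -> x k = y k) -> tsum N x = tsum N y.
Proof. by move=> xy; apply: eq_bigr => k _; apply: xy; rewrite bmdeg. Qed.

Lemma tsumZ (R : pzSemiRingType) N (c : R) (x : M -> R) :
  tsum N (fun k => c * x k) = c * tsum N x.
Proof. by rewrite /tsum mulr_sumr. Qed.

End truncated_sum.

Section total_sum.
Variables (R : realType) (d : nat).
Local Notation M := (multinom d).
Implicit Types (x y : M -> R).

Lemma le_tsum N x y : (forall k, x k <= y k) -> tsum N x <= tsum N y.
Proof. by move=> xy; apply: ler_sum => k _. Qed.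

Lemma tsum_ge0 N x : (forall k, 0 <= x k) -> 0 <= tsum N x.
Proof. by move=> x0; apply: sumr_ge0. Qed.

Lemma nondecreasing_tsum x : (forall k, 0 <= x k) ->
  nondecreasing_seq (fun N => tsum N x).
Proof.
move=> x0; apply/nondecreasing_seqP => N.
rewrite -(tsum_widen x (leqnSn N)); apply: le_tsum => k.
by case: ifP.
Qed.

Lemma ge_tsum_one x k N : (forall k, 0 <= x k) -> (mdeg k < N)%N ->
  x k <= tsum N x.
Proof.
move=> x0 kN; rewrite /tsum (bigD1 (BMultinom kN)) //= lerDl.
exact: sumr_ge0.
Qed.

(* Sums over N^d are limits over the total degree; smb and csmb mean absolutely
   summable. *)
Definition smb x := exists B, forall N, tsum N (fun k => `|x k|) <= B.

Definition tot x := limn (fun N => tsum N x).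

Lemma nonneg_tsum_cvg x : (forall k, 0 <= x k) -> smb x ->
  (fun N => tsum N x) @ \oo --> tot x.
Proof.
move=> x0 [B xB]; apply/cvg_ex; exists (sup (range (fun N => tsum N x))).
apply: nondecreasing_cvgn; first exact: nondecreasing_tsum.
exists B => _ [N _ <-]; apply: le_trans (xB N).
by apply: le_tsum => k; rewrite ler_norm.
Qed.

Lemma smbD x y : smb x -> smb y -> smb (fun k => x k + y k).
Proof.
move=> [B xB] [B' yB]; exists (B + B') => N.
apply: le_trans (lerD (xB N) (yB N)); rewrite -tsumD.
by apply: le_tsum => k; exact: ler_normD.
Qed.

Lemma smbZ c x : smb x -> smb (fun k => c * x k).
Proof.
move=> [B xB]; exists (`|c| * B) => N.
have -> : tsum N (fun k => `|c * x k|) = `|c| * tsum N (fun k => `|x k|).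
  by rewrite -tsumZ; apply: eq_tsum => k _; rewrite normrM.
by rewrite ler_wpM2l.
Qed.

Lemma smbN x : smb x -> smb (fun k => - x k).
Proof.
by move=> [B xB]; exists B => N; under eq_tsum do rewrite normrN.
Qed.

Lemma smb_le x y : (forall k, `|x k| <= `|y k|) -> smb y -> smb x.
Proof.
move=> xy [B yB]; exists B => N; apply: le_trans (yB N).
by apply: le_tsum => k; exact: xy.
Qed.

Lemma smb0 : smb (fun _ => 0).
Proof. by exists 0 => N; rewrite /tsum big1 // => k _; rewrite normr0. Qed.

Lemma smb_cvg x : smb x -> (fun N => tsum N x) @ \oo --> tot x.
Proof.
move=> sx; have sn : smb (fun k => `|x k|).
  by apply: smb_le sx => k; rewrite normr_id.
(* x = (x + |x|) - |x| is a difference of two nonnegative summable families, to which monotone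
   convergence applies. *)
apply/cvg_ex; exists (tot (fun k => x k + `|x k|) - tot (fun k => `|x k|)).
rewrite (_ : (fun N => _) =
    (fun N => tsum N (fun k => x k + `|x k|)) \- (fun N => tsum N (fun k => `|x k|))); last first.
  by apply/funext => N /=; rewrite tsumD addrK.
apply: cvgB; apply: nonneg_tsum_cvg => //.
  by move=> k; rewrite -lerBlDl sub0r -normrN ler_norm.
exact: smbD.
Qed.

Lemma tot_unique x l : (fun N => tsum N x) @ \oo --> l -> tot x = l.
Proof. by move=> /cvg_lim; apply. Qed.

Lemma totD x y : smb x -> smb y -> tot (fun k => x k + y k) = tot x + tot y.
Proof.
move=> sx sy; apply: tot_unique.
under eq_fun do rewrite tsumD.
by apply: cvgD; exact: smb_cvg.
Qed.

Lemma totZ c x : smb x -> tot (fun k => c * x k) = c * tot x.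
Proof.
move=> sx; apply: tot_unique; under eq_fun do rewrite tsumZ.
by apply: cvgMr; exact: smb_cvg.
Qed.

Lemma totN x : smb x -> tot (fun k => - x k) = - tot x.
Proof.
move=> sx; apply: tot_unique; under eq_fun do rewrite tsumN.
by apply: cvgN; exact: smb_cvg.
Qed.

Lemma totB x y : smb x -> smb y -> tot (fun k => x k - y k) = tot x - tot y.
Proof. by move=> sx sy; rewrite totD ?totN//; exact: smbN. Qed.

Lemma tot0 : tot (fun _ => 0) = 0.
Proof.
apply: tot_unique; rewrite (_ : (fun N => _) = fun _ => 0) ?cvg_cst //.
  exact: cvg_cst.
by apply/funext => N; rewrite /tsum big1.
Qed.

Lemma tot_ge0 x : (forall k, 0 <= x k) -> 0 <= tot x.
Proof.
move=> x0; have [cx|cx] := pselect (cvgn (fun N => tsum N x)).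
  by apply: limr_ge => //; apply: nearW => N; exact: tsum_ge0.
(* Without convergence [limn] takes its default value, which is 0 in [R]. *)
by rewrite /tot dvgP.
Qed.

Lemma le_tot x y : smb x -> smb y -> (forall k, x k <= y k) -> tot x <= tot y.
Proof.
move=> sx sy xy; rewrite -subr_ge0 -totB//; apply: tot_ge0 => k.
by rewrite subr_ge0.
Qed.

Lemma tsum_le_tot N x : (forall k, 0 <= x k) -> smb x -> tsum N x <= tot x.
Proof.
move=> x0 sx; apply: nondecreasing_cvgn_le; first exact: nondecreasing_tsum.
by apply/cvg_ex; exists (tot x); exact: smb_cvg.
Qed.

Lemma tot_le x B : smb x -> (forall N, tsum N x <= B) -> tot x <= B.
Proof.
move=> sx xB; apply: limr_le; last exact: nearW.
by apply/cvg_ex; exists (tot x); exact: smb_cvg.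
Qed.

Lemma le_term_tot x k : (forall k, 0 <= x k) -> smb x -> x k <= tot x.
Proof.
move=> x0 sx; apply: le_trans (tsum_le_tot (mdeg k).+1 x0 sx).
exact: ge_tsum_one.
Qed.

Lemma smb_ge0P x B : (forall k, 0 <= x k) -> (forall N, tsum N x <= B) -> smb x.
Proof.
move=> x0 xB; exists B => N; apply: le_trans (xB N).
by apply: le_tsum => k; rewrite ger0_norm.
Qed.

Lemma mshift_norm x m k : `|mshift m x k| = mshift m (fun k => `|x k|) k.
Proof. by rewrite /mshift; case: ifP => // _; rewrite normr0. Qed.

Lemma smb_mshift x m : smb x -> smb (mshift m x).
Proof.
move=> sx; have [B xB] := sx; exists B => N.
have -> : tsum N (fun k => `|mshift m x k|) = tsum N (mshift m (fun k => `|x k|)).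
  by apply: eq_tsum => k _; exact: mshift_norm.
apply: le_trans (xB N); rewrite -[leRHS](tsum_mshift N m).
apply: nondecreasing_tsum; last exact: leq_addl.
by move=> k; rewrite /mshift; case: ifP.
Qed.

Lemma tot_eq0 x : (forall k, 0 <= x k) -> smb x -> tot x = 0 -> forall k, x k = 0.
Proof.
move=> x0 sx tx k; apply/eqP; rewrite eq_le x0 andbT.
by rewrite -tx; exact: le_term_tot.
Qed.

Lemma fin_supp_tsum (V : nmodType) (x : M -> V) D N :
  (forall k, (D <= mdeg k)%N -> x k = 0) -> (D <= N)%N -> tsum N x = tsum D x.
Proof.
move=> xD DN; rewrite -(tsum_widen _ DN); apply: eq_tsum => k _.
by case: ltnP => // /xD.
Qed.

Lemma fin_supp_tot x D : (forall k, (D <= mdeg k)%N -> x k = 0) ->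
  smb x /\ tot x = tsum D x.
Proof.
move=> xD; have ev : \forall N \near \oo, tsum N x = tsum D x.
  by exists D => // N /= DN; exact: fin_supp_tsum.
split.
  exists (tsum D (fun k => `|x k|)) => N.
  rewrite -(@fin_supp_tsum _ (fun k => `|x k|) D (N + D)%N) ?leq_addl //.
    by apply: nondecreasing_tsum => //; rewrite leq_addr.
  by move=> k /xD ->; rewrite normr0.
apply: tot_unique.
have : (fun N => tsum D x) @ \oo --> tsum D x by exact: cvg_cst.
apply: cvg_trans; apply: near_eq_cvg; near=> N; apply/esym.
by near: N.
Unshelve. all: by end_near. Qed.

Lemma eq_tot x y : (forall k, x k = y k) -> tot x = tot y.
Proof. by move=> xy; congr tot; apply/funext. Qed.

Lemma tot_trunc_cvg x : smb x ->
  (fun N => tot (fun k => if (mdeg k < N)%N then 0 else x k)) @ \oo --> (0 : R).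
Proof.
move=> sx; rewrite [X in X @ _ --> _](_ : _ = fun N => tot x - tsum N x).
  by rewrite -(subrr (tot x)); apply: cvgB; [exact: cvg_cst|exact: smb_cvg].
apply/funext => N.
have y0 k : (N <= mdeg k)%N -> (if (mdeg k < N)%N then x k else 0) = 0.
  by rewrite ltnNge => ->.
have [sy ty] := fin_supp_tot y0.
rewrite -(tsum_widen x (leqnn N)) -ty -totB//.
by apply: eq_tot => k; case: ifP; rewrite ?subrr ?subr0.
Qed.

End total_sum.

(** * Modulus and limits in [R[i]] *)

Section complex_modulus.
Variable R : realType.
Local Notation C := R[i].
Local Notation normc := (@Normc.normc R).
Local Notation Re := (@complex.Re R).
Local Notation Im := (@complex.Im R).
Implicit Types z w : C.

Lemma normc_ge0 z : 0 <= normc z.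
Proof. by case: z => a b; exact: sqrtr_ge0. Qed.

Lemma normc2E z : normc z ^+ 2 = Re z ^+ 2 + Im z ^+ 2.
Proof. by case: z => a b /=; rewrite sqr_sqrtr // addr_ge0 ?sqr_ge0. Qed.

Lemma normcD z w : normc (z + w) <= normc z + normc w.
Proof. exact: le_normcD. Qed.

Lemma normcNc z : normc (- z) = normc z.
Proof. exact: normcN. Qed.

Lemma normcBC z w : normc (z - w) = normc (w - z).
Proof. by rewrite -normcNc opprB. Qed.

Lemma normc_conj z : normc (conjc z) = normc z.
Proof. by case: z => a b /=; rewrite sqrrN. Qed.

Lemma normc_real (x : R) : normc x%:C%C = `|x|.
Proof. by rewrite /= expr0n /= addr0 sqrtr_sqr. Qed.

Lemma Re_le_normc z : `|Re z| <= normc z.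
Proof.
rewrite -(ger0_norm (normc_ge0 z)) -ler_sqr ?nnegrE // ?normr_ge0 //.
by rewrite !real_normK ?num_real // normc2E lerDl sqr_ge0.
Qed.

Lemma Im_le_normc z : `|Im z| <= normc z.
Proof.
rewrite -(ger0_norm (normc_ge0 z)) -ler_sqr ?nnegrE // ?normr_ge0 //.
by rewrite !real_normK ?num_real // normc2E lerDr sqr_ge0.
Qed.

Lemma normc_le_ReIm z : normc z <= `|Re z| + `|Im z|.
Proof.
case: z => a b; rewrite [X in normc X](_ : _ = (a%:C + Complex 0 b)%C).
  apply: le_trans (normcD _ _) _; rewrite normc_real lerD2l /=.
  by rewrite expr0n /= add0r sqrtr_sqr.
by apply/eqP; rewrite eq_complex /= addr0 add0r !eqxx.
Qed.

Lemma normcX z n : normc (z ^+ n) = normc z ^+ n.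
Proof.
elim: n => [|n IH]; first by rewrite !expr0 Normc.normc1.
by rewrite !exprS Normc.normcM IH.
Qed.

Lemma normc_eq0 z : (normc z == 0) = (z == 0).
Proof.
apply/eqP/eqP => [/Normc.eq0_normc //|->]; exact: Normc.normc0.
Qed.

Lemma mulc_conj z : z * conjc z = (normc z ^+ 2)%:C%C.
Proof.
rewrite normc2E; case: z => a b; apply/eqP.
by rewrite eq_complex /=; apply/andP; split; apply/eqP; ring.
Qed.

Lemma normc_sum (I : Type) (r : seq I) (P : pred I) (F : I -> C) :
  normc (\sum_(i <- r | P i) F i) <= \sum_(i <- r | P i) normc (F i).
Proof.
elim/big_ind2 : _ => //; first by rewrite Normc.normc0.
by move=> x1 x2 y1 y2 h1 h2; apply: le_trans (normcD _ _) _; exact: lerD.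
Qed.

Lemma normc_prod (I : Type) (r : seq I) (P : pred I) (F : I -> C) :
  normc (\prod_(i <- r | P i) F i) = \prod_(i <- r | P i) normc (F i).
Proof.
elim/big_ind2 : _ => //; first by rewrite Normc.normc1.
by move=> x1 x2 y1 y2 <- <-; rewrite Normc.normcM.
Qed.

(** The parallelogram identity, with |z - w|^2 dropped. *)
Lemma normcD2 z w : normc (z + w) ^+ 2 <= 2 * normc z ^+ 2 + 2 * normc w ^+ 2.
Proof.
rewrite !normc2E; case: z w => [a b] [c e] /=; rewrite -subr_ge0.
have -> : 2 * (a ^+ 2 + b ^+ 2) + 2 * (c ^+ 2 + e ^+ 2) -
  ((a + c) ^+ 2 + (b + e) ^+ 2) = (a - c) ^+ 2 + (b - e) ^+ 2 by ring.
by rewrite addr_ge0 ?sqr_ge0.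
Qed.

Lemma ReD z w : Re (z + w) = Re z + Re w. Proof. by case: z w => [a b] [c e]. Qed.
Lemma ImD z w : Im (z + w) = Im z + Im w. Proof. by case: z w => [a b] [c e]. Qed.
Lemma ReN z : Re (- z) = - Re z. Proof. by case: z. Qed.
Lemma ImN z : Im (- z) = - Im z. Proof. by case: z. Qed.
Lemma cReM z w : Re (z * w) = Re z * Re w - Im z * Im w.
Proof. by case: z w => [a b] [c e]. Qed.
Lemma cImM z w : Im (z * w) = Re z * Im w + Im z * Re w.
Proof. by case: z w => [a b] [c e]. Qed.

Lemma eq_ReIm z w : Re z = Re w -> Im z = Im w -> z = w.
Proof. by case: z w => [a b] [c e] /= -> ->. Qed.

Lemma Re_sum (I : Type) (r : seq I) (P : pred I) (F : I -> C) :
  Re (\sum_(i <- r | P i) F i) = \sum_(i <- r | P i) Re (F i).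
Proof. by elim/big_ind2 : _ => // x1 x2 y1 y2 <- <-; rewrite ReD. Qed.

Lemma Im_sum (I : Type) (r : seq I) (P : pred I) (F : I -> C) :
  Im (\sum_(i <- r | P i) F i) = \sum_(i <- r | P i) Im (F i).
Proof. by elim/big_ind2 : _ => // x1 x2 y1 y2 <- <-; rewrite ImD. Qed.

(** Convergence in [R[i]] expressed by a real limit: the form used in [holomorphic], and one to
    which the real squeeze lemmas apply. *)
Definition ccvg (u : nat -> C) (l : C) : Prop :=
  (fun n => normc (u n - l)) @ \oo --> (0 : R).

Lemma ccvgP u l : ccvg u l <->
  ((fun n => Re (u n)) @ \oo --> Re l) /\ ((fun n => Im (u n)) @ \oo --> Im l).
Proof.
split=> [ul|[rl il]].
  split; apply/subr_cvg0; apply/norm_cvg0P.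
    apply: squeeze_cvgr (cvg_cst 0) ul; apply: nearW => n /=.
    by rewrite normr_ge0 /= -ReN -ReD; exact: Re_le_normc.
  apply: squeeze_cvgr (cvg_cst 0) ul; apply: nearW => n /=.
  by rewrite normr_ge0 /= -ImN -ImD; exact: Im_le_normc.
have h : (fun n => `|Re (u n) - Re l| + `|Im (u n) - Im l|) @ \oo --> (0 : R).
  rewrite -[X in _ --> X](addr0 0); apply: cvgD.
    by apply/norm_cvg0P; apply/subr_cvg0.
  by apply/norm_cvg0P; apply/subr_cvg0.
apply: squeeze_cvgr (cvg_cst 0) h; apply: nearW => n /=.
by rewrite normc_ge0 /= -ReN -ReD -ImN -ImD; exact: normc_le_ReIm.
Qed.

Lemma ccvg_unique u l l' : ccvg u l -> ccvg u l' -> l = l'.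
Proof.
move=> /ccvgP[a b] /ccvgP[a' b']; apply: eq_ReIm.
  exact: (cvg_unique _ a a').
exact: (cvg_unique _ b b').
Qed.

Lemma ccvgD u v l m : ccvg u l -> ccvg v m -> ccvg (fun n => u n + v n) (l + m).
Proof.
move=> /ccvgP[a b] /ccvgP[a' b']; apply/ccvgP; split.
  by rewrite ReD; under eq_fun do rewrite ReD; exact: cvgD.
by rewrite ImD; under eq_fun do rewrite ImD; exact: cvgD.
Qed.

Lemma ccvgZ c u l : ccvg u l -> ccvg (fun n => c * u n) (c * l).
Proof.
move=> ul; rewrite /ccvg; under eq_fun do rewrite -mulrBr Normc.normcM.
by rewrite -(mulr0 (normc c)); apply: cvgMr.
Qed.

Lemma ccvg_cst l : ccvg (fun=> l) l.
Proof.
rewrite /ccvg; under eq_fun do rewrite subrr Normc.normc0.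
exact: cvg_cst.
Qed.

Lemma ccvg_shift m u l : ccvg (fun n => u (m + n)%N) l -> ccvg u l.
Proof.
move=> h; rewrite /ccvg -(cvg_shiftn m) /=.
by under eq_fun do rewrite addnC.
Qed.

Lemma normc_ccvg u l : ccvg u l -> (fun n => normc (u n)) @ \oo --> normc l.
Proof.
move=> ul; apply/subr_cvg0; apply/norm_cvg0P.
apply: squeeze_cvgr (cvg_cst 0) ul; apply: nearW => n /=.
have h1 := normcD (u n) (l - u n); have h2 := normcD l (u n - l).
rewrite addrC subrK normcBC in h1; rewrite addrC subrK in h2.
by rewrite normr_ge0 /= ler_norml; apply/andP; split; lra.
Qed.

End complex_modulus.

(** * The Hilbert space of square summable families *)

Section square_summable.
Variables (R : realType) (d : nat).
Local Notation M := (multinom d).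
Local Notation C := R[i].
Local Notation normc := (@Normc.normc R).
Local Notation Re := (@complex.Re R).
Local Notation Im := (@complex.Im R).
Implicit Types (a b x y : M -> C).

Definition csmb x := smb (fun k => normc (x k)).

Definition ctot x : C := Complex (tot (fun k => Re (x k))) (tot (fun k => Im (x k))).

Lemma csmb_Re x : csmb x -> smb (fun k => Re (x k)).
Proof.
apply: smb_le => k; rewrite (ger0_norm (normc_ge0 _)); exact: Re_le_normc.
Qed.

Lemma csmb_Im x : csmb x -> smb (fun k => Im (x k)).
Proof.
apply: smb_le => k; rewrite (ger0_norm (normc_ge0 _)); exact: Im_le_normc.
Qed.

Lemma ctot_cvg x : csmb x -> ccvg (fun N => tsum N x) (ctot x).
Proof.
move=> sx; apply/ccvgP; split => /=.
  under eq_fun do rewrite /tsum Re_sum.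
  exact: smb_cvg (csmb_Re sx).
under eq_fun do rewrite /tsum Im_sum.
exact: smb_cvg (csmb_Im sx).
Qed.

Lemma ctot_unique x l : ccvg (fun N => tsum N x) l -> ctot x = l.
Proof.
move=> /ccvgP[]; under eq_fun do rewrite /tsum Re_sum.
under [X in _ -> X @ _ --> _ -> _]eq_fun do rewrite /tsum Im_sum.
by move=> hr hi; apply: eq_ReIm; exact: tot_unique.
Qed.

Lemma csmb_le x y : (forall k, normc (x k) <= normc (y k)) -> csmb y -> csmb x.
Proof. by move=> xy; apply: smb_le => k; rewrite !ger0_norm ?normc_ge0. Qed.

Lemma csmb_leR x (y : M -> R) : (forall k, normc (x k) <= y k) -> smb y -> csmb x.
Proof.
move=> xy; apply: smb_le => k; rewrite (ger0_norm (normc_ge0 _)).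
by apply: le_trans (xy k) _; rewrite ler_norm.
Qed.

Lemma csmbD x y : csmb x -> csmb y -> csmb (fun k => x k + y k).
Proof. by move=> sx sy; apply: csmb_leR (smbD sx sy) => k; exact: normcD. Qed.

Lemma csmbZ c x : csmb x -> csmb (fun k => c * x k).
Proof.
by move=> sx; apply: csmb_leR (smbZ (normc c) sx) => k; rewrite Normc.normcM.
Qed.

Lemma csmb0 : csmb (fun=> 0).
Proof. by apply: csmb_leR (@smb0 R d) => k; rewrite Normc.normc0. Qed.

Lemma ctotD x y : csmb x -> csmb y -> ctot (fun k => x k + y k) = ctot x + ctot y.
Proof.
move=> sx sy; apply: ctot_unique; under eq_fun do rewrite tsumD.
by apply: ccvgD; exact: ctot_cvg.
Qed.

Lemma ctotZ c x : csmb x -> ctot (fun k => c * x k) = c * ctot x.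
Proof.
move=> sx; apply: ctot_unique; under eq_fun do rewrite tsumZ.
by apply: ccvgZ; exact: ctot_cvg.
Qed.

Lemma ctot0 : ctot (fun=> 0) = 0.
Proof. by rewrite /ctot !tot0. Qed.

Lemma eq_ctot x y : (forall k, x k = y k) -> ctot x = ctot y.
Proof. by move=> xy; congr ctot; apply/funext. Qed.

Lemma ctot_conj x : csmb x -> ctot (fun k => conjc (x k)) = conjc (ctot x).
Proof.
move=> sx; apply: eq_ReIm => /=; first by apply: eq_tot => k; case: (x k).
rewrite -totN; last exact: csmb_Im.
by apply: eq_tot => k; case: (x k).
Qed.

Lemma ctot_real (x : M -> R) : ctot (fun k => (x k)%:C%C) = (tot x)%:C%C.
Proof. by apply: eq_ReIm => //=; exact: tot0. Qed.

Lemma csmb_mshift m x : csmb x -> csmb (mshift m x).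
Proof.
move=> sx; apply: csmb_leR (smb_mshift m sx) => k.
by rewrite /mshift; case: ifP; rewrite ?Normc.normc0.
Qed.

Lemma ctot_mshift m x : csmb x -> ctot (mshift m x) = ctot x.
Proof.
move=> sx; apply: ctot_unique; apply: (@ccvg_shift _ (mdeg m)).
under eq_fun do rewrite tsum_mshift; exact: ctot_cvg.
Qed.

Lemma fin_supp_ctot x D : (forall k, (D <= mdeg k)%N -> x k = 0) ->
  csmb x /\ ctot x = tsum D x.
Proof.
move=> xD; split.
  by case: (@fin_supp_tot _ _ (fun k => normc (x k)) D) => // k /xD ->; exact: Normc.normc0.
apply: eq_ReIm => /=; rewrite /tsum ?Re_sum ?Im_sum.
  by case: (@fin_supp_tot _ _ (fun k => Re (x k)) D) => // k /xD ->.
by case: (@fin_supp_tot _ _ (fun k => Im (x k)) D) => // k /xD ->.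
Qed.

Lemma csmb_sum (I : Type) (r : seq I) (F : I -> M -> C) :
  (forall i, csmb (F i)) -> csmb (fun k => \sum_(i <- r) F i k).
Proof.
move=> sF; elim: r => [|i r IH].
  by apply: csmb_le csmb0 => k; rewrite big_nil.
by apply: csmb_le (csmbD (sF i) IH) => k; rewrite big_cons.
Qed.

Lemma ctot_sum (I : Type) (r : seq I) (F : I -> M -> C) :
  (forall i, csmb (F i)) ->
  ctot (fun k => \sum_(i <- r) F i k) = \sum_(i <- r) ctot (F i).
Proof.
move=> sF; elim: r => [|i r IH].
  by rewrite big_nil -[RHS]ctot0; apply: eq_ctot => k; rewrite big_nil.
rewrite big_cons -IH -ctotD //; last exact: csmb_sum.
by apply: eq_ctot => k; rewrite big_cons.
Qed.

Definition l2 a := smb (fun k => normc (a k) ^+ 2).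
(** The square of the l2 norm, so that expansions of |a + b|^2 remain polynomial identities. *)
Definition nrm a := tot (fun k => normc (a k) ^+ 2).
Definition dot a b := ctot (fun k => a k * conjc (b k)).

Lemma l2_le a b : (forall k, normc (a k) <= normc (b k)) -> l2 b -> l2 a.
Proof.
move=> ab; apply: smb_le => k.
by rewrite !ger0_norm ?sqr_ge0 // lerXn2r ?nnegrE ?normc_ge0.
Qed.

Lemma l2D a b : l2 a -> l2 b -> l2 (fun k => a k + b k).
Proof.
move=> sa sb; apply: smb_le (smbD (smbZ 2 sa) (smbZ 2 sb)) => k.
rewrite (ger0_norm (sqr_ge0 _)).
exact: le_trans (normcD2 _ _) (ler_norm _).
Qed.

Lemma l2Z c a : l2 a -> l2 (fun k => c * a k).
Proof.
move=> sa; apply: smb_le (smbZ (normc c ^+ 2) sa) => k.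
by rewrite Normc.normcM exprMn.
Qed.

Lemma l2N a : l2 a -> l2 (fun k => - a k).
Proof. by apply: l2_le => k; rewrite normcNc. Qed.

Lemma l2B a b : l2 a -> l2 b -> l2 (fun k => a k - b k).
Proof. by move=> sa sb; apply: l2D => //; exact: l2N. Qed.

Lemma l20 : l2 (fun=> 0).
Proof. by apply: smb_le (@smb0 R d) => k; rewrite Normc.normc0 expr0n. Qed.

Lemma l2_mshift m a : l2 a -> l2 (mshift m a).
Proof.
move=> sa; apply: smb_le (smb_mshift m sa) => k.
by rewrite /mshift; case: ifP; rewrite ?Normc.normc0 ?expr0n.
Qed.

Lemma csmb_dot a b : l2 a -> l2 b -> csmb (fun k => a k * conjc (b k)).
Proof.
move=> sa sb; apply: csmb_leR (smbD sa sb) => k.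
rewrite Normc.normcM normc_conj -subr_ge0.
have := sqr_ge0 (normc (a k) - normc (b k)); have := normc_ge0 (a k).
have := normc_ge0 (b k); nra.
Qed.

Lemma dotDl a a' b : l2 a -> l2 a' -> l2 b ->
  dot (fun k => a k + a' k) b = dot a b + dot a' b.
Proof.
move=> sa sa' sb; rewrite /dot -ctotD; try exact: csmb_dot.
by apply: eq_ctot => k; rewrite mulrDl.
Qed.

Lemma dotZl c a b : l2 a -> l2 b -> dot (fun k => c * a k) b = c * dot a b.
Proof.
move=> sa sb; rewrite /dot -ctotZ; last exact: csmb_dot.
by apply: eq_ctot => k; rewrite mulrA.
Qed.

Lemma dotC a b : l2 a -> l2 b -> dot b a = conjc (dot a b).
Proof.
move=> sa sb; rewrite /dot -ctot_conj; last exact: csmb_dot.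
by apply: eq_ctot => k; rewrite rmorphM /= conjcK mulrC.
Qed.

Lemma dotDr a b b' : l2 a -> l2 b -> l2 b' ->
  dot a (fun k => b k + b' k) = dot a b + dot a b'.
Proof.
move=> sa sb sb'; rewrite /dot -ctotD; try exact: csmb_dot.
by apply: eq_ctot => k; rewrite rmorphD mulrDr.
Qed.

Lemma dotZr c a b : l2 a -> l2 b -> dot a (fun k => c * b k) = conjc c * dot a b.
Proof.
move=> sa sb; rewrite /dot -ctotZ; last exact: csmb_dot.
by apply: eq_ctot => k; rewrite rmorphM mulrCA.
Qed.

Lemma dotNl a b : l2 a -> l2 b -> dot (fun k => - a k) b = - dot a b.
Proof.
move=> sa sb; rewrite -[RHS]mulN1r -dotZl //.
by apply: eq_ctot => k; rewrite mulN1r.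
Qed.

Lemma dotNr a b : l2 a -> l2 b -> dot a (fun k => - b k) = - dot a b.
Proof.
move=> sa sb; have -> : - dot a b = conjc (-1) * dot a b.
  by rewrite rmorphN1 mulN1r.
by rewrite -dotZr //; apply: eq_ctot => k; rewrite mulN1r.
Qed.

Lemma dotBl a a' b : l2 a -> l2 a' -> l2 b ->
  dot (fun k => a k - a' k) b = dot a b - dot a' b.
Proof. by move=> sa sa' sb; rewrite dotDl ?dotNl //; exact: l2N. Qed.

Lemma dotBr a b b' : l2 a -> l2 b -> l2 b' ->
  dot a (fun k => b k - b' k) = dot a b - dot a b'.
Proof. by move=> sa sb sb'; rewrite dotDr ?dotNr //; exact: l2N. Qed.

Lemma dotaa a : dot a a = (nrm a)%:C%C.
Proof. by rewrite /nrm -ctot_real; apply: eq_ctot => k; rewrite mulc_conj. Qed.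

Lemma eq_nrm a b : (forall k, a k = b k) -> nrm a = nrm b.
Proof. by move=> ab; apply: eq_tot => k; rewrite ab. Qed.

Lemma eq_dot a a' b b' : (forall k, a k = a' k) -> (forall k, b k = b' k) ->
  dot a b = dot a' b'.
Proof. by move=> ea eb; apply: eq_ctot => k; rewrite ea eb. Qed.

Lemma nrm_ge0 a : 0 <= nrm a.
Proof. by apply: tot_ge0 => k; exact: sqr_ge0. Qed.

Lemma nrmZ c a : l2 a -> nrm (fun k => c * a k) = normc c ^+ 2 * nrm a.
Proof.
move=> sa; rewrite /nrm -totZ //.
by apply: eq_tot => k; rewrite Normc.normcM exprMn.
Qed.

Lemma nrmN a : nrm (fun k => - a k) = nrm a.
Proof. by apply: eq_tot => k; rewrite normcNc. Qed.

Lemma nrmD a b : l2 a -> l2 b ->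
  nrm (fun k => a k + b k) = nrm a + nrm b + 2 * Re (dot a b).
Proof.
move=> sa sb; have sab := l2D sa sb.
have := dotaa (fun k => a k + b k).
rewrite dotDl // !dotDr // (dotC sa sb) !dotaa => /(congr1 Re).
by rewrite !ReD /= => <-; case: (dot a b) => u v /=; ring.
Qed.

Lemma nrmB a b : l2 a -> l2 b ->
  nrm (fun k => a k - b k) = nrm a + nrm b - 2 * Re (dot a b).
Proof. by move=> sa sb; rewrite nrmD ?nrmN ?dotNr ?ReN; [lra|..|exact: l2N]. Qed.

Lemma nrmD_le a b : l2 a -> l2 b ->
  nrm (fun k => a k + b k) <= 2 * nrm a + 2 * nrm b.
Proof.
move=> sa sb; have := nrm_ge0 (fun k => a k - b k).
by rewrite nrmB // nrmD //; lra.
Qed.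

Lemma nrmBC a b : nrm (fun k => a k - b k) = nrm (fun k => b k - a k).
Proof. by apply: eq_tot => k; rewrite normcBC. Qed.

Lemma nrm_eq0 a : l2 a -> nrm a = 0 -> forall k, a k = 0.
Proof.
move=> sa a0 k; apply/eqP; rewrite -normc_eq0 -sqrf_eq0; apply/eqP.
by apply: (tot_eq0 _ sa a0 k) => j; exact: sqr_ge0.
Qed.

Lemma dot_CauchySchwarz a b : l2 a -> l2 b -> normc (dot a b) ^+ 2 <= nrm a * nrm b.
Proof.
move=> sa sb; have [b0|b0] := eqVneq (nrm b) 0.
  have h := nrm_eq0 sb b0; rewrite (_ : dot a b = 0) ?Normc.normc0 ?expr0n ?b0 ?mulr0 //.
  by rewrite -[RHS]ctot0; apply: eq_ctot => k; rewrite h conjc0 mulr0.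
have bp : 0 < nrm b by rewrite lt_neqAle eq_sym b0 nrm_ge0.
(* l b is the orthogonal projection of a on the line of b; the inequality is |a - l b|^2 >= 0. *)
set l := dot a b * ((nrm b)^-1)%:C%C.
have := nrm_ge0 (fun k => a k - l * b k).
rewrite nrmB // ?nrmZ //; last exact: l2Z.
rewrite dotZr //.
have -> : Re (conjc l * dot a b) = normc (dot a b) ^+ 2 / nrm b.
  by rewrite normc2E /l; case: (dot a b) => u v /=; ring.
have -> : normc l ^+ 2 * nrm b = normc (dot a b) ^+ 2 / nrm b.
  rewrite /l Normc.normcM normc_real exprMn real_normK ?num_real //.
  by field; rewrite b0.
move=> h; rewrite -ler_pdivrMr //; lra.
Qed.

(** Bounds on finite sections suffice. This is how square summability is obtained when it is not
    known beforehand: for limits of coefficients, products with B and adjoints. *)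
Lemma nrm_fatou a B : (forall N, tsum N (fun k => normc (a k) ^+ 2) <= B) ->
  l2 a /\ nrm a <= B.
Proof.
move=> aB; have sa : l2 a by apply: (smb_ge0P _ aB) => k; exact: sqr_ge0.
by split => //; apply: tot_le.
Qed.

Lemma tsum_le_nrm N a : l2 a -> tsum N (fun k => normc (a k) ^+ 2) <= nrm a.
Proof. by move=> sa; apply: tsum_le_tot => // k; exact: sqr_ge0. Qed.

Definition trunc N a : M -> C := fun k => if (mdeg k < N)%N then a k else 0.

Lemma l2_fin a D : (forall k, (D <= mdeg k)%N -> a k = 0) -> l2 a.
Proof.
move=> aD; case: (@fin_supp_tot _ _ (fun k => normc (a k) ^+ 2) D) => // k /aD ->.
by rewrite Normc.normc0 expr0n.
Qed.

Lemma trunc_high N a k : (N <= mdeg k)%N -> trunc N a k = 0.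
Proof. by rewrite /trunc ltnNge => ->. Qed.

Lemma l2_trunc N a : l2 (trunc N a).
Proof. exact: l2_fin (@trunc_high N a). Qed.

Lemma nrm_trunc N a : nrm (trunc N a) = tsum N (fun k => normc (a k) ^+ 2).
Proof.
rewrite /nrm; case: (@fin_supp_tot _ _ (fun k => normc (trunc N a k) ^+ 2) N).
  by move=> k /trunc_high ->; rewrite Normc.normc0 expr0n.
by move=> _ ->; apply: eq_tsum => k kN; rewrite /trunc kN.
Qed.

Lemma nrm_tail_cvg a : l2 a ->
  (fun N => nrm (fun k => a k - trunc N a k)) @ \oo --> (0 : R).
Proof.
move=> sa; have := tot_trunc_cvg sa; apply: cvg_trans; apply: near_eq_cvg.
apply: nearW => N; apply: eq_tot => k; rewrite /trunc.
by case: ifP; rewrite ?subrr ?Normc.normc0 ?expr0n ?subr0.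
Qed.

Lemma dot_sumr (I : Type) (r : seq I) a (F : I -> M -> C) : l2 a ->
  (forall i, l2 (F i)) ->
  dot a (fun k => \sum_(i <- r) F i k) = \sum_(i <- r) dot a (F i).
Proof.
move=> sa sF; rewrite /dot -ctot_sum; last by move=> i; exact: csmb_dot.
by apply: eq_ctot => k; rewrite rmorph_sum mulr_sumr.
Qed.

End square_summable.

(** * Formal power series *)

Section formal_product.
Variables (R : realType) (d : nat).
Local Notation M := (multinom d).
Local Notation C := R[i].
Implicit Types (a b c : M -> C) (p q : mpoly d C).

Definition tpoly N a : mpoly d C := \sum_(k : bmultinom d N) a k *: mpolyX C k.

Lemma mcoeff_tpoly N a k : mcoeff k (tpoly N a) = trunc N a k.
Proof.
rewrite /trunc; case: ltnP => kN; first by rewrite mcoeff_mpoly.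
rewrite /tpoly raddf_sum big1 // => j _ /=; rewrite mcoeffZ mcoeffX.
case: eqP => [jk|_]; last by rewrite mulr0.
by have := bmdeg j; rewrite jk ltnNge kN.
Qed.

(** The locality that lets identities between power series be checked on polynomial truncations,
    inside the ring of polynomials. *)
Lemma mcoeffM_congr p p' q q' k :
  (forall m, (mdeg m <= mdeg k)%N -> mcoeff m p = mcoeff m p') ->
  (forall m, (mdeg m <= mdeg k)%N -> mcoeff m q = mcoeff m q') ->
  mcoeff k (p * q) = mcoeff k (p' * q').
Proof.
move=> pp' qq'; rewrite !mcoeffM; apply: eq_bigr => -[k1 k2] /= _.
by rewrite pp' ?qq' // -ltnS bmdeg.
Qed.

(* Coefficient k of a Cauchy product only involves degrees up to mdeg k. *)
Definition fmul a b : M -> C :=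
  fun k => mcoeff k (tpoly (mdeg k).+1 a * tpoly (mdeg k).+1 b).

Lemma fmulE N a b k : (mdeg k < N)%N ->
  fmul a b k = mcoeff k (tpoly N a * tpoly N b).
Proof.
move=> kN; apply: mcoeffM_congr => m mk; rewrite !mcoeff_tpoly /trunc ltnS mk;
  by rewrite (leq_ltn_trans mk kN).
Qed.

Lemma fmulC a b k : fmul a b k = fmul b a k.
Proof. by rewrite /fmul mulrC. Qed.

Lemma eq_fmul a a' b b' k : (forall m, a m = a' m) -> (forall m, b m = b' m) ->
  fmul a b k = fmul a' b' k.
Proof. by move=> /funext -> /funext ->. Qed.

(** Both sides are the coefficient k of one product of three truncations above degree [mdeg k],
    where multiplication of polynomials is associative. *)
Lemma fmulA a b c k : fmul a (fmul b c) k = fmul (fmul a b) c k.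
Proof.
rewrite [LHS]/fmul [RHS]/fmul.
set N := (mdeg k).+1.
have h x y m : (mdeg m <= mdeg k)%N ->
    mcoeff m (tpoly N (fmul x y)) = mcoeff m (tpoly N x * tpoly N y).
  by move=> mk; rewrite mcoeff_tpoly /trunc ltnS mk (fmulE (N := N)).
rewrite (@mcoeffM_congr _ (tpoly N a) _ (tpoly N b * tpoly N c)) //; last exact: h.
rewrite mulrA; apply: mcoeffM_congr => // m mk; by rewrite h.
Qed.

Definition fpoly p : M -> C := fun k => mcoeff k p.

Lemma fmul_fpoly p a k : fmul (fpoly p) a k = mcoeff k (p * tpoly (mdeg k).+1 a).
Proof.
by apply: mcoeffM_congr => // m mk; rewrite mcoeff_tpoly /trunc ltnS mk.
Qed.

Lemma fmul_fpolyM p q k : fmul (fpoly p) (fpoly q) k = fpoly (p * q) k.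
Proof.
rewrite fmul_fpoly; apply: mcoeffM_congr => // m mk.
by rewrite mcoeff_tpoly /trunc ltnS mk.
Qed.

Lemma fmul1 a k : fmul (fpoly 1) a k = a k.
Proof. by rewrite fmul_fpoly mul1r mcoeff_tpoly /trunc ltnSn. Qed.

Lemma mcoeffXM m q k : mcoeff k (mpolyX C m * q) = mshift m (fpoly q) k.
Proof.
rewrite /mshift mulrC; case: ifP => mk.
  by rewrite -{1}(submK mk) addmC mcoeffMX.
rewrite mcoeffM big1 // => -[k1 k2] /= /eqP ek; rewrite mcoeffX.
case: eqP => [mk2|_]; last by rewrite mulr0.
suff: mpoly.lem m k by rewrite mk.
by rewrite [X in mpoly.lem _ X]ek mk2 lem_addl.
Qed.

Lemma fmulX m a k : fmul (fpoly (mpolyX C m)) a k = mshift m a k.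
Proof.
rewrite fmul_fpoly mcoeffXM /mshift; case: ifP => // mk.
by rewrite /fpoly mcoeff_tpoly /trunc ltnS mdegB.
Qed.

Lemma fmul_poly p a k :
  fmul (fpoly p) a k = \sum_(m <- msupp p) mcoeff m p * mshift m a k.
Proof.
rewrite fmul_fpoly {1}(mpolyE p) mulr_suml raddf_sum /=.
apply: eq_bigr => m _; rewrite -scalerAl mcoeffZ; congr (_ * _).
by rewrite -fmulX fmul_fpoly.
Qed.

Lemma tpolyD N a b : tpoly N (fun k => a k + b k) = tpoly N a + tpoly N b.
Proof. by rewrite -big_split; apply: eq_bigr => k _; rewrite scalerDl. Qed.

Lemma tpolyZ N (z : C) a : tpoly N (fun k => z * a k) = z *: tpoly N a.
Proof. by rewrite scaler_sumr; apply: eq_bigr => k _; rewrite scalerA. Qed.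

Lemma fmulDr a b c k : fmul a (fun k => b k + c k) k = fmul a b k + fmul a c k.
Proof. by rewrite /fmul tpolyD mulrDr mcoeffD. Qed.

Lemma fmulZr a (z : C) b k : fmul a (fun k => z * b k) k = z * fmul a b k.
Proof. by rewrite /fmul tpolyZ -scalerAr mcoeffZ. Qed.

Lemma fmulNr a b k : fmul a (fun k => - b k) k = - fmul a b k.
Proof.
rewrite -[RHS]mulN1r -fmulZr; apply: eq_fmul => // m; by rewrite mulN1r.
Qed.

Lemma fmulBr a b c k : fmul a (fun k => b k - c k) k = fmul a b k - fmul a c k.
Proof. by rewrite fmulDr fmulNr. Qed.

Lemma fmul_at0 a b : fmul a b (@mnm0 d) = a (@mnm0 d) * b (@mnm0 d).
Proof.
rewrite /fmul rmorphM /= !mcoeff_tpoly /trunc !mdeg0 //.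
Qed.

Lemma fmul_trunc a b N k : (mdeg k < N)%N -> fmul a (trunc N b) k = fmul a b k.
Proof.
move=> kN; apply: mcoeffM_congr => // m mk.
by rewrite !mcoeff_tpoly /trunc ltnS mk (leq_ltn_trans mk kN).
Qed.

Lemma fmul_fpoly_tpoly b N a k : fmul b (fpoly (tpoly N a)) k =
  \sum_(m : bmultinom d N) a m * mshift m b k.
Proof.
rewrite fmulC fmul_fpoly mulr_suml raddf_sum /=.
apply: eq_bigr => m _; rewrite -scalerAl mcoeffZ; congr (_ * _).
by rewrite -fmulX fmul_fpoly.
Qed.

Lemma fpoly_tpoly N a k : fpoly (tpoly N a) k = trunc N a k.
Proof. exact: mcoeff_tpoly. Qed.

(** Without constant term p has order at least 1, so p^j has order at least j. *)
Lemma mcoeff_expr_low p j k : mcoeff (@mnm0 d) p = 0 -> (mdeg k < j)%N ->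
  mcoeff k (p ^+ j) = 0.
Proof.
move=> p0; elim: j k => // j IH k kj.
rewrite exprS mcoeffM big1 // => -[[k1 ?] [k2 ?]] /= /eqP ek.
have [->|k10] := eqVneq k1 (@mnm0 d); first by rewrite p0 mul0r.
rewrite IH ?mulr0 //; move: (congr1 (@mdeg d) ek) kj; rewrite mdegD => ->.
have : (0 < mdeg k1)%N by rewrite lt0n mdeg_eq0.
by case: (mdeg k1) => // n _; rewrite addSn !ltnS => /(leq_ltn_trans _); apply; rewrite leq_addl.
Qed.

(* 1/p = p_0^-1 \sum_j (1 - p/p_0)^j; the terms j > mdeg k do not contribute to
   coefficient k. *)
Definition psinv p : M -> C := fun k =>
  let q := 1 - (mcoeff (@mnm0 d) p)^-1 *: p in
  (mcoeff (@mnm0 d) p)^-1 * \sum_(j < (mdeg k).+1) mcoeff k (q ^+ j).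

Lemma psinv_at0 p : psinv p (@mnm0 d) = (mcoeff (@mnm0 d) p)^-1.
Proof. by rewrite /psinv mdeg0 big_ord1 expr0 mcoeff1 eqxx mulr1. Qed.

Lemma fmul_psinv p k : mcoeff (@mnm0 d) p != 0 ->
  fmul (fpoly p) (psinv p) k = fpoly 1 k.
Proof.
move=> p0; set N := (mdeg k).+1; set q := 1 - (mcoeff (@mnm0 d) p)^-1 *: p.
have q0 : mcoeff (@mnm0 d) q = 0.
  by rewrite mcoeffB mcoeff1 eqxx mcoeffZ mulVf ?subrr.
rewrite fmul_fpoly.
rewrite (@mcoeffM_congr _ p _ ((mcoeff (@mnm0 d) p)^-1 *: \sum_(j < N) q ^+ j)) //.
  rewrite -scalerAr scalerAl.
  (* p / p_0 = 1 - q, so the geometric sum telescopes to 1 - q^N, and q^N has no coefficient of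
     degree [mdeg k] < N. *)
  rewrite (_ : _ *: p = - (q - 1)); last by rewrite /q opprB subKr.
  rewrite mulNr -subrX1 opprB mcoeffB mcoeff_expr_low ?subr0 //.
move=> m mk; rewrite mcoeff_tpoly /trunc ltnS mk mcoeffZ raddf_sum /=; congr (_ * _).
rewrite (big_ord_widen N (fun j => mcoeff m (q ^+ j))) 1?ltnS // big_mkcond.
apply: eq_bigr => j _; case: ltnP => // mj.
by rewrite mcoeff_expr_low.
Qed.

(* The product of the smallest monomials of the two factors, for a monomial
   order, occurs in the product. *)
Lemma fmul_fpoly_inj p a : p != 0 -> (forall k, fmul (fpoly p) a k = 0) ->
  forall k, a k = 0.
Proof.
move=> p0 pa0 k0; apply: contrapT => ak0.
have [k [ak kmin]] : exists k, a k <> 0 /\ forall j, (j < k)%O -> a j = 0.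
  elim/(well_founded_ind (@ltom_wf d)) : k0 ak0 => k IH ak.
  have [h|/existsNP[j /not_implyP[jk aj]]] := pselect (forall j, (j < k)%O -> a j = 0).
    by exists k.
  exact: IH aj.
set m := mlast p; have := pa0 (mnm_add m k).
rewrite fmul_fpoly mcoeffM.
have dm : (mdeg m < (mdeg (mnm_add m k)).+1)%N by rewrite ltnS mdegD leq_addr.
have dk : (mdeg k < (mdeg (mnm_add m k)).+1)%N by rewrite ltnS mdegD leq_addl.
rewrite (bigD1 (BMultinom dm, BMultinom dk)) //= mcoeff_tpoly /trunc dk.
rewrite big1 ?addr0.
  move/eqP; rewrite mulf_eq0 => /orP[|/eqP //].
  by rewrite mcoeff_eq0 mlast_supp.
move=> -[[k1 ?] [k2 ?]] /= /andP[/eqP ek nk].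
have [k1m|mk1] := ltP k1 m; first by rewrite mcoeff_lt_mlast // mul0r.
have [k2k|kk2] := ltP k2 k.
  by rewrite mcoeff_tpoly /trunc (kmin _ k2k) if_same mulr0.
move: mk1; rewrite le_eqVlt => /orP[/eqP mk1|mk1].
  have kk : k2 = k by apply: (@addmI d m); rewrite ek -mk1.
  case/negP: nk; rewrite xpair_eqE -!val_eqE /= -mk1 kk !eqxx //.
by have := ltmc_le_add mk1 kk2; rewrite ek ltxx.
Qed.

End formal_product.

#[global] Opaque fmul psinv.

(** * Fourier analysis on the torus *)

Section characters_integral.
Variable R : realType.
Local Notation T := (measurableTypeR R).

(** [angle_measure1] is defined on the whole line and gives mass 0 to the complement of [0, 2 pi];
    the integral is brought to the interval, where the fundamental theorem of calculus applies. *)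
Lemma integral_angle_measure1 (f : T -> \bar R) :
  (@angle_measure1 R).-integrable setT f ->
  (\int[@angle_measure1 R]_x f x = \int[@lebesgue_measure R]_(x in `[0%R, (2 * pi)%R]) f x)%E.
Proof.
move=> intf.
have mD := @measurable_angle_interval R.
rewrite (negligible_integral (N := ~` @angle_interval R)) //; last 2 first.
- exact: measurableC.
- rewrite [LHS](_ : _ = @lebesgue_measure R (~` @angle_interval R `&` @angle_interval R)) //.
  by rewrite setICl measure0.
rewrite setDE setCK setTI.
rewrite (_ : @angle_interval R = [set` `[0, 2 * pi]%R]); last first.
  by apply/seteqP; split => x; rewrite /= in_itv.
apply: eq_measure_integral => A mA AD.
rewrite [LHS](_ : _ = @lebesgue_measure R (A `&` @angle_interval R)) //.
by rewrite setIidl // => x /AD /=; rewrite in_itv.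
Qed.

Lemma angle_measure1_lty : (@angle_measure1 R setT < +oo)%E.
Proof.
rewrite [ltLHS](_ : _ = @lebesgue_measure R (setT `&` @angle_interval R)) //.
by rewrite setTI angle_interval_lty.
Qed.

Lemma cos_affine_continuous (phi a : R) : continuous (fun x : R => cos (phi + a * x)).
Proof.
move=> x; apply: (@continuous_comp _ _ _ (fun x : R => phi + a * x) cos); last exact: continuous_cos.
by apply: cvgD; [exact: cvg_cst|apply: cvgMr; exact: cvg_id].
Qed.

Lemma integrable_cos_affine (phi a : R) :
  (@angle_measure1 R).-integrable setT (fun x : T => (cos (phi + a * x))%:E).
Proof.
apply: measurable_bounded_integrable => //.
- exact: angle_measure1_lty.
- apply: (@continuous_measurable_fun R (fun x => cos (phi + a * x))).
  exact: cos_affine_continuous.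
- exists 1; split => // y y1 x _ /=; exact: le_trans (cos_max _) (ltW y1).
Qed.

Lemma sin_periodicn (x : R) (n : nat) : sin (x + n%:R * (2 * pi)) = sin x.
Proof.
rewrite mulr_natl [2 * pi]mulr_natl; exact: (periodicn (@sinD2pi R)).
Qed.

Lemma integral_cos_affine (phi : R) (k l : nat) :
  (\int[@angle_measure1 R]_x (cos (phi + (k%:R - l%:R) * x))%:E =
   (if k == l then 2 * pi * cos phi else 0)%:E)%E.
Proof.
have pi2 : 0 < 2 * pi :> R by rewrite mulr_gt0 ?pi_gt0.
rewrite integral_angle_measure1; last exact: integrable_cos_affine.
case: eqP => [->|/eqP kl].
  under eq_integral do rewrite subrr mul0r addr0.
  rewrite integral_cst //= lebesgue_measure_itv /= lte_fin pi2.
  by rewrite oppr0 adde0 -EFinM mulrC.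
set a : R := k%:R - l%:R; have a0 : a != 0 by rewrite subr_eq0 eqr_nat.
pose F x : R := a^-1 * sin (phi + a * x).
have dF (x : R) : is_derive x 1 F (cos (phi + a * x)).
  rewrite /F; apply: is_derive_eq.
  rewrite /GRing.scale /=; field; rewrite ?a0 //.
rewrite (@continuous_FTC2 _ _ F) //.
- rewrite /F mulr0 addr0 -EFinB -mulrBr; congr (_%:E).
  rewrite (_ : sin (phi + a * (2 * pi)) = sin phi) ?subrr ?mulr0 //.
  (* The phases differ by (k - l) periods, of unknown sign: l periods are added on one side and k on
     the other. *)
  rewrite -(sin_periodicn (phi + a * (2 * pi)) l) -(sin_periodicn phi k).
  by congr sin; rewrite /a; ring.
- exact/continuous_subspaceT/cos_affine_continuous.
- have cF : continuous F.
    by move=> x; apply/differentiable_continuous/derivable1_diffP; case: (dF x).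
  split.
  + by move=> x _; case: (dF x).
  + exact/cvg_at_right_filter/cF.
  + exact/cvg_at_left_filter/cF.
- by move=> x _; rewrite derive1E; case: (dF x).
Qed.

End characters_integral.

Section torus_characters.
Variable R : realType.
Local Notation T := (measurableTypeR R).

Lemma angle_measure_lty d : (angle_measure R d setT < +oo)%E.
Proof. by rewrite ltey_eq fin_num_measure. Qed.

Lemma product_angle_measure_lty d :
  ((@angle_measure1 R \x angle_measure R d)%E setT < +oo)%E.
Proof.
rewrite -setXTT product_measure1E // lte_mul_pinfty ?fin_num_measure //.
exact: angle_measure_lty.
Qed.

Lemma measurable_linear_angle d (a : 'I_d -> R) (phi : R) :
  measurable_fun setT (fun t : d.-tuple T => phi + \sum_i a i * tnth t i).
Proof.
apply: measurable_funD => //; apply: measurable_sum => i.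
by apply: measurable_funM => //; exact: measurable_tnth.
Qed.

Lemma measurable_cos : measurable_fun setT (@cos R).
Proof. by apply: continuous_measurable_fun; exact: continuous_cos. Qed.

Lemma measurable_cos_linear d (a : 'I_d -> R) (phi : R) :
  measurable_fun setT (fun t : d.-tuple T => cos (phi + \sum_i a i * tnth t i)).
Proof.
by apply: (measurableT_comp measurable_cos); exact: measurable_linear_angle.
Qed.

Lemma integrable_cos_bounded (dd : measure_display) (X : measurableType dd)
    (mu : {measure set X -> \bar R}) (f : X -> R) : (mu setT < +oo)%E ->
  measurable_fun setT f -> mu.-integrable setT (fun x => (cos (f x))%:E).
Proof.
move=> mu_oo mf; apply: measurable_bounded_integrable => //.
- exact: (measurableT_comp measurable_cos).
- exists 1; split => // y y1 x _ /=; exact: le_trans (cos_max _) (ltW y1).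
Qed.

(* The phase phi makes the statement inductive: integrating out all the
   variables but one leaves a cosine of the same shape. *)
Lemma integral_character d (phi : R) (k l : 'I_d -> nat) :
  (\int[angle_measure R d]_t
     (cos (phi + \sum_i ((k i)%:R - (l i)%:R) * tnth t i))%:E =
   (if [forall i, k i == l i] then (2 * pi) ^+ d * cos phi else 0)%:E)%E.
Proof.
elim: d phi k l => [|d IH] phi k l.
  rewrite /= integral_dirac //; last by apply/measurable_EFinP; exact: measurable_cos_linear.
  rewrite diracT mul1e big_ord0 addr0 expr0 mul1r.
  by case: ifP => // /forallP[]; case.
rewrite /= /angle_measure_cons.
have mcons : measurable_fun setT (@angle_cons R d) by exact: measurable_cons.
have mf := @measurable_cos_linear d.+1 (fun i => (k i)%:R - (l i)%:R) phi.
have intf : (@angle_measure1 R \x angle_measure R d)%E.-integrable setT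
    ((fun t : d.+1.-tuple T =>
      (cos (phi + \sum_i ((k i)%:R - (l i)%:R) * tnth t i))%:E) \o @angle_cons R d).
  apply: (@integrable_cos_bounded _ _ _ (fun x : T * d.-tuple T =>
    phi + \sum_i ((k i)%:R - (l i)%:R) * tnth (angle_cons x) i)).
    exact: product_angle_measure_lty.
  apply: (@measurableT_comp _ _ _ _ _ _
    (fun t : d.+1.-tuple T => phi + \sum_i ((k i)%:R - (l i)%:R) * tnth t i)) => //.
  exact: measurable_linear_angle.
rewrite (integral_pushforward mcons) //; last exact/measurable_EFinP.
rewrite preimage_setT -integral12_prod_meas1 //.
(* Fubini: for fixed x the inner integral is the induction hypothesis with phase phi + (k_0 - l_0)
   x. *)
transitivity (\int[@angle_measure1 R]_x
  ((if [forall i : 'I_d, k (lift ord0 i) == l (lift ord0 i)] then (2 * pi) ^+ d else 0)%:E *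
    (cos (phi + ((k ord0)%:R - (l ord0)%:R) * x))%:E))%E.
  apply: eq_integral => x _; rewrite /fubini_F /=.
  rewrite -EFinM; under eq_integral.
    move=> t _; rewrite big_ord_recl /= (_ : tnth _ ord0 = x) // addrA.
    rewrite (eq_bigr (fun i => ((k (lift ord0 i))%:R - (l (lift ord0 i))%:R) * tnth t i)); last first.
      by move=> i _; congr (_ * _); rewrite (_ : tnth _ (lift ord0 i) = tnth t i) // tnthS.
    over.
  rewrite /= IH; case: ifP => // _; by rewrite mul0r.
rewrite integralZl //; last exact: integrable_cos_affine.
rewrite integral_cos_affine -EFinM; congr (_%:E).
have -> : [forall i, k i == l i] =
    (k ord0 == l ord0) && [forall i : 'I_d, k (lift ord0 i) == l (lift ord0 i)].
  apply/forallP/andP => [h|[h0 /forallP h] i]; first by split; [|apply/forallP].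
  by case: (unliftP ord0 i) => [j ->|->].
by case: eqP => _ /=; case: ifP => _; rewrite ?mulr0 ?mul0r // exprSr -!mulrA.
Qed.

End torus_characters.

Section finite_integral.
Context (dd : measure_display) (X : measurableType dd) (R : realType).
Variable mu : {measure set X -> \bar R}.

(** Integrability travels with the value, as additivity of the integral requires it at each use. *)
Definition hasint (f : X -> R) (v : R) : Prop :=
  mu.-integrable setT (EFin \o f) /\ (\int[mu]_x (f x)%:E = v%:E)%E.

Lemma hasintD f g u v : hasint f u -> hasint g v -> hasint (fun x => f x + g x) (u + v).
Proof.
move=> [intf fu] [intg gv]; split.
  rewrite (_ : _ \o _ = (EFin \o f) \+ (EFin \o g))%E; first exact: integrableD.
  by apply/funext => x; rewrite /= EFinD.
under eq_integral do rewrite EFinD.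
by rewrite integralD // fu gv.
Qed.

Lemma hasintZ c f u : hasint f u -> hasint (fun x => c * f x) (c * u).
Proof.
move=> [intf fu]; split.
  rewrite (_ : _ \o _ = fun x => c%:E * (f x)%:E)%E; first exact: integrableZl.
  by apply/funext => x; rewrite /= EFinM.
under eq_integral do rewrite EFinM.
by rewrite integralZl // fu.
Qed.

Lemma hasint0 : hasint (fun=> 0) 0.
Proof. by split; [exact: integrable0|rewrite integral0]. Qed.

Lemma hasint_sum (I : Type) (r : seq I) (f : I -> X -> R) (v : I -> R) :
  (forall i, hasint (f i) (v i)) ->
  hasint (fun x => \sum_(i <- r) f i x) (\sum_(i <- r) v i).
Proof.
move=> fv; elim: r => [|i r IH].
  rewrite big_nil (_ : (fun x => _) = fun=> 0); first exact: hasint0.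
  by apply/funext => x; rewrite big_nil.
rewrite big_cons (_ : (fun x => _) = fun x => f i x + \sum_(j <- r) f j x).
  exact: hasintD.
by apply/funext => x; rewrite big_cons.
Qed.

Lemma hasint_ext f g u v : (forall x, f x = g x) -> u = v -> hasint f u -> hasint g v.
Proof. by move=> /funext -> ->. Qed.

End finite_integral.

Section measurable_complex.
Context (dd : measure_display) (X : measurableType dd) (R : realType).
Local Notation C := R[i].
Local Notation normc := (@Normc.normc R).
Implicit Types f g : X -> C.

Definition cmeas f := measurable_fun setT (fun x => complex.Re (f x)) /\
  measurable_fun setT (fun x => complex.Im (f x)).

Lemma cmeas_cst (c : C) : cmeas (fun=> c).
Proof. by split; exact: measurable_cst. Qed.

Lemma cmeasD f g : cmeas f -> cmeas g -> cmeas (fun x => f x + g x).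
Proof.
move=> [rf jf] [rg jg]; split.
  by under eq_fun do rewrite ReD; exact: measurable_funD.
by under eq_fun do rewrite ImD; exact: measurable_funD.
Qed.

Lemma cmeasM f g : cmeas f -> cmeas g -> cmeas (fun x => f x * g x).
Proof.
move=> [rf jf] [rg jg]; split.
  under eq_fun do rewrite cReM.
  by apply: measurable_funB; exact: measurable_funM.
under eq_fun do rewrite cImM.
by apply: measurable_funD; exact: measurable_funM.
Qed.

Lemma cmeasB f g : cmeas f -> cmeas g -> cmeas (fun x => f x - g x).
Proof.
move=> mf mg; have -> : (fun x => f x - g x) = (fun x => f x + (-1) * g x).
  by apply/funext => x; rewrite mulN1r.
by apply: cmeasD => //; apply: cmeasM => //; exact: cmeas_cst.
Qed.

Lemma cmeas_sum (I : Type) (r : seq I) (F : I -> X -> C) :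
  (forall i, cmeas (F i)) -> cmeas (fun x => \sum_(i <- r) F i x).
Proof.
move=> mF; elim: r => [|i r IH].
  by under eq_fun do rewrite big_nil; exact: cmeas_cst.
by under eq_fun do rewrite big_cons; exact: cmeasD.
Qed.

Lemma cmeas_cvg (F : nat -> X -> C) f : (forall n, cmeas (F n)) ->
  (forall x, ccvg (F^~ x) (f x)) -> cmeas f.
Proof.
move=> mF Ff; split.
  apply: (@measurable_fun_cvg _ _ _ _ (fun n x => complex.Re (F n x))) => //.
    by move=> n; case: (mF n).
  by move=> x _; case/ccvgP : (Ff x).
apply: (@measurable_fun_cvg _ _ _ _ (fun n x => complex.Im (F n x))) => //.
  by move=> n; case: (mF n).
by move=> x _; case/ccvgP : (Ff x).
Qed.

Lemma measurable_normc2 f : cmeas f -> measurable_fun setT (fun x => normc (f x) ^+ 2).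
Proof.
move=> [rf jf]; under eq_fun do rewrite normc2E.
by apply: measurable_funD; exact: measurable_funX.
Qed.

End measurable_complex.

Section parseval.
Variables (R : realType) (d : nat).
Local Notation T := (measurableTypeR R).
Local Notation M := (multinom d).
Local Notation C := R[i].
Local Notation normc := (@Normc.normc R).
Local Notation mu := (angle_measure R d).

Definition cis (x : R) : C := Complex (cos x) (sin x).

Lemma cisD x y : cis (x + y) = cis x * cis y.
Proof. by rewrite /cis sinD cosD; apply: eq_ReIm => //=; ring. Qed.

Lemma cis0 : cis 0 = 1.
Proof. by rewrite /cis sin0 cos0. Qed.

Lemma cis_conj x : conjc (cis x) = cis (- x).
Proof. by rewrite /cis sinN cosN. Qed.

Lemma cis_sum (I : Type) (r : seq I) (F : I -> R) :
  cis (\sum_(i <- r) F i) = \prod_(i <- r) cis (F i).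
Proof. exact: (big_morph cis cisD cis0). Qed.

Lemma cisX x n : cis x ^+ n = cis (n%:R * x).
Proof.
elim: n => [|n IH]; first by rewrite expr0 mul0r cis0.
by rewrite exprS IH -cisD -natr1 mulrDl mul1r addrC.
Qed.

Lemma normc_cis x : normc (cis x) = 1.
Proof. by rewrite /= cos2Dsin2 sqrtr1. Qed.

Definition echar (k : M) (t : d.-tuple T) : C := mmap1 (torus_point 1 t) k.

Lemma torus_pointE r (t : d.-tuple T) i :
  torus_point r t i = (r%:C)%C * cis (tnth t i).
Proof. by apply: eq_ReIm => /=; ring. Qed.

Lemma mmap1_torus r t k : mmap1 (torus_point r t) k = ((r ^+ mdeg k)%:C)%C * echar k t.
Proof.
rewrite /echar /mmap1 mdegE -prodrXr rmorph_prod -big_split /=.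
apply: eq_bigr => i _; rewrite !torus_pointE mul1r exprMn.
by rewrite rmorphXn.
Qed.

Lemma echarE k t : echar k t = cis (\sum_i (k i)%:R * tnth t i).
Proof.
rewrite cis_sum; apply: eq_bigr => i _.
by rewrite torus_pointE mul1r cisX.
Qed.

Lemma normc_echar k t : normc (echar k t) = 1.
Proof. by rewrite echarE normc_cis. Qed.

Lemma echar_conjM k l t :
  echar k t * conjc (echar l t) = cis (\sum_i ((k i)%:R - (l i)%:R) * tnth t i).
Proof.
rewrite !echarE cis_conj -cisD -sumrN -big_split /=; congr cis.
by apply: eq_bigr => i _; rewrite mulrBl.
Qed.

Lemma hasint_Re_character (z : C) (k l : M) :
  hasint mu (fun t => complex.Re (z * (echar k t * conjc (echar l t))))
    (if k == l then (2 * pi) ^+ d * complex.Re z else 0).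
Proof.
have hc phi : hasint mu
    (fun t => cos (phi + \sum_i ((k i)%:R - (l i)%:R) * tnth t i))
    (if k == l then (2 * pi) ^+ d * cos phi else 0).
  split.
    apply: (@integrable_cos_bounded _ _ _ _ (fun t : d.-tuple T =>
      phi + \sum_i ((k i)%:R - (l i)%:R) * tnth t i)).
      exact: angle_measure_lty.
    exact: measurable_linear_angle.
  rewrite integral_character; congr (if _ then _ else _)%:E.
  apply/forallP/eqP => [kl|-> //]; apply/mnmP => i; exact/eqP.
(* Re (z e^{iu}) = Re z cos u - Im z sin u, and sin u = cos (u - pi/2): both terms are cosines with
   a phase. *)
apply: hasint_ext (hasintD (hasintZ (complex.Re z) (hc 0))
  (hasintZ (- complex.Im z) (hc (- (pi / 2))))).
  move=> t; rewrite echar_conjM add0r [- (pi / 2) + _]addrC cosBpihalf.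
  by case: z => x y /=; ring.
rewrite cos0 cosN cos_pihalf; case: ifP => _; ring.
Qed.

Lemma normc2_sum (I : Type) (r : seq I) (F : I -> C) :
  normc (\sum_(i <- r) F i) ^+ 2 =
  \sum_(i <- r) \sum_(j <- r) complex.Re (F i * conjc (F j)).
Proof.
transitivity (complex.Re ((\sum_(i <- r) F i) * conjc (\sum_(i <- r) F i))).
  by rewrite mulc_conj.
rewrite rmorph_sum mulr_suml Re_sum; apply: eq_bigr => i _.
by rewrite mulr_sumr Re_sum.
Qed.

Lemma parseval_finite N (a : M -> C) :
  hasint mu (fun t => normc (tsum N (fun k => a k * echar k t)) ^+ 2)
    ((2 * pi) ^+ d * tsum N (fun k => normc (a k) ^+ 2)).
Proof.
have := hasint_sum (index_enum (bmultinom d N)) (fun k : bmultinom d N =>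
  hasint_sum (index_enum (bmultinom d N)) (fun l : bmultinom d N =>
  hasint_Re_character (a k * conjc (a l)) k l)).
apply: hasint_ext => [t|].
  rewrite /tsum normc2_sum; apply: eq_bigr => k _; apply: eq_bigr => l _.
  by rewrite rmorphM mulrACA.
rewrite /tsum mulr_sumr; apply: eq_bigr => k _.
rewrite (bigD1 k) //= eqxx mulc_conj /= big1 ?addr0 // => l lk.
by case: eqP => // kl; rewrite -val_eqE /= kl eqxx in lk.
Qed.

Lemma cmeas_echar k : cmeas (fun t => echar k t).
Proof.
have mc phi := measurable_cos_linear (fun i => (k i)%:R) phi.
split.
  rewrite (_ : (fun t => _) =
      (fun t : d.-tuple T => cos (0 + \sum_i (k i)%:R * tnth t i))) //.
  by apply/funext => t; rewrite echarE /= add0r.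
rewrite (_ : (fun t => _) =
    (fun t : d.-tuple T => cos (- (pi / 2) + \sum_i (k i)%:R * tnth t i))) //.
by apply/funext => t; rewrite echarE /= addrC cosBpihalf.
Qed.

Lemma cmeas_tsum N (a : M -> C) : cmeas (fun t => tsum N (fun k => a k * echar k t)).
Proof.
apply: (@cmeas_sum _ _ _ _ _ (fun k t => a (bmnm k) * echar (bmnm k) t)) => k.
by apply: cmeasM; [exact: cmeas_cst|exact: cmeas_echar].
Qed.

(** By conversion this is [ev a (torus_point 1 t)], so the algebra of [ev] also serves on the torus
    when a is absolutely summable. *)
Definition bsum (a : M -> C) (t : d.-tuple T) : C := ctot (fun k => a k * echar k t).

Lemma csmb_char (a : M -> C) t : csmb a -> csmb (fun k => a k * echar k t).
Proof. by apply: csmb_le => k; rewrite Normc.normcM normc_echar mulr1. Qed.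

Lemma bsum_cvg (a : M -> C) t : csmb a ->
  ccvg (fun N => tsum N (fun k => a k * echar k t)) (bsum a t).
Proof. by move=> sa; apply: ctot_cvg; exact: csmb_char. Qed.

Lemma cmeas_bsum a : csmb a -> cmeas (bsum a).
Proof.
move=> sa; apply: (@cmeas_cvg _ _ _ (fun N t => tsum N (fun k => a k * echar k t))).
  by move=> N; exact: cmeas_tsum.
by move=> t; exact: bsum_cvg.
Qed.

(** Each |a_k| is at most the total sum A, whence |a_k|^2 <= A |a_k|. *)
Lemma csmb_l2 (a : M -> C) : csmb a -> l2 a.
Proof.
move=> sa; apply: smb_le (smbZ (tot (fun k => normc (a k))) sa) => k.
have h := le_term_tot k (fun k => normc_ge0 (a k)) sa.
rewrite (ger0_norm (sqr_ge0 _)) expr2; apply: le_trans (ler_norm _).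
by rewrite ler_wpM2r ?normc_ge0.
Qed.

(** The partial sums are bounded by A = sum |a_k| uniformly on the torus, and the constant A^2 is
    integrable there: dominated convergence extends [parseval_finite]. *)
Lemma parseval (a : M -> C) : csmb a ->
  hasint mu (fun t => normc (bsum a t) ^+ 2) ((2 * pi) ^+ d * nrm a).
Proof.
move=> sa; set A : R := tot (fun k => normc (a k)).
have A0 : 0 <= A by apply: tot_ge0 => k; exact: normc_ge0.
have bA N t : normc (tsum N (fun k => a k * echar k t)) <= A.
  apply: le_trans (normc_sum _ _ _) _.
  under eq_bigr do rewrite Normc.normcM normc_echar mulr1.
  by apply: tsum_le_tot => // k; exact: normc_ge0.
have mf N : measurable_fun setT
    (fun t => (normc (tsum N (fun k => a k * echar k t)) ^+ 2)%:E).
  by apply/measurable_EFinP; apply: measurable_normc2; exact: cmeas_tsum.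
have [] := @dominated_convergence _ _ _ mu setT measurableT
  (fun N t => (normc (tsum N (fun k => a k * echar k t)) ^+ 2)%:E)
  (fun t => (normc (bsum a t) ^+ 2)%:E) (fun=> (A ^+ 2)%:E) mf.
- by apply/measurable_EFinP; apply: measurable_normc2; exact: cmeas_bsum.
- apply: aeW => t _; apply: cvg_EFin; first exact: nearW.
  rewrite (_ : _ \o _ = fun N => normc (tsum N (fun k => a k * echar k t)) ^+ 2) //.
  by apply: cvgM; apply: normc_ccvg; exact: bsum_cvg.
- exact: (@finite_measure_integrable_cst _ _ _ mu).
- apply: aeW => t N _ /=; rewrite lee_fin ger0_norm ?sqr_ge0 //.
  by rewrite lerXn2r ?nnegrE ?normc_ge0.
move=> intf _ cvf; split => //.
apply: (cvg_unique _ cvf) => //.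
rewrite (_ : (fun N => _) =
  fun N => ((2 * pi) ^+ d * tsum N (fun k => normc (a k) ^+ 2))%:E); last first.
  by apply/funext => N; exact: (parseval_finite N a).2.
apply: cvg_EFin; first exact: nearW.
apply: cvgMr; exact: (smb_cvg (csmb_l2 sa)).
Qed.

End parseval.

(** * Power series on the polydisk *)

Section power_series_evaluation.
Variables (R : realType) (d : nat).
Local Notation M := (multinom d).
Local Notation C := R[i].
Local Notation normc := (@Normc.normc R).
Implicit Types (a b : M -> C) (z : 'I_d -> C).

Lemma polydiskP z : polydisk z <-> forall i, normc (z i) < 1.
Proof. by split=> h i; have := h i; rewrite /= ltcR. Qed.

Lemma ler_sum_uniq (I : eqType) (s t : seq I) (F : I -> R) :
  uniq s -> uniq t -> {subset s <= t} -> (forall i, 0 <= F i) ->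
  \sum_(i <- s) F i <= \sum_(i <- t) F i.
Proof.
move=> us ut st F0.
have pst : perm_eq s [seq i <- t | i \in s].
  apply: uniq_perm => //; first exact: filter_uniq.
  move=> i; rewrite mem_filter; case si : (i \in s) => //=.
  by rewrite st.
rewrite (perm_big _ pst) /= big_filter [leRHS](bigID (mem s)) /= lerDl.
exact: sumr_ge0.
Qed.

Definition deg_seq N : seq M := [seq bmnm k | k <- index_enum (bmultinom d N)].

Lemma uniq_deg_seq N : uniq (deg_seq N).
Proof. by rewrite map_inj_uniq ?index_enum_uniq //; exact: val_inj. Qed.

Lemma mem_deg_seq N k : (mdeg k < N)%N -> k \in deg_seq N.
Proof.
by move=> kN; apply/mapP; exists (BMultinom kN) => //; rewrite mem_index_enum.
Qed.

Lemma tsum_deg_seq (V : nmodType) N (x : M -> V) :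
  tsum N x = \sum_(k <- deg_seq N) x k.
Proof. by rewrite big_map. Qed.

(** Every finite set of multi-indices lies below some total degree, so unordered sums and degree
    cut-offs have the same upper bounds. *)
Lemma csmb_esum (x : M -> C) :
  (\esum_(k in [set: M]) (normc (x k))%:E < +oo)%E <-> csmb x.
Proof.
have x0 k : 0 <= normc (x k) by exact: normc_ge0.
split=> [xoo|[B xB]].
  have xN N : ((tsum N (fun k => normc (x k)))%:E <=
      \esum_(k in [set: M]) (normc (x k))%:E)%E.
    apply: esum_ge; exists [set` deg_seq N]; first by split => //; exact: finite_seq.
    by rewrite -fsbig_seq ?uniq_deg_seq // tsum_deg_seq sumEFin.
  have xfin : (\esum_(k in [set: M]) (normc (x k))%:E)%E \is a fin_num.
    by rewrite ge0_fin_numE //; apply: esum_ge0 => k _; rewrite lee_fin.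
  apply: (@smb_ge0P _ _ _ (fine (\esum_(k in [set: M]) (normc (x k))%:E)%E)) => // N.
  by rewrite -lee_fin fineK.
apply: le_lt_trans (ltry B).
apply: ge_ereal_sup => _ [A [Af _] <-].
rewrite fsbig_finite // sumEFin lee_fin.
set s := finmap.enum_fset _.
apply: le_trans (xB (\max_(k <- s) mdeg k).+1).
under eq_tsum do rewrite ger0_norm //.
rewrite tsum_deg_seq; apply: ler_sum_uniq => //.
- exact: finmap.fset_uniq.
- exact: uniq_deg_seq.
- by move=> k ks; apply: mem_deg_seq; rewrite ltnS; exact: leq_bigmax_seq.
Qed.

(** Multi-indices of degree at most N embed in the cube {0, ..., N}^d, over which the sum factors
    into d one-variable geometric sums. *)
Lemma tsum_geometric_le N (r : 'I_d -> R) : (forall i, 0 <= r i < 1) ->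
  tsum N (fun k => \prod_i r i ^+ k i) <= \prod_i (1 - r i)^-1.
Proof.
move=> r01; have r0 i : 0 <= r i by case/andP : (r01 i).
case: N => [|N].
  rewrite [leLHS]big1 => [|k _]; last by have := bmdeg k.
  by apply: prodr_ge0 => i _; rewrite invr_ge0 subr_ge0 ltW //; case/andP : (r01 i).
pose h (k : bmultinom d N.+1) : {ffun 'I_d -> 'I_N.+1} := [ffun i => inord (k i)].
have kiN (k : bmultinom d N.+1) i : (k i < N.+1)%N.
  apply: leq_ltn_trans (bmdeg k); rewrite mdegE (bigD1 i) //=.
  by rewrite leq_addr.
have h_inj : injective h.
  move=> k l /ffunP kl; apply/val_inj/mnmP => i.
  by have := congr1 val (kl i); rewrite !ffunE /= !inordK.
apply: (@le_trans _ _ (\sum_(f : {ffun 'I_d -> 'I_N.+1}) \prod_i r i ^+ f i)).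
  rewrite [leLHS](_ : _ = \sum_(f in [set h k | k in predT]%SET) \prod_i r i ^+ f i).
    rewrite [leLHS]big_mkcond; apply: ler_sum => f _; case: ifP => // _.
    by apply: prodr_ge0 => i _; exact: exprn_ge0.
  rewrite big_imset /=; last by move=> ? ? _ _; exact: h_inj.
  by apply: eq_bigr => k _; apply: eq_bigr => i _; rewrite ffunE inordK.
rewrite -(bigA_distr_bigA (fun i (j : 'I_N.+1) => r i ^+ j)).
apply: ler_prod => i _; have /andP[ri0 ri1] := r01 i.
rewrite sumr_ge0 /=; last by move=> j _; exact: exprn_ge0.
rewrite -[leRHS]mul1r ler_pdivlMr ?subr_gt0 // mulrC.
have -> : (1 - r i) * \sum_(j < N.+1) r i ^+ j = 1 - r i ^+ N.+1.
  by rewrite -opprB mulNr -subrX1 opprB.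
by rewrite gerBl exprn_ge0.
Qed.

Lemma smb_geometric (r : 'I_d -> R) : (forall i, 0 <= r i < 1) ->
  smb (fun k : M => \prod_i r i ^+ k i).
Proof.
move=> r01; apply: smb_ge0P (fun N => tsum_geometric_le N r01) => k.
by apply: prodr_ge0 => i _; apply: exprn_ge0; case/andP : (r01 i).
Qed.

Lemma normc_mmap1 z k : normc (mmap1 z k) = \prod_i normc (z i) ^+ k i.
Proof. by rewrite normc_prod; apply: eq_bigr => i _; rewrite normcX. Qed.

Definition eva a z : M -> C := fun k => a k * mmap1 z k.
Definition ev a z : C := ctot (eva a z).

(** |a_k z^k| <= |a_k|^2 + |z^k|^2, and the second family is geometric with ratios |z_i|^2 < 1. *)
Lemma csmb_l2_eva a z : l2 a -> polydisk z -> csmb (eva a z).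
Proof.
move=> sa /polydiskP z1.
have sz : smb (fun k : M => \prod_i (normc (z i) ^+ 2) ^+ k i).
  apply: smb_geometric => i; rewrite sqr_ge0 /= expr_lt1 ?normc_ge0 //.
apply: csmb_leR (smbD sa sz) => k.
rewrite Normc.normcM (_ : \prod_i _ = normc (mmap1 z k) ^+ 2); last first.
  by rewrite normc_mmap1 -prodrXl; apply: eq_bigr => i _; rewrite exprAC.
have := sqr_ge0 (normc (a k) - normc (mmap1 z k)).
have := normc_ge0 (a k); have := normc_ge0 (mmap1 z k); nra.
Qed.

Lemma mmap1D z k l : mmap1 z (mnm_add k l) = mmap1 z k * mmap1 z l.
Proof. by apply: commr_mmap1_M => i x; rewrite /GRing.comm mulrC. Qed.

Lemma eva_mshift m a z k : eva (mshift m a) z k = mmap1 z m * mshift m (eva a z) k.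
Proof.
rewrite /eva /mshift; case: ifP => mk; last by rewrite mulr0 mul0r.
by rewrite mulrCA -mmap1D addmC submK.
Qed.

Lemma csmb_eva_mshift m a z : csmb (eva a z) -> csmb (eva (mshift m a) z).
Proof.
move=> sa; apply: csmb_le (csmbZ (mmap1 z m) (csmb_mshift m sa)) => k.
by rewrite eva_mshift.
Qed.

Lemma ev_mshift m a z : csmb (eva a z) -> ev (mshift m a) z = mmap1 z m * ev a z.
Proof.
move=> sa; rewrite /ev -(ctot_mshift m sa) -ctotZ; last exact: csmb_mshift.
by apply: eq_ctot => k; exact: eva_mshift.
Qed.

Lemma eva_fmul p a z k : eva (fmul (fpoly p) a) z k =
  \sum_(m <- msupp p) mcoeff m p * eva (mshift m a) z k.
Proof.
by rewrite /eva fmul_poly mulr_suml; apply: eq_bigr => m _; rewrite mulrA.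
Qed.

Lemma csmb_eva_fmul p a z : csmb (eva a z) -> csmb (eva (fmul (fpoly p) a) z).
Proof.
move=> sa; have h := @csmb_sum _ _ _ (msupp p)
  (fun m k => mcoeff m p * eva (mshift m a) z k)
  (fun m => csmbZ (mcoeff m p) (csmb_eva_mshift m sa)).
by apply: csmb_le h => k; rewrite eva_fmul.
Qed.

Lemma ev_fmul p a z : csmb (eva a z) -> ev (fmul (fpoly p) a) z = meval z p * ev a z.
Proof.
move=> sa; transitivity
    (ctot (fun k => \sum_(m <- msupp p) mcoeff m p * eva (mshift m a) z k)).
  by apply: eq_ctot => k; rewrite eva_fmul.
rewrite ctot_sum; last by move=> m; apply: csmbZ; exact: csmb_eva_mshift.
rewrite /meval /mmap mulr_suml; apply: eq_bigr => m _.
rewrite ctotZ; last exact: csmb_eva_mshift.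
by rewrite -mulrA -(ev_mshift m sa).
Qed.

Lemma ev1 z : ev (fpoly 1) z = 1.
Proof.
rewrite /ev; case: (@fin_supp_ctot _ _ (eva (fpoly 1) z) 1) => [k|_ ->].
  rewrite /eva /fpoly mcoeff1 => k0; case: eqP => [k00|]; last by rewrite mul0r.
  by rewrite k00 mdeg0 in k0.
have h0 : (mdeg (@mnm0 d) < 1)%N by rewrite mdeg0.
rewrite /tsum (bigD1 (BMultinom h0)) //= big1 ?addr0.
  by rewrite /eva /fpoly mcoeff1 eqxx mmap11 mulr1.
move=> k; rewrite -val_eqE /eva /fpoly mcoeff1 /= => /negbTE ->.
by rewrite mul0r.
Qed.

Lemma evD a b z : csmb (eva a z) -> csmb (eva b z) ->
  ev (fun k => a k + b k) z = ev a z + ev b z.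
Proof.
by move=> sa sb; rewrite /ev -ctotD //; apply: eq_ctot => k; rewrite /eva mulrDl.
Qed.

Lemma evZ c a z : csmb (eva a z) -> ev (fun k => c * a k) z = c * ev a z.
Proof.
by move=> sa; rewrite /ev -ctotZ //; apply: eq_ctot => k; rewrite /eva mulrA.
Qed.

Lemma evB a b z : csmb (eva a z) -> csmb (eva b z) ->
  ev (fun k => a k - b k) z = ev a z - ev b z.
Proof.
move=> sa sb; rewrite -mulN1r -(evZ _ sb) -evD //; first by congr ev; apply/funext => k; rewrite mulN1r.
by apply: csmb_le sb => k; rewrite /eva mulN1r mulNr normcNc.
Qed.

Lemma ev_ext a b z : (forall k, a k = b k) -> ev a z = ev b z.
Proof. by move=> /funext ->. Qed.

Lemma holomorphicP (F : ('I_d -> C) -> C) : holomorphic F <->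
  exists a, forall z, polydisk z -> csmb (eva a z) /\ F z = ev a z.
Proof.
split=> -[a ha]; exists a => z zD; have [h1 h2] := ha z zD.
  have sa : csmb (eva a z) by exact/csmb_esum.
  split => //; apply: (@ccvg_unique _ (fun N => tsum N (eva a z))); last exact: ctot_cvg.
  by rewrite /ccvg; under eq_fun do rewrite normcBC.
split; first exact/csmb_esum.
rewrite h2; under eq_fun do rewrite normcBC.
exact: (ctot_cvg h1).
Qed.

End power_series_evaluation.

(** * Coefficients of the inverse of a zero-free polynomial *)

Section univariate_bounds.
Variable R : realType.
Local Notation C := R[i].
Local Notation normc := (@Normc.normc R).
Implicit Types (q V W : {poly C}) (w : C) (ws : seq C).

(** A linear factor normalized to 1 at the origin, w being the inverse of the root: roots outside
    the open disk give |w| <= 1. *)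
Definition lin w : {poly C} := 1 - w *: 'X.

Lemma coef_linM w V n :
  (lin w * V)`_n = V`_n - (if n is m.+1 then w * V`_m else 0).
Proof.
rewrite /lin mulrBl mul1r -scalerAl coefB coefZ coefXM.
by case: n => [|n] /=; rewrite ?mulr0.
Qed.

(** [R[i]] is algebraically closed, and each root a has |a| >= 1, hence X - a = (-a)(1 - X/a). The
    constants collect into q(0). *)
Lemma zero_free_factor q : (forall l : C, normc l < 1 -> q.[l] != 0) ->
  exists ws, [/\ forall w, w \in ws -> normc w <= 1, (size ws < size q)%N &
    q = q.[0] *: \prod_(w <- ws) lin w].
Proof.
move=> q0; have [rs qrs] := closed_field_poly_normal q.
have qn0 : q != 0 by apply: contra (q0 0 _) => [/eqP ->|]; rewrite ?horner0 // Normc.normc0.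
have lq : lead_coef q != 0 by rewrite lead_coef_eq0.
have rs1 a : a \in rs -> 1 <= normc a.
  move=> ars; rewrite leNgt; apply/negP => /q0; rewrite qrs hornerZ mulf_eq0 (negbTE lq) /=.
  by rewrite -/(root _ _) root_prod_XsubC ars.
have rs0 a : a \in rs -> a != 0.
  by move=> /rs1 a1; rewrite -normc_eq0 gt_eqF // (lt_le_trans ltr01).
exists [seq a^-1 | a <- rs]; split.
- by move=> _ /mapP[a ars ->]; rewrite Normc.normcV invf_le1 ?rs1 // (lt_le_trans ltr01) ?rs1.
- by rewrite size_map qrs size_scale // size_prod_XsubC.
- have h s : {subset s <= rs} -> \prod_(a <- s) ('X - a%:P) =
      (\prod_(a <- s) (- a)) *: \prod_(w <- [seq a^-1 | a <- s]) lin w.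
    elim: s => [|a s IH] ss; first by rewrite !big_nil scale1r.
    rewrite /= !big_cons IH; last by move=> x xs; apply: ss; rewrite inE xs orbT.
    have -> : 'X - a%:P = (- a) *: lin a^-1.
      rewrite /lin scalerBr scalerA mulNr divff ?rs0 ?ss ?inE ?eqxx //.
      by rewrite scaleN1r opprK scaleNr -mul_polyC mulr1 addrC.
    by rewrite -scalerAl -scalerAr scalerA.
  have q00 : q.[0] = lead_coef q * \prod_(a <- rs) (- a).
    rewrite {1}qrs hornerZ horner_prod; congr (_ * _); apply: eq_bigr => a _.
    by rewrite hornerXsubC sub0r.
  by rewrite {1}qrs (h rs) // scalerA q00.
Qed.

(** With W = (1 - wX) V, the recursion is V_{n+1} = W_{n+1} + w V_n. The constant 1/(1 - s) is the
    one that closes the induction with equality: 1 + s/(1 - s) = 1/(1 - s). *)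
Lemma coef_bound_lin (s K : R) w V N : 0 < s < 1 -> 0 <= K -> normc w <= 1 ->
  (forall n, (n < N)%N -> normc ((lin w * V)`_n) <= K * s^-1 ^+ n) ->
  forall n, (n < N)%N -> normc V`_n <= (K / (1 - s)) * s^-1 ^+ n.
Proof.
move=> /andP[s0 s1] K0 w1 hW; elim=> [|n IH] nN.
  have := hW 0%N nN; rewrite coef_linM subr0 !expr0 !mulr1 => /le_trans; apply.
  by rewrite ler_pdivlMr ?subr_gt0 // ler_piMr // gerBl ltW.
have := hW _ nN; rewrite coef_linM => hn.
have hV : normc V`_n.+1 <= K * s^-1 ^+ n.+1 + normc V`_n.
  rewrite -[V`_n.+1](subrK (w * V`_n)); apply: le_trans (normcD _ _) _.
  by apply: lerD => //; rewrite Normc.normcM ler_piMl ?normc_ge0.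
apply: le_trans hV _; apply: le_trans (lerD (lexx _) (IH (ltnW nN))) _.
rewrite le_eqVlt; apply/orP; left; apply/eqP.
rewrite exprS; field; rewrite gt_eqF //= gt_eqF // subr_gt0 //.
Qed.

(** Each factor costs 1/(1 - s). The bounds concern indices below N only, since V will be a
    truncation of 1/P along a line, which inverts P only in low degree. *)
Lemma coef_bound_prod (s K : R) ws V N : 0 < s < 1 -> 0 <= K ->
  (forall w, w \in ws -> normc w <= 1) ->
  (forall n, (n < N)%N -> normc ((\prod_(w <- ws) lin w * V)`_n) <= K * s^-1 ^+ n) ->
  forall n, (n < N)%N -> normc V`_n <= (K * (1 - s)^-1 ^+ size ws) * s^-1 ^+ n.
Proof.
move=> s01; have /andP[s0 s1] := s01.
elim: ws K V => [|w ws IH] K V K0 ws1 hW n nN.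
  by have := hW _ nN; rewrite big_nil mul1r expr0 mulr1.
rewrite /= exprSr mulrA mulrAC; have wP : w \in w :: ws by rewrite inE eqxx.
have K1 : 0 <= K / (1 - s) by rewrite divr_ge0 // subr_ge0 ltW.
have := IH (K / (1 - s)) V K1 _ _ n nN.
rewrite -!mulrA [X in _ -> _ <= K * X](_ : _ =
  ((1 - s)^-1 * ((1 - s)^-1 ^+ size ws * s^-1 ^+ n))); last by ring.
apply; first by move=> x xs; apply: ws1; rewrite inE xs orbT.
apply: (coef_bound_lin s01 K0 (ws1 _ wP)) => m mN.
by have := hW _ mN; rewrite big_cons mulrA.
Qed.

(** Factor by factor: |1 - w| <= |1 - r w| + (1 - r)|w|, and (1 - r)|w| <= 1 - r <= 1 - r|w| <= |1 -
    r w|. *)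
Lemma prod_lin_ratio (r : R) ws : 0 <= r < 1 -> (forall w, w \in ws -> normc w <= 1) ->
  normc (\prod_(w <- ws) lin w).[1] <=
    2 ^+ size ws * normc (\prod_(w <- ws) lin w).[r%:C%C].
Proof.
move=> /andP[r0 r1]; elim: ws => [|w ws IH] ws1.
  by rewrite !big_nil !hornerC mul1r.
rewrite !big_cons !hornerM !Normc.normcM exprS mulrACA.
apply: ler_pM; rewrite ?normc_ge0 //; last first.
  by apply: IH => x xs; apply: ws1; rewrite inE xs orbT.
have w1 : normc w <= 1 by apply: ws1; rewrite inE eqxx.
have el (x : C) : (lin w).[x] = 1 - w * x by rewrite /lin hornerD hornerN hornerZ hornerX hornerC.
rewrite !el.
have h1 : normc (1 - w * 1) <= normc (1 - w * r%:C%C) + (1 - r) * normc w.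
  have -> : 1 - w * 1 = (1 - w * r%:C%C) + (- ((1 - r)%:C%C * w)).
    by rewrite rmorphB rmorph1; ring.
  apply: le_trans (normcD _ _) _.
  by rewrite normcNc Normc.normcM normc_real ger0_norm // subr_ge0 ltW.
have h2 : 1 <= normc (1 - w * r%:C%C) + r * normc w.
  rewrite -[leLHS](Normc.normc1 R) -[X in normc X](subrK (w * r%:C%C)).
  apply: le_trans (normcD _ _) _.
  by rewrite lerD2l Normc.normcM normc_real (ger0_norm r0) [normc w * _]mulrC.
by nra.
Qed.

End univariate_bounds.

Section dilation_polynomial.
Variables (R : realType) (d : nat).
Local Notation M := (multinom d).
Local Notation C := R[i].
Local Notation normc := (@Normc.normc R).
Implicit Types (a : M -> C) (z : 'I_d -> C) (p : mpoly d C).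

(* The one-variable polynomial l |-> p(l z). *)
Definition zpoly z p : {poly C} := mmap (@polyC C) (fun i => z i *: 'X) p.

Lemma zpolyM z p q : zpoly z (p * q) = zpoly z p * zpoly z q.
Proof. by rewrite /zpoly rmorphM. Qed.

Lemma zpolyE z p : zpoly z p =
  \sum_(m <- msupp p) (mcoeff m p * mmap1 z m) *: 'X^(mdeg m).
Proof.
rewrite /zpoly /mmap; apply: eq_bigr => m _.
rewrite mul_polyC -scalerA; congr (_ *: _).
rewrite /mmap1 mdegE -prodrXr -scaler_prod.
by apply: eq_bigr => i _; rewrite exprZn.
Qed.

Lemma coef_zpoly z p n : (zpoly z p)`_n =
  \sum_(m <- msupp p) mcoeff m p * mmap1 z m * (n == mdeg m)%:R.
Proof.
by rewrite zpolyE coef_sum; apply: eq_bigr => m _; rewrite coefZ coefXn.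
Qed.

Lemma coef_zpoly_eq0 z p n : (forall m, mdeg m = n -> mcoeff m p = 0) ->
  (zpoly z p)`_n = 0.
Proof.
move=> p0; rewrite coef_zpoly big1 // => m _.
by case: eqP => [nm|_]; rewrite ?mulr0 // p0 ?mul0r.
Qed.

Lemma horner_zpoly z p (l : C) : (zpoly z p).[l] = meval (fun i => l * z i) p.
Proof.
rewrite zpolyE horner_sum; apply: eq_bigr => m _.
rewrite hornerZ hornerXn /= -mulrA; congr (_ * _).
rewrite /mmap1 mdegE -prodrXr -big_split /=; apply: eq_bigr => i _.
by rewrite exprMn mulrC.
Qed.

Lemma size_zpoly z p : (size (zpoly z p) <= mmeasure (@mdeg d) p)%N.
Proof.
apply/leq_sizeP => n pn; apply: coef_zpoly_eq0 => m mn.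
by apply: memN_msupp_eq0; apply: msize_mdeg_ge; rewrite mn.
Qed.

(** The coefficient of l^n is the homogeneous component of degree n at z, written as a truncated sum
    so that [parseval_finite] can be applied to it as a function of z. *)
Lemma coef_zpoly_tpoly z a N n : (n < N)%N -> (zpoly z (tpoly N a))`_n =
  tsum n.+1 (fun k => (if mdeg k == n then a k else 0) * mmap1 z k).
Proof.
move=> nN; rewrite -(tsum_widen _ nN) /zpoly /tpoly raddf_sum /= coef_sum.
apply: eq_bigr => k _.
rewrite -mul_mpolyC rmorphM /= mmapC mmapX mul_polyC coefZ.
have -> : mmap1 (fun i => z i *: 'X) k = mmap1 z k *: 'X^(mdeg k).
  rewrite /mmap1 mdegE -prodrXr -scaler_prod.
  by apply: eq_bigr => i _; rewrite exprZn.
rewrite coefZ coefXn eq_sym; case: eqP => [->|_]; first by rewrite ltnSn mulr1.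
by rewrite !mulr0 mul0r if_same.
Qed.

End dilation_polynomial.

Section inverse_coefficients.
Variables (R : realType) (d : nat).
Local Notation M := (multinom d).
Local Notation C := R[i].
Local Notation normc := (@Normc.normc R).
Variable P : mpoly d C.
Hypothesis P_neq0 : forall z, (@polydisk R d `|` @distinguished_boundary R d) z ->
  meval z P != 0.

Let D := mmeasure (@mdeg d) P.
Let P0 := mcoeff (@mnm0 d) P.

Lemma meval0_mcoeff (p : mpoly d C) : meval (fun=> 0) p = mcoeff (@mnm0 d) p.
Proof.
rewrite [in LHS](mpolyE p) raddf_sum /= [in RHS](mpolyE p) raddf_sum /=.
apply: eq_bigr => m _; rewrite mevalZ mcoeffZ mcoeffX; congr (_ * _).
case: eqP => [->|/eqP m0]; first by rewrite mevalX big1 // => i _; rewrite mnm0E expr0.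
have [i mi] : exists i, m i != 0%N.
  apply/existsP; rewrite -negb_forall; apply: contra m0 => /forallP m0.
  by apply/eqP/mnmP => i; rewrite mnm0E; apply/eqP.
by rewrite mevalX (bigD1 i) //= expr0n (negbTE mi) mul0r.
Qed.

Lemma P0_neq0 : P0 != 0.
Proof.
rewrite /P0 -meval0_mcoeff; apply: P_neq0; left => i /=.
by rewrite normr0 ltr01.
Qed.

Lemma torus_boundary (t : d.-tuple (measurableTypeR R)) :
  @distinguished_boundary R d (torus_point 1 t).
Proof.
move=> i; rewrite torus_pointE mul1r; apply/eqP; rewrite eq_complex /=.
by rewrite cos2Dsin2 sqrtr1 !eqxx.
Qed.

Lemma zpoly_torus_neq0 t (l : C) : normc l < 1 -> (zpoly (torus_point 1 t) P).[l] != 0.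
Proof.
move=> l1; rewrite horner_zpoly; apply: P_neq0; left.
apply/polydiskP => i; rewrite Normc.normcM torus_pointE mul1r normc_cis mulr1 //.
Qed.

Lemma zpoly_factor t : exists ws, [/\ forall w, w \in ws -> normc w <= 1,
  (size ws <= D)%N & zpoly (torus_point 1 t) P = P0 *: \prod_(w <- ws) lin w].
Proof.
have [ws [ws1 sws qE]] := zero_free_factor (@zpoly_torus_neq0 t).
exists ws; split => //.
  exact: leq_trans (ltnW sws) (size_zpoly _ _).
rewrite {1}qE horner_zpoly /P0 -meval0_mcoeff; congr (_ *: _).
by apply: meval_eq => i; rewrite mul0r.
Qed.

(** Along the line through a torus point, P_0 times the product of the linear factors, times the
    truncation V of 1/P, equals 1 up to degree n; [coef_bound_prod] applies with K = 1/|P_0|. *)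
Lemma psinv_homogeneous_bound (s : R) (t : d.-tuple (measurableTypeR R)) n : 0 < s < 1 ->
  normc (tsum n.+1 (fun k : M => (if mdeg k == n then psinv P k else 0) * echar k t)) <=
  (normc P0)^-1 * (1 - s)^-1 ^+ D * s^-1 ^+ n.
Proof.
move=> s01; have /andP[s0 s1] := s01.
have [ws [ws1 sws qE]] := zpoly_factor t.
have := coef_zpoly_tpoly (torus_point 1 t) (psinv P) (ltnSn n) => <-.
set V := zpoly _ (tpoly n.+1 _).
have WE : \prod_(w <- ws) lin w * V =
    P0^-1 *: zpoly (torus_point 1 t) (P * tpoly n.+1 (psinv P)).
  by rewrite zpolyM qE -/V -scalerAl scalerA mulVf ?P0_neq0 // scale1r.
have Wm m : (m < n.+1)%N ->
    (zpoly (torus_point 1 t) (P * tpoly n.+1 (psinv P)))`_m = (m == 0%N)%:R.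
  move=> mn; rewrite -[P * _](subrK 1) /zpoly rmorphD rmorph1 coefD coef1.
  rewrite -[X in X + _]/(zpoly _ _)`_m coef_zpoly_eq0 ?add0r // => k km.
  rewrite mcoeffB -[X in _ - X]/(fpoly 1 k) -(fmul_psinv k P0_neq0) fmul_fpoly.
  rewrite (@mcoeffM_congr _ _ P P (tpoly n.+1 (psinv P)) (tpoly (mdeg k).+1 (psinv P))) ?subrr //.
  move=> j jk; rewrite !mcoeff_tpoly /trunc !ltnS jk ifT //.
  by rewrite (leq_trans jk) // km -ltnS.
have K0 : 0 <= (normc P0)^-1 by rewrite invr_ge0 normc_ge0.
apply: le_trans (@coef_bound_prod _ s (normc P0)^-1 ws V n.+1 s01 K0 ws1 _ n (ltnSn n)) _.
  move=> m mn; rewrite WE coefZ Wm // Normc.normcM Normc.normcV.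
  apply: ler_wpM2l => //; case: m mn => [|m] _.
    by rewrite (_ : (_ == _)%:R = 1 :> C) // Normc.normc1 expr0.
  by rewrite (_ : (_ == _)%:R = 0 :> C) // Normc.normc0 exprn_ge0 // invr_ge0 ltW.
apply: ler_wpM2r; first by rewrite exprn_ge0 // invr_ge0 ltW.
(* The number of factors depends on t but never exceeds D; since 1/(1 - s) >= 1, the exponent D
   gives a bound uniform in t. *)
apply: ler_wpM2l => //; apply: ler_weXn2l => //.
by rewrite invf_ge1 ?subr_gt0 // gerBl ltW.
Qed.

Lemma angle_measure_setT : (angle_measure R d setT = ((2 * pi) ^+ d)%:E)%E.
Proof.
have := @integral_character R d 0 (fun=> 0%N) (fun=> 0%N).
rewrite (_ : [forall i, _]) ?cos0 ?mulr1; last by apply/forallP.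
under eq_integral do
  (rewrite (_ : cos _ = 1); last by rewrite big1 ?addr0 ?cos0 // => i _; rewrite subrr mul0r).
by rewrite integral_cst // mul1e.
Qed.

(** By Parseval a coefficient is at most the mean square of its homogeneous component on the torus,
    hence at most its uniform bound; the mass (2 pi)^d cancels. *)
Lemma psinv_coef_bound (s : R) k : 0 < s < 1 ->
  normc (psinv P k) <= (normc P0)^-1 * (1 - s)^-1 ^+ D * s^-1 ^+ mdeg k.
Proof.
move=> s01; have /andP[s0 s1] := s01.
set B := _ * s^-1 ^+ _; pose n := mdeg k.
have B0 : 0 <= B.
  rewrite /B !mulr_ge0 ?invr_ge0 ?normc_ge0 ?exprn_ge0 ?invr_ge0 ?subr_ge0 //; exact: ltW.
pose a (j : M) := if mdeg j == n then psinv P j else 0.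
rewrite -ler_sqr ?nnegrE ?normc_ge0 //.
have pi0 : 0 < (2 * pi : R) ^+ d by rewrite exprn_gt0 // mulr_gt0 ?pi_gt0.
rewrite -(ler_pM2l pi0).
apply: (@le_trans _ _ ((2 * pi) ^+ d * tsum n.+1 (fun j => normc (a j) ^+ 2))).
  rewrite ler_pM2l //.
  have -> : normc (psinv P k) ^+ 2 = normc (a k) ^+ 2 by rewrite /a eqxx.
  exact: (@ge_tsum_one _ _ (fun j => normc (a j) ^+ 2) k n.+1 (fun j => sqr_ge0 _) (ltnSn _)).
rewrite -lee_fin -(parseval_finite n.+1 a).2 [leRHS]EFinM muleC -angle_measure_setT.
rewrite -integral_cst //; apply: ge0_le_integral => //.
- by move=> t _; rewrite lee_fin sqr_ge0.
- by apply/measurable_EFinP; apply: measurable_normc2; exact: cmeas_tsum.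
- move=> t _; rewrite lee_fin lerXn2r ?nnegrE ?normc_ge0 //.
  exact: psinv_homogeneous_bound.
Qed.

Definition dilate (a : M -> C) (r : R) : M -> C := fun k => a k * ((r ^+ mdeg k)%:C)%C.

Lemma csmb_eva_psinv z : polydisk z -> csmb (eva (psinv P) z).
Proof.
move=> /polydiskP z1.
(* r bounds all |z_i| and stays below 1, the initial value 1/2 keeping it positive. With s halfway
   between r and 1, the majorant is geometric of ratio r/s < 1. *)
pose r := \big[Num.max/(1/2)]_(i < d) normc (z i).
have zr i : normc (z i) <= r by exact: le_bigmax.
have r01 : 0 < r < 1.
  apply/andP; split; last first.
    by apply/bigmax_ltP; split => //; rewrite ltr_pdivrMr // mul1r ltr1n.
  have h : 1 / 2 <= r by exact: bigmax_ge_id.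
  by apply: lt_le_trans h; rewrite divr_gt0.
have /andP[r0 r1] := r01.
pose s := (r + 1) / 2; have s01 : 0 < s < 1 by rewrite /s; apply/andP; split; lra.
have rs : r < s by rewrite /s; lra.
have /andP[s0 s1] := s01.
pose K := (normc P0)^-1 * (1 - s)^-1 ^+ D.
have K0 : 0 <= K.
  by rewrite !mulr_ge0 ?invr_ge0 ?normc_ge0 ?exprn_ge0 ?invr_ge0 ?subr_ge0 // ltW.
have sg : smb (fun k : M => \prod_(i < d) (r / s) ^+ k i).
  by apply: smb_geometric => i; rewrite divr_ge0 ?ltW // ltr_pdivrMr // mul1r.
apply: csmb_leR (smbZ K sg) => k.
rewrite Normc.normcM; apply: le_trans (ler_wpM2r (normc_ge0 _) (psinv_coef_bound k s01)) _.
rewrite -/K -mulrA; apply: ler_wpM2l => //.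
rewrite prodrXr -mdegE exprMn mulrC.
apply: ler_wpM2r; first by rewrite exprn_ge0 // invr_ge0 ltW.
rewrite normc_mmap1 mdegE -prodrXr; apply: ler_prod => i _.
by rewrite exprn_ge0 ?normc_ge0 //= lerXn2r ?nnegrE ?normc_ge0 // ltW.
Qed.

Lemma ev_psinv z : polydisk z -> ev (psinv P) z = (meval z P)^-1.
Proof.
move=> zD; have Pz : meval z P != 0 by apply: P_neq0; left.
apply: (mulfI Pz); rewrite divff // -(ev_fmul P (csmb_eva_psinv zD)) -(ev1 z).
by apply: ev_ext => k; exact: fmul_psinv P0_neq0.
Qed.

End inverse_coefficients.

(** * Multiplication by an inner quotient is isometric *)

Section l2_limits.
Variables (R : realType) (d : nat).
Local Notation M := (multinom d).
Local Notation C := R[i].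
Local Notation normc := (@Normc.normc R).
Implicit Types (a b : M -> C).

(** |x|^2 = |a|^2 + |x - a|^2 + 2 Re <a, x - a>, where Cauchy-Schwarz controls the last term. *)
Lemma nrm_cvg (x : nat -> M -> C) a : (forall j, l2 (x j)) -> l2 a ->
  (fun j => nrm (fun k => x j k - a k)) @ \oo --> (0 : R) ->
  (fun j => nrm (x j)) @ \oo --> nrm a.
Proof.
move=> sx sa h; pose e (j : nat) : R := nrm (fun k => x j k - a k).
have he : (fun j => e j + 2 * Num.sqrt (nrm a * e j)) @ \oo --> (0 : R).
  rewrite -[X in _ --> X](addr0 0); apply: cvgD => //.
  rewrite -(mulr0 2); apply: cvgMr; rewrite -(sqrtr0 R) -(mulr0 (nrm a)).
  apply: (continuous_cvg _ (@sqrt_continuous R _)); exact: cvgMr.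
apply/subr_cvg0; apply/norm_cvg0P.
apply: squeeze_cvgr (cvg_cst 0) he; apply: nearW => j /=.
rewrite normr_ge0 /=.
have sxa : l2 (fun k => x j k - a k) by exact: l2B.
have -> : nrm (x j) = nrm a + e j + 2 * complex.Re (dot a (fun k => x j k - a k)).
  by rewrite -nrmD //; apply: eq_nrm => k; rewrite addrC subrK.
set X := 2 * complex.Re _.
have -> : nrm a + e j + X - nrm a = e j + X by ring.
rewrite /X.
have e0 : 0 <= e j by exact: nrm_ge0.
apply: le_trans (ler_normD _ _) _; rewrite ger0_norm // lerD2l normrM.
rewrite ger0_norm // ler_pM2l // ; apply: le_trans (Re_le_normc _) _.
rewrite -[leLHS]ger0_norm ?normc_ge0 // -sqrtr_sqr; apply: ler_wsqrtr.
exact: dot_CauchySchwarz sa sxa.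
Qed.

(** Lower semicontinuity: on each finite section the squares converge, and [nrm_fatou] removes the
    cut-off. Only an inequality survives. *)
Lemma nrm_coef_cvg (x : nat -> M -> C) a B :
  (forall k, ccvg (x^~ k) (a k)) -> (forall j, l2 (x j)) ->
  (fun j => nrm (x j)) @ \oo --> B -> l2 a /\ nrm a <= B.
Proof.
move=> xa sx xB; apply: nrm_fatou => N.
have h : (fun j => tsum N (fun k => normc (x j k) ^+ 2)) @ \oo -->
    tsum N (fun k => normc (a k) ^+ 2).
  rewrite /tsum; elim: (index_enum _) => [|k r IH].
    by rewrite big_nil; under eq_fun do rewrite big_nil; exact: cvg_cst.
  rewrite big_cons; under eq_fun do rewrite big_cons.
  by apply: cvgD => //; apply: cvgM; apply: normc_ccvg.
rewrite -(cvg_lim _ h) // -(cvg_lim _ xB) //; apply: ler_lim.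
- by apply/cvg_ex; eexists; exact: h.
- by apply/cvg_ex; eexists; exact: xB.
- by apply: nearW => j; exact: tsum_le_nrm.
Qed.

Lemma ccvg_sum (I : Type) (r : seq I) (u : I -> nat -> C) (l : I -> C) :
  (forall i, ccvg (u i) (l i)) ->
  ccvg (fun n => \sum_(i <- r) u i n) (\sum_(i <- r) l i).
Proof.
move=> ul; elim: r => [|i r IH].
  by rewrite big_nil /ccvg; under eq_fun do rewrite big_nil; exact: ccvg_cst.
rewrite big_cons /ccvg; under eq_fun do rewrite big_cons.
exact: ccvgD.
Qed.

Lemma ccvg_mshift (x : nat -> M -> C) a m k : (forall k, ccvg (x^~ k) (a k)) ->
  ccvg (fun j => mshift m (x j) k) (mshift m a k).
Proof.
by move=> xa; rewrite /mshift; case: ifP => _; [exact: xa|exact: ccvg_cst].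
Qed.

Lemma ccvg_fmul (x : nat -> M -> C) a p k : (forall k, ccvg (x^~ k) (a k)) ->
  ccvg (fun j => fmul (fpoly p) (x j) k) (fmul (fpoly p) a k).
Proof.
move=> xa; rewrite fmul_poly /ccvg; under eq_fun do rewrite fmul_poly.
by apply: ccvg_sum => m; apply: ccvgZ; exact: ccvg_mshift.
Qed.

Lemma csmb_fmul p a : csmb a -> csmb (fmul (fpoly p) a).
Proof.
(* At the point (1, ..., 1) all monomials equal 1, so [csmb] is absolute convergence of the series
   there. *)
have e (b : M -> C) k : eva b (fun=> 1) k = b k.
  by rewrite /eva /mmap1 big1 ?mulr1 // => i _; rewrite expr1n.
move=> sa; have : csmb (eva a (fun=> 1)) by apply: csmb_le sa => k; rewrite e.
by move=> /(csmb_eva_fmul p); apply: csmb_le => k; rewrite e.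
Qed.

Lemma bsum_fmul p a t : csmb a ->
  bsum (fmul (fpoly p) a) t = meval (torus_point 1 t) p * bsum a t.
Proof. by move=> sa; apply: ev_fmul; exact: csmb_char. Qed.

Lemma pi2d_gt0 : 0 < (2 * pi : R) ^+ d.
Proof. by rewrite exprn_gt0 // mulr_gt0 ?pi_gt0. Qed.

(** Parseval turns pointwise domination on the torus into domination of norms. *)
Lemma nrm_le_bsum a b (K : R) : csmb a -> csmb b -> 0 <= K ->
  (forall t : d.-tuple (measurableTypeR R), normc (bsum a t) <= K * normc (bsum b t)) ->
  nrm a <= K ^+ 2 * nrm b.
Proof.
move=> sa sb K0 ab; rewrite -(ler_pM2l pi2d_gt0) mulrCA.
rewrite -lee_fin -(parseval sa).2 -(hasintZ (K ^+ 2) (parseval sb)).2.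
apply: ge0_le_integral => //.
- by move=> t _; rewrite lee_fin sqr_ge0.
- by apply/measurable_EFinP/measurable_normc2/cmeas_bsum.
- apply/measurable_EFinP; apply: measurable_funM => //.
  by apply: measurable_normc2; exact: cmeas_bsum.
- move=> t _; rewrite lee_fin -exprMn lerXn2r ?nnegrE ?mulr_ge0 ?normc_ge0 //.
Qed.

Lemma nrm_fmul_le p a : csmb a ->
  nrm (fmul (fpoly p) a) <= (\sum_(m <- msupp p) normc (mcoeff m p)) ^+ 2 * nrm a.
Proof.
move=> sa; apply: nrm_le_bsum => //; first exact: csmb_fmul.
  by apply: sumr_ge0 => m _; exact: normc_ge0.
move=> t; rewrite bsum_fmul // Normc.normcM; apply: ler_wpM2r; first exact: normc_ge0.
apply: le_trans (normc_sum _ _ _) _; apply: ler_sum => m _.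
by rewrite Normc.normcM -/(echar m t) normc_echar mulr1.
Qed.

Lemma nrm_bsum_cvg0 (x : nat -> M -> C) (K : R) : (forall j, csmb (x j)) ->
  (forall j t, normc (bsum (x j) t) <= K) ->
  (forall t, (fun j => normc (bsum (x j) t)) @ \oo --> (0 : R)) ->
  (fun j => nrm (x j)) @ \oo --> (0 : R).
Proof.
move=> sx xK x0.
have [] := @dominated_convergence _ _ _ (angle_measure R d) setT measurableT
  (fun j t => (normc (bsum (x j) t) ^+ 2)%:E) (cst 0%E) (fun=> (K ^+ 2)%:E).
- move=> j; apply/measurable_EFinP/measurable_normc2/cmeas_bsum; exact: sx.
- exact: measurable_cst.
- apply: aeW => t _; apply: cvg_EFin; first exact: nearW.
  rewrite (_ : _ \o _ = fun j => normc (bsum (x j) t) ^+ 2) //.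
  have := cvgM (x0 t) (x0 t); rewrite mulr0 => h2. exact: h2.
- exact: (@finite_measure_integrable_cst _ _ _ (angle_measure R d)).
- apply: aeW => t j _ /=; rewrite lee_fin ger0_norm ?sqr_ge0 //.
  by rewrite lerXn2r ?nnegrE ?normc_ge0 ?xK //; exact: le_trans (normc_ge0 _) (xK j t).
move=> _ _; rewrite integral0 => h.
have {h} : (fun j => ((2 * pi) ^+ d * nrm (x j))%:E) @ \oo --> (0%:E : \bar R).
  move: h; rewrite (_ : [sequence _]_ _ = fun j => ((2 * pi) ^+ d * nrm (x j))%:E) //.
  by apply/funext => j; exact: (parseval (sx j)).2.
move=> /fine_cvg h; rewrite -(mulr0 ((2 * pi : R) ^+ d)^-1).
rewrite (_ : (fun j => nrm (x j)) =
    fun j => ((2 * pi) ^+ d)^-1 * ((2 * pi) ^+ d * nrm (x j))); first exact: cvgMr.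
by apply/funext => j; rewrite mulKf // gt_eqF ?pi2d_gt0.
Qed.

End l2_limits.

Section inner_isometry.
Variables (R : realType) (d : nat).
Local Notation M := (multinom d).
Local Notation C := R[i].
Local Notation T := (measurableTypeR R).
Local Notation normc := (@Normc.normc R).
Implicit Types (a h : M -> C).

Lemma torus_polydisk (r : R) (t : d.-tuple T) : 0 <= r < 1 -> polydisk (torus_point r t).
Proof.
move=> /andP[r0 r1]; apply/polydiskP => i.
by rewrite torus_pointE Normc.normcM normc_cis mulr1 normc_real ger0_norm.
Qed.

Lemma eva_torus a r (t : d.-tuple T) k :
  eva a (torus_point r t) k = dilate a r k * echar k t.
Proof. by rewrite /eva mmap1_torus mulrA. Qed.

Lemma csmb_dilate a r (t : d.-tuple T) : csmb (eva a (torus_point r t)) -> csmb (dilate a r).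
Proof.
by apply: csmb_le => k; rewrite eva_torus [leRHS]Normc.normcM normc_echar mulr1.
Qed.

Lemma bsum_dilate a r (t : d.-tuple T) : bsum (dilate a r) t = ev a (torus_point r t).
Proof. by apply: eq_ctot => k; rewrite eva_torus. Qed.

Definition radseq (j : nat) : R := 1 - harmonic j.

Lemma radseq01 j : 0 <= radseq j < 1.
Proof.
rewrite /radseq /harmonic /=; apply/andP; split.
  by rewrite subr_ge0 invf_le1 // ler1n.
by rewrite gtrBl invr_gt0.
Qed.

Lemma radseq_cvg : radseq @ \oo --> (1 : R).
Proof.
rewrite -[X in _ --> X](subr0 1); apply: cvgB; first exact: cvg_cst.
exact: cvg_harmonic.
Qed.

Lemma radseqX_ccvg n : ccvg (fun j => ((radseq j ^+ n)%:C)%C) 1.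
Proof.
apply/ccvgP; split => /=; last exact: cvg_cst.
rewrite -(expr1n R n); elim: n => [|n IH]; first by under eq_fun do rewrite expr0; exact: cvg_cst.
rewrite exprS; under eq_fun do rewrite exprS.
by apply: cvgM => //; exact: radseq_cvg.
Qed.

Lemma dilate_ccvg a k : ccvg (fun j => dilate a (radseq j) k) (a k).
Proof. by rewrite -[X in ccvg _ X]mulr1; apply: ccvgZ; exact: radseqX_ccvg. Qed.

Lemma meval_radseq_ccvg p (t : d.-tuple T) :
  ccvg (fun j => meval (torus_point (radseq j) t) p) (meval (torus_point 1 t) p).
Proof.
apply: ccvg_sum => m; apply: ccvgZ.
rewrite (_ : (fun j => _) = fun j => echar m t * ((radseq j ^+ mdeg m)%:C)%C); last first.
  by apply/funext => j; rewrite mmap1_torus mulrC.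
rewrite -[X in ccvg _ X]mulr1.
by apply: ccvgZ; exact: radseqX_ccvg.
Qed.

(** On the torus 1/z is the conjugate of z, so z^(m-k) = z^m conj(z^k) and P*(z) = z^m
    conj(P(z)). *)
Lemma meval_reflect (P : mpoly d C) (t : d.-tuple T) :
  normc (meval (torus_point 1 t) (reflect_poly P)) = normc (meval (torus_point 1 t) P).
Proof.
have le_m k : k \in msupp P -> mpoly.lem k (multidegree P).
  move=> kP; apply/mnm_lepP => i; rewrite /multidegree mnmE.
  apply: (leq_bigmax_seq (F := fun k : M => k i))=> //.
have -> : meval (torus_point 1 t) (reflect_poly P) =
    echar (multidegree P) t * conjc (meval (torus_point 1 t) P).
  rewrite /reflect_poly raddf_sum /= [meval _ P]/meval /mmap rmorph_sum mulr_sumr.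
  rewrite big_seq [RHS]big_seq; apply: eq_bigr => k kP.
  rewrite mevalZ mevalX rmorphM mulrCA; congr (_ * _).
  rewrite -[LHS]/(echar (mnm_sub (multidegree P) k) t).
  rewrite -[RHS]/(echar (multidegree P) t * conjc (echar k t)).
  rewrite -{2}(submK (le_m k kP)) [X in _ = X * _]mmap1D -mulrA mulc_conj.
  by rewrite normc_echar expr1n mulr1.
by rewrite Normc.normcM normc_echar mul1r normc_conj.
Qed.

#[local] Opaque reflect_poly.

Variable P : mpoly d C.
Hypothesis P_neq0 : forall z, (@polydisk R d `|` @distinguished_boundary R d) z ->
  meval z P != 0.

Let c := psinv P.
Let crad j := dilate c (radseq j).

Lemma csmb_crad j : csmb (crad j).
Proof.
(* Any angle would do: the moduli of the terms depend on the radius only. *)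
apply: (@csmb_dilate _ _ [tuple of nseq d 0]).
by apply: csmb_eva_psinv => //; apply: torus_polydisk; exact: radseq01.
Qed.

Lemma bsum_crad j t : bsum (crad j) t = (meval (torus_point (radseq j) t) P)^-1.
Proof.
by rewrite bsum_dilate ev_psinv //; apply: torus_polydisk; exact: radseq01.
Qed.

Let D := mmeasure (@mdeg d) P.

Lemma meval_ratio (t : d.-tuple T) (r : R) : 0 <= r < 1 ->
  normc (meval (torus_point 1 t) P) <= 2 ^+ D * normc (meval (torus_point r t) P).
Proof.
move=> r01; have [ws [ws1 sws qE]] := zpoly_factor P_neq0 t.
have e (l : R) : meval (torus_point l t) P = (zpoly (torus_point 1 t) P).[l%:C%C].
  by rewrite horner_zpoly; apply: meval_eq => i; rewrite !torus_pointE mul1r.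
rewrite !e qE !hornerZ !Normc.normcM mulrCA; apply: ler_wpM2l; first exact: normc_ge0.
apply: le_trans (prod_lin_ratio r01 ws1) _.
by apply: ler_wpM2r; [exact: normc_ge0|apply: ler_weXn2l; rewrite ?ler1n].
Qed.

(** The defect of the dilated series of 1/P as an inverse of P. Its convergence to 0 in norm is what
    makes multiples of P approximate every polynomial. *)
Let x j k := fmul (fpoly P) (crad j) k - fpoly 1 k.

Lemma csmbB a h : csmb a -> csmb h -> csmb (fun k => a k - h k).
Proof.
move=> sa sh; apply: csmb_le (csmbD sa (csmbZ (-1) sh)) => k.
by rewrite mulN1r.
Qed.

Lemma csmb_poly (p : mpoly d C) : csmb (fpoly p).
Proof.
case: (@fin_supp_ctot _ _ (fpoly p) (mmeasure (@mdeg d) p)) => // k pk.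
by rewrite /fpoly memN_msupp_eq0 //; exact: msize_mdeg_ge.
Qed.

Lemma csmb_x j : csmb (x j).
Proof.
apply: csmbB; last exact: csmb_poly.
by apply: csmb_fmul; exact: csmb_crad.
Qed.

Lemma bsum_x j t : bsum (x j) t =
  meval (torus_point 1 t) P / meval (torus_point (radseq j) t) P - 1.
Proof.
rewrite -bsum_crad -bsum_fmul; last exact: csmb_crad.
rewrite [LHS](_ : _ = ev (x j) (torus_point 1 t)) // evB; last 2 first.
- by apply: csmb_char; apply: csmb_fmul; exact: csmb_crad.
- by apply: csmb_char; exact: csmb_poly.
by rewrite ev1.
Qed.

Lemma meval_radseq_neq0 j t : meval (torus_point (radseq j) t) P != 0.
Proof. by apply: P_neq0; left; apply: torus_polydisk; exact: radseq01. Qed.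

Lemma meval_torus_neq0 (t : d.-tuple T) : meval (torus_point 1 t) P != 0.
Proof. by apply: P_neq0; right; exact: torus_boundary. Qed.

Lemma meval_ratio_le j t : normc (meval (torus_point 1 t) P) /
  normc (meval (torus_point (radseq j) t) P) <= 2 ^+ D.
Proof.
rewrite ler_pdivrMr; first exact: meval_ratio (radseq01 j).
by rewrite lt_neqAle normc_ge0 eq_sym normc_eq0 meval_radseq_neq0.
Qed.

Lemma nrm_x_cvg0 : (fun j => nrm (x j)) @ \oo --> (0 : R).
Proof.
apply: (@nrm_bsum_cvg0 _ _ x (2 ^+ D + 1)); first exact: csmb_x.
  move=> j t; rewrite bsum_x; apply: le_trans (normcD _ _) _.
  rewrite normcNc Normc.normc1 lerD2r Normc.normcM Normc.normcV.
  exact: meval_ratio_le.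
move=> t; set z := torus_point 1 t.
have nz : normc (meval z P) != 0 by rewrite normc_eq0 meval_torus_neq0.
have h : (fun j => 2 ^+ D / normc (meval z P) *
    normc (meval (torus_point (radseq j) t) P - meval z P)) @ \oo --> (0 : R).
  rewrite -(mulr0 (2 ^+ D / normc (meval z P))); apply: cvgMr.
  exact: meval_radseq_ccvg.
apply: squeeze_cvgr (cvg_cst 0) h; apply: nearW => j.
apply/andP; split; first exact: normc_ge0.
set w := meval (torus_point (radseq j) t) P.
have w0 : w != 0 := meval_radseq_neq0 j t.
(* With A = P(z) and B = P(r_j z), the ratio A/B, bounded by 2^D, takes the place of a lower bound
   on |B|. *)
have e (A B : C) : A != 0 -> B != 0 -> A / B - 1 = (A / B) * A^-1 * (A - B).
  by move=> A0 B0; field; rewrite A0 B0.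
have -> : bsum (x j) t = (meval z P / w) * (meval z P)^-1 * (meval z P - w).
  rewrite bsum_x; exact: e (meval_torus_neq0 t) w0.
have e' (A B : C) : normc (A / B * A^-1 * (A - B)) =
    normc A / normc B * (normc A)^-1 * normc (B - A).
  by rewrite !Normc.normcM !Normc.normcV normcBC.
rewrite e'; apply: ler_wpM2r; first exact: normc_ge0.
apply: ler_wpM2r; first by rewrite invr_ge0 normc_ge0.
exact: meval_ratio_le.
Qed.

Definition inner_coef : M -> C := fmul (fpoly (reflect_poly P)) c.

(** For absolutely summable a both products have boundary sums, of equal modulus at every point
    since |P*| = |P| on the torus. *)
Lemma nrm_reflect_mul a : csmb a ->
  nrm (fmul (fpoly (reflect_poly P)) a) = nrm (fmul (fpoly P) a).
Proof.
move=> sa; have s1 := csmb_fmul (reflect_poly P) sa; have s2 := csmb_fmul P sa.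
have le u v : csmb u -> csmb v ->
    (forall t : d.-tuple T, normc (bsum u t) <= normc (bsum v t)) -> nrm u <= nrm v.
  move=> su sv uv; rewrite -[leRHS]mul1r -(expr1n R 2).
  by apply: nrm_le_bsum => // t; rewrite mul1r.
have e (t : d.-tuple T) : normc (bsum (fmul (fpoly (reflect_poly P)) a) t) =
    normc (bsum (fmul (fpoly P) a) t).
  by rewrite !bsum_fmul // !Normc.normcM meval_reflect.
have le1 (u v : R) : u = v -> u <= v by move=> ->.
apply: le_anti; apply/andP; split.
  by apply: (le _ _ s1 s2) => t; exact: le1 (e t).
by apply: (le _ _ s2 s1) => t; exact: le1 (esym (e t)).
Qed.

Lemma fmul_inner_poly a k : fmul (fpoly P) (fmul inner_coef a) k =
  fmul (fpoly (reflect_poly P)) a k.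
Proof.
rewrite fmulA; have -> : fmul (fpoly P) inner_coef = fpoly (reflect_poly P).
  apply/funext => j; rewrite /inner_coef fmulA.
  have -> : fmul (fpoly P) (fpoly (reflect_poly P)) =
      fmul (fpoly (reflect_poly P)) (fpoly P) by apply/funext => i; exact: fmulC.
  rewrite -fmulA; have -> : fmul (fpoly P) c = fpoly 1.
    by apply/funext => i; apply: fmul_psinv; exact: P0_neq0.
  by rewrite fmulC fmul1.
by [].
Qed.

(* w j = h c_{r_j}, so that P w_j --> h strongly while P* w_j --> b h. *)
Let w p j := fmul (fpoly p) (crad j).

Lemma csmb_w p j : csmb (w p j).
Proof. by apply: csmb_fmul; exact: csmb_crad. Qed.

Lemma Pw_cvg p : (fun j => nrm (fun k => fmul (fpoly P) (w p j) k - fpoly p k))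
  @ \oo --> (0 : R).
Proof.
set K := (\sum_(m <- msupp p) normc (mcoeff m p)) ^+ 2.
have h : (fun j => K * nrm (x j)) @ \oo --> (0 : R).
  by rewrite -(mulr0 K); apply: cvgMr; exact: nrm_x_cvg0.
apply: squeeze_cvgr (cvg_cst 0) h; apply: nearW => j /=; rewrite nrm_ge0 /=.
(* P (p c_j) - p = p (P c_j - 1) = p x_j, where c_j is the dilated series of 1/P. *)
have -> : nrm (fun k => fmul (fpoly P) (w p j) k - fpoly p k) =
    nrm (fmul (fpoly p) (x j)).
  apply: eq_nrm => k; rewrite /x fmulBr fmul_fpolyM mulr1.
  have -> : fmul (fpoly p) (fmul (fpoly P) (crad j)) =
      fmul (fpoly P) (fmul (fpoly p) (crad j)); last by [].
  apply/funext => i; rewrite !fmulA.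
  by have -> : fmul (fpoly p) (fpoly P) = fmul (fpoly P) (fpoly p)
    by apply/funext => l; exact: fmulC.
exact: nrm_fmul_le (csmb_x j).
Qed.

Lemma nrm_Pw_cvg p : (fun j => nrm (fmul (fpoly P) (w p j))) @ \oo --> nrm (fpoly p).
Proof.
apply: nrm_cvg; last exact: Pw_cvg; last exact/csmb_l2/csmb_poly.
by move=> j; apply: csmb_l2; apply: csmb_fmul; exact: csmb_w.
Qed.

(** P* w_j tends to b p coefficientwise, and |P* w_j| = |P w_j| tends to |p|; semicontinuity gives a
    contraction, the equality coming in [inner_poly_isometry]. *)
Lemma inner_poly_le p : l2 (fmul inner_coef (fpoly p)) /\
  nrm (fmul inner_coef (fpoly p)) <= nrm (fpoly p).
Proof.
apply: (@nrm_coef_cvg _ _ (fun j => fmul (fpoly (reflect_poly P)) (w p j))).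
- move=> k; have -> : fmul inner_coef (fpoly p) k =
      fmul (fpoly (reflect_poly P)) (fmul (fpoly p) c) k.
    rewrite /inner_coef -fmulA; congr (fmul _ _ k).
    by apply/funext => i; exact: fmulC.
  apply: ccvg_fmul => i; apply: ccvg_fmul => l; exact: dilate_ccvg.
- by move=> j; apply: csmb_l2; apply: csmb_fmul; exact: csmb_w.
- rewrite (_ : (fun j => _) = fun j => nrm (fmul (fpoly P) (w p j))).
    exact: nrm_Pw_cvg.
  by apply/funext => j; apply: nrm_reflect_mul; exact: csmb_w.
Qed.

Lemma fpoly_tpolyE N a : fpoly (tpoly N a) = trunc N a.
Proof. by apply/funext => k; exact: fpoly_tpoly. Qed.

(** Coefficients of b h below degree N involve only the truncation of h at N, for which the
    polynomial case bounds them. *)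
Lemma inner_le h : l2 h -> l2 (fmul inner_coef h) /\ nrm (fmul inner_coef h) <= nrm h.
Proof.
move=> sh; apply: nrm_fatou => N.
have [s1 l1] := inner_poly_le (tpoly N h); rewrite fpoly_tpolyE in s1 l1.
have -> : tsum N (fun k => normc (fmul inner_coef h k) ^+ 2) =
    tsum N (fun k => normc (fmul inner_coef (trunc N h) k) ^+ 2).
  by apply: eq_tsum => k kN; rewrite fmul_trunc.
apply: le_trans (tsum_le_nrm N s1) _; apply: le_trans l1 _.
by rewrite nrm_trunc; exact: tsum_le_nrm.
Qed.

Lemma l2_inner h : l2 h -> l2 (fmul inner_coef h).
Proof. by case/inner_le. Qed.

Lemma inner_cvg (y : nat -> M -> C) h : (forall j, l2 (y j)) -> l2 h ->
  (fun j => nrm (fun k => y j k - h k)) @ \oo --> (0 : R) ->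
  (fun j => nrm (fmul inner_coef (y j))) @ \oo --> nrm (fmul inner_coef h).
Proof.
move=> sy sh yh; apply: nrm_cvg; [by move=> j; exact: l2_inner|exact: l2_inner|].
apply: squeeze_cvgr (cvg_cst 0) yh; apply: nearW => j /=; rewrite nrm_ge0 /=.
rewrite (eq_nrm (b := fmul inner_coef (fun k => y j k - h k))).
  by apply: (inner_le _).2; exact: l2B.
by move=> k; rewrite fmulBr.
Qed.

(** b (P w_j) = P* w_j has norm exactly |P w_j|. Since P w_j tends to p in norm and b is now a
    contraction, the two sides converge to |b p| and |p|. *)
Lemma inner_poly_isometry p : nrm (fmul inner_coef (fpoly p)) = nrm (fpoly p).
Proof.
have sw j : l2 (fmul (fpoly P) (w p j)) by apply/csmb_l2/csmb_fmul/csmb_w.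
have h1 := inner_cvg sw (csmb_l2 (csmb_poly p)) (Pw_cvg p).
have h2 := @nrm_Pw_cvg p.
have e : (fun j => nrm (fmul inner_coef (fmul (fpoly P) (w p j)))) =
    (fun j => nrm (fmul (fpoly P) (w p j))).
  apply/funext => j.
  transitivity (nrm (fmul (fpoly (reflect_poly P)) (w p j))); last exact: nrm_reflect_mul (csmb_w p j).
  apply: eq_nrm => k; rewrite -fmul_inner_poly !fmulA.
  by have -> : fmul inner_coef (fpoly P) = fmul (fpoly P) inner_coef
    by apply/funext => i; exact: fmulC.
by rewrite e in h1; exact: (cvg_unique _ h1 h2).
Qed.

Lemma inner_isometry h : l2 h -> nrm (fmul inner_coef h) = nrm h.
Proof.
move=> sh; have st N := @l2_trunc _ _ N h.
have h0 : (fun N => nrm (fun k => trunc N h k - h k)) @ \oo --> (0 : R).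
  by under eq_fun do rewrite nrmBC; exact: nrm_tail_cvg.
have h1 := inner_cvg st sh h0; have h2 := nrm_cvg st sh h0.
have e : (fun N => nrm (fmul inner_coef (trunc N h))) = (fun N => nrm (trunc N h)).
  by apply/funext => N; rewrite -fpoly_tpolyE inner_poly_isometry.
by rewrite e in h1; exact: (cvg_unique _ h1 h2).
Qed.

Lemma inner_coef0 : inner_coef (@mnm0 d) = alpha P.
Proof.
rewrite /inner_coef fmul_at0 /alpha !meval0_mcoeff; congr (_ * _).
exact: psinv_at0.
Qed.

(** [ev_fmul] handles polynomial multipliers only; multiplying by P(z), which is nonzero, brings the
    claim to P b = P*. *)
Lemma ev_inner h z : polydisk z -> csmb (eva h z) -> csmb (eva (fmul inner_coef h) z) ->
  ev (fmul inner_coef h) z = inner_quotient P z * ev h z.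
Proof.
move=> zD sh sbh; have Pz : meval z P != 0 by apply: P_neq0; left.
apply: (mulfI Pz); rewrite -ev_fmul // /inner_quotient.
rewrite (ev_ext _ (b := fmul (fpoly (reflect_poly P)) h)); last exact: fmul_inner_poly.
by rewrite ev_fmul // mulrA mulrCA divff // mulr1.
Qed.

End inner_isometry.

(** * Adjoints of isometric multiplications *)

Section adjoint.
Variables (R : realType) (d : nat).
Local Notation M := (multinom d).
Local Notation C := R[i].
Local Notation normc := (@Normc.normc R).
Local Notation Re := (@complex.Re R).
Local Notation Im := (@complex.Im R).
Implicit Types (f g h : M -> C).

Definition isometric (b : M -> C) := forall h, l2 h ->
  l2 (fmul b h) /\ nrm (fmul b h) = nrm h.

Definition adj (b f : M -> C) : M -> C := fun l => dot f (mshift l b).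

Lemma Re_dot f g : l2 f -> l2 g ->
  Re (dot f g) = (nrm (fun k => f k + g k) - nrm f - nrm g) / 2.
Proof. by move=> sf sg; rewrite nrmD //; lra. Qed.

Lemma Im_dot f g : l2 f -> l2 g ->
  Im (dot f g) = Re (dot f (fun k => Complex 0 1 * g k)).
Proof. by move=> sf sg; rewrite dotZr //; case: (dot f g) => u v /=; ring. Qed.

Lemma dot_ccvg f (x : nat -> M -> C) a : l2 f -> (forall j, l2 (x j)) -> l2 a ->
  (fun j => nrm (fun k => x j k - a k)) @ \oo --> (0 : R) ->
  ccvg (fun j => dot f (x j)) (dot f a).
Proof.
move=> sf sx sa h.
have hs : (fun j => Num.sqrt (nrm f * nrm (fun k => x j k - a k))) @ \oo --> (0 : R).
  rewrite -(sqrtr0 R) -(mulr0 (nrm f)).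
  apply: (continuous_cvg _ (@sqrt_continuous R _)); exact: cvgMr.
apply: squeeze_cvgr (cvg_cst 0) hs; apply: nearW => j.
apply/andP; split; first exact: normc_ge0.
rewrite -dotBr // -[leLHS]ger0_norm ?normc_ge0 // -sqrtr_sqr; apply: ler_wsqrtr.
by apply: dot_CauchySchwarz => //; exact: l2B.
Qed.

Variable b : M -> C.
Hypothesis iso : isometric b.

Lemma l2_iso h : l2 h -> l2 (fmul b h).
Proof. by case/iso. Qed.

Lemma nrm_iso h : l2 h -> nrm (fmul b h) = nrm h.
Proof. by case/iso. Qed.

Lemma l2_isometric_coef : l2 b.
Proof.
have e : fmul b (fpoly 1) = b by apply/funext => k; rewrite fmulC fmul1.
rewrite -e; apply: l2_iso; apply: (@l2_fin _ _ _ 1%N) => k k1.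
rewrite /fpoly mcoeff1; case: eqP => // k0; by rewrite k0 mdeg0 in k1.
Qed.

(** Polarization: norms determine the real part, and Im <f, g> = Re <f, i g>. *)
Lemma dot_iso f g : l2 f -> l2 g -> dot (fmul b f) (fmul b g) = dot f g.
Proof.
move=> sf sg; have hRe u v : l2 u -> l2 v -> Re (dot (fmul b u) (fmul b v)) = Re (dot u v).
  move=> su sv; have su' := l2_iso su; have sv' := l2_iso sv.
  rewrite !Re_dot // (nrm_iso su) (nrm_iso sv); congr ((_ - _ - _) / _).
  rewrite -[RHS]nrm_iso; last exact: l2D.
  by apply: eq_nrm => k; rewrite fmulDr.
have sig : l2 (fun k => Complex 0 1 * g k) by exact: l2Z.
apply: eq_ReIm; first exact: hRe.
have sf' := l2_iso sf; have sg' := l2_iso sg.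
rewrite !Im_dot // -(hRe _ _ sf sig).
have -> : fmul b (fun k => Complex 0 1 * g k) = fun k => Complex 0 1 * fmul b g k.
  by apply/funext => k; rewrite fmulZr.
by [].
Qed.

Lemma adj_trunc N f t : l2 f ->
  dot f (fmul b (trunc N t)) = tsum N (fun l => adj b f l * conjc (t l)).
Proof.
move=> sf; have sb := l2_isometric_coef.
have e k : fmul b (trunc N t) k = \sum_(l : bmultinom d N) t l * mshift l b k.
  rewrite -fmul_fpoly_tpoly; congr (fmul b _ k).
  by apply/funext => j; rewrite fpoly_tpoly.
rewrite (eq_dot (a' := f) (fun _ => erefl) e).
rewrite (@dot_sumr _ _ _ _ _ (fun (l : bmultinom d N) k => t l * mshift l b k)) //; last first.
  by move=> l; apply: l2Z; exact: l2_mshift.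
apply: eq_bigr => l _; rewrite dotZr //; first by rewrite mulrC.
exact: l2_mshift.
Qed.

(* Bessel's inequality for the orthonormal family z^l b. *)
Lemma adj_le f : l2 f -> l2 (adj b f) /\ nrm (adj b f) <= nrm f.
Proof.
move=> sf; apply: nrm_fatou => N.
have st := @l2_trunc _ _ N (adj b f).
have := nrm_ge0 (fun k => f k - fmul b (trunc N (adj b f)) k).
have st' := l2_iso st.
rewrite nrmB // nrm_iso // adj_trunc // nrm_trunc.
set S := tsum N _ => h.
suff e : Re (tsum N (fun l => adj b f l * conjc (adj b f l))) = S.
  by rewrite e in h; lra.
by rewrite /tsum Re_sum; apply: eq_bigr => l _; rewrite mulc_conj.
Qed.

Lemma l2_adj f : l2 f -> l2 (adj b f).
Proof. by case/adj_le. Qed.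

Lemma nrm_adj_le f : l2 f -> nrm (adj b f) <= nrm f.
Proof. by case/adj_le. Qed.

Lemma trunc_cvg h : l2 h -> (fun N => nrm (fun k => trunc N h k - h k)) @ \oo --> (0 : R).
Proof. by move=> sh; under eq_fun do rewrite nrmBC; exact: nrm_tail_cvg. Qed.

(** [adj] is defined by its coefficients, so the identity is first known for truncations of h; both
    sides are continuous in h. *)
Lemma adj_dot f h : l2 f -> l2 h -> dot f (fmul b h) = dot (adj b f) h.
Proof.
move=> sf sh; have st N := @l2_trunc _ _ N h.
have h1 : ccvg (fun N => dot f (fmul b (trunc N h))) (dot f (fmul b h)).
  apply: dot_ccvg => //; [by move=> j; exact: l2_iso|exact: l2_iso|].
  have e : (fun j => nrm (fun k => fmul b (trunc j h) k - fmul b h k)) =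
      (fun j => nrm (fun k => trunc j h k - h k)).
    apply/funext => j; rewrite -[RHS]nrm_iso; last exact: l2B.
    by apply: eq_nrm => k; rewrite fmulBr.
  by rewrite e; exact: trunc_cvg.
have h2 := dot_ccvg (l2_adj sf) st sh (trunc_cvg sh).
have e : (fun N => dot f (fmul b (trunc N h))) = (fun N => dot (adj b f) (trunc N h)).
  apply/funext => N; rewrite adj_trunc // /dot.
  case: (@fin_supp_ctot _ _ (fun k => adj b f k * conjc (trunc N h k)) N).
    by move=> k /trunc_high ->; rewrite conjc0 mulr0.
  by move=> _ ->; apply: eq_tsum => k kN; rewrite /trunc kN.
by rewrite e in h1; exact: ccvg_unique h1 h2.
Qed.

Lemma residual_orth f h : l2 f -> l2 h ->
  dot (fun k => f k - fmul b (adj b f) k) (fmul b h) = 0.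
Proof.
move=> sf sh; have sa := l2_adj sf.
have sa' := l2_iso sa; have sh' := l2_iso sh.
by rewrite dotBl // dot_iso // adj_dot // subrr.
Qed.

Lemma adjD f g k : l2 f -> l2 g -> adj b (fun k => f k + g k) k = adj b f k + adj b g k.
Proof.
by move=> sf sg; rewrite /adj dotDl //; apply: l2_mshift; exact: l2_isometric_coef.
Qed.

(** z^l b lives on indices k >= l. For |l| > D these lie outside the support of f; for |l| = D only
    k = l remains, where z^l b has the coefficient b_0. *)
Lemma adj_support D f : (forall k, (D < mdeg k)%N -> f k = 0) ->
  (forall l, (D < mdeg l)%N -> adj b f l = 0) /\
  (forall l, mdeg l = D -> adj b f l = f l * conjc (b (@mnm0 d))).
Proof.
move=> fD.
have le_deg (l k : M) : mpoly.lem l k -> mdeg k = (mdeg l + mdeg (mnm_sub k l))%N.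
  by move=> lk; rewrite -{1}(submK lk) mdegD addnC.
have adjE l : adj b f l = tsum D.+1 (fun k => f k * conjc (mshift l b k)).
  rewrite /adj /dot; case: (@fin_supp_ctot _ _
    (fun k => f k * conjc (mshift l b k)) D.+1) => // k kD; by rewrite fD ?mul0r.
split=> l lD; rewrite adjE.
  apply: big1 => k _; rewrite /mshift; case: ifP => [lk|_]; last by rewrite conjc0 mulr0.
  have := bmdeg k; rewrite (le_deg _ _ lk) => h.
  by have := leq_ltn_trans (leq_addr _ _) h; rewrite ltnS leqNgt lD.
have lD1 : (mdeg l < D.+1)%N by rewrite lD.
rewrite /tsum (bigD1 (BMultinom lD1)) //= big1 ?addr0.
  have -> : mshift l b l = b (@mnm0 d); last by [].
  rewrite /mshift lepm_refl; congr b; apply/mnmP => i.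
  by rewrite mnmBE subnn mnm0E.
move=> k; rewrite -val_eqE /= => kl; rewrite /mshift; case: ifP => [lk|_]; last by rewrite conjc0 mulr0.
have kl0 : mdeg (mnm_sub k l) == 0%N.
  have h : (mdeg k <= D)%N by rewrite -ltnS bmdeg.
  by rewrite (le_deg _ _ lk) lD -[leqRHS]addn0 leq_add2l leqn0 in h.
case/eqP: kl; move: kl0; rewrite mdeg_eq0 => /eqP kl0.
by rewrite -(submK lk) kl0 add0m.
Qed.

End adjoint.

(** * Products of adjoints and their decay *)

Section adjoint_products.
Variables (R : realType) (d : nat).
Local Notation M := (multinom d).
Local Notation C := R[i].
Local Notation normc := (@Normc.normc R).
Implicit Types (f g h : M -> C) (bs : nat -> M -> C).

Lemma nonneg_cvg0P (u : nat -> R) : (forall n, 0 <= u n) ->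
  (u @ \oo --> (0 : R)) <->
  (forall e, 0 < e -> exists N, forall n, (N <= n)%N -> u n <= e).
Proof.
move=> u0; split=> [/cvgr0Pnorm_le h e e0|h].
  have [N _ hN] := h e e0; exists N => n Nn.
  by have := hN n Nn; rewrite /= ger0_norm.
apply/cvgr0Pnorm_le => e e0; have [N hN] := h e e0.
by exists N => // n /= Nn; rewrite ger0_norm // hN.
Qed.

(** The last index is outermost, following the recursion that produces f_{n+1} from f_n. *)
Fixpoint adjs bs n f : M -> C :=
  if n is m.+1 then adj (bs m) (adjs bs m f) else f.

Lemma adjs_add bs m n f : adjs bs (m + n) f = adjs (fun j => bs (m + j)%N) n (adjs bs m f).
Proof. by elim: n => [|n IH]; rewrite ?addn0 // addnS /= IH. Qed.

Section isometric_sequence.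
Variable bs : nat -> M -> C.
Hypothesis iso : forall n, isometric (bs n).

Lemma l2_adjs n f : l2 f -> l2 (adjs bs n f).
Proof. by move=> sf; elim: n => //= n IH; exact: l2_adj. Qed.

Lemma nrm_adjs_le n f : l2 f -> nrm (adjs bs n f) <= nrm f.
Proof.
move=> sf; elim: n => //= n IH; apply: le_trans IH.
by apply: nrm_adj_le => //; exact: l2_adjs.
Qed.

Lemma adjsD n f g : l2 f -> l2 g ->
  adjs bs n (fun k => f k + g k) = fun k => adjs bs n f k + adjs bs n g k.
Proof.
move=> sf sg; elim: n => //= n IH; rewrite IH; apply/funext => k.
by apply: adjD => //; exact: l2_adjs.
Qed.

Lemma nrm_adjsD_le n f g : l2 f -> l2 g ->
  nrm (adjs bs n (fun k => f k + g k)) <= 2 * nrm (adjs bs n f) + 2 * nrm (adjs bs n g).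
Proof. by move=> sf sg; rewrite adjsD //; apply: nrmD_le; exact: l2_adjs. Qed.

Lemma adjs_support D n f : (forall k, (D < mdeg k)%N -> f k = 0) ->
  (forall l, (D < mdeg l)%N -> adjs bs n f l = 0) /\
  (forall l, mdeg l = D ->
    normc (adjs bs n f l) = (\prod_(j < n) normc (bs j (@mnm0 d))) * normc (f l)).
Proof.
move=> fD; elim: n => [|n [IH1 IH2]]; first by split=> // l _; rewrite big_ord0 mul1r.
have [h1 h2] := adj_support (bs n) IH1; split; [exact: h1|move=> l lD].
have -> : adjs bs n.+1 f l = adjs bs n f l * conjc (bs n (@mnm0 d)) by exact: h2.
rewrite Normc.normcM IH2 // normc_conj big_ord_recr /=.
exact: mulrAC.
Qed.

End isometric_sequence.

(** Every tail is included: one vanishing factor kills the full product but says nothing of later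
    ones, and the induction on the degree restarts at a later index. *)
Definition decaying bs := forall m,
  (fun n => \prod_(j < n) normc (bs (m + j)%N (@mnm0 d))) @ \oo --> (0 : R).

Lemma isometric_shift bs m : (forall n, isometric (bs n)) ->
  forall n, isometric (bs (m + n)%N).
Proof. by move=> iso n; exact: iso. Qed.

Lemma decaying_shift bs m : decaying bs -> decaying (fun j => bs (m + j)%N).
Proof.
by move=> h m'; have := h (m + m')%N; under eq_fun do under eq_bigr do rewrite -addnA.
Qed.

(* The adjoints are triangular for the grading by degree, with the value at the
   origin on the diagonal: the top-degree part is killed by the product of these
   values, the lower part by induction on the degree. *)
Lemma adjs_poly_cvg0 D bs f : (forall n, isometric (bs n)) -> decaying bs ->
  (forall k, (D <= mdeg k)%N -> f k = 0) ->
  (fun n => nrm (adjs bs n f)) @ \oo --> (0 : R).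
Proof.
elim: D bs f => [|D IH] bs f iso dec fD.
  have f0 : f = fun=> 0 by apply/funext => k; exact: fD.
  rewrite (_ : (fun n => _) = fun=> 0); first exact: cvg_cst.
  apply/funext => n; apply/eqP; rewrite eq_le nrm_ge0 andbT.
  apply: le_trans (nrm_adjs_le iso n _) _; first by rewrite f0; exact: l20.
  rewrite f0 /nrm (eq_tot (y := fun=> 0)) ?tot0 // => k.
  by rewrite Normc.normc0 expr0n.
have sf : l2 f by exact: l2_fin fD.
apply/nonneg_cvg0P => [n|e e0]; first exact: nrm_ge0.
pose q m : R := (\prod_(j < m) normc (bs j (@mnm0 d))) ^+ 2 * nrm f.
have q0 : q @ \oo --> (0 : R).
  have h := dec 0%N; have := cvgM h h; rewrite mulr0 => /(_ _) h2.
  rewrite -(mul0r (nrm f)); apply: cvgMl; exact: h2.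
have q_ge0 m : 0 <= q m by rewrite mulr_ge0 ?sqr_ge0 ?nrm_ge0.
(* Since |u + v|^2 <= 2|u|^2 + 2|v|^2, two pieces of size e/4 give e. Here m makes the top-degree
   piece small; contractions keep it so. *)
have [m hm] := (nonneg_cvg0P q_ge0).1 q0 (e / 4) (divr_gt0 e0 (ltr0n _ 4)).
have {}hm := hm m (leqnn m).
pose v := adjs bs m f; have sv : l2 v by exact: l2_adjs.
pose top k := if mdeg k == D then v k else 0.
pose low k := if mdeg k == D then 0 else v k.
have fD' k : (D < mdeg k)%N -> f k = 0 by exact: fD.
have [vD vtop] := adjs_support bs m fD'.
have stop : l2 top by apply: l2_le sv => k; rewrite /top; case: ifP; rewrite ?Normc.normc0 ?normc_ge0.
have slow : l2 low by apply: l2_le sv => k; rewrite /low; case: ifP; rewrite ?Normc.normc0 ?normc_ge0.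
have ntop : nrm top <= q m.
  rewrite /q /nrm -totZ //; apply: le_tot => // [|k]; first exact: smbZ.
  rewrite /top; case: eqP => [kD|_]; first by rewrite vtop // exprMn.
  by rewrite Normc.normc0 expr0n mulr_ge0 ?sqr_ge0.
have lowD k : (D <= mdeg k)%N -> low k = 0.
  rewrite leq_eqVlt eq_sym /low => /orP[->//|Dk].
  by rewrite (gtn_eqF Dk); exact: vD.
have iso' := @isometric_shift bs m iso.
have [N hN] := (nonneg_cvg0P (fun n => nrm_ge0 _)).1
  (IH _ _ iso' (@decaying_shift bs m dec) lowD) (e / 4) (divr_gt0 e0 (ltr0n _ 4)).
exists (m + N)%N => n mn.
have -> : n = (m + (n - m))%N by rewrite subnKC // (leq_trans _ mn) ?leq_addr.
have Nn : (N <= n - m)%N by rewrite leq_subRL ?mn // (leq_trans _ mn) ?leq_addr.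
rewrite adjs_add -/v; have -> : v = fun k => top k + low k.
  by apply/funext => k; rewrite /top /low; case: ifP; rewrite ?addr0 ?add0r.
apply: le_trans (nrm_adjsD_le iso' _ stop slow) _.
have := nrm_adjs_le iso' (n - m) stop; have := hN _ Nn; lra.
Qed.

(** The products of adjoints are contractions uniformly in n, so the polynomial case extends by
    density of truncations. *)
Lemma adjs_cvg0 bs f : (forall n, isometric (bs n)) -> decaying bs -> l2 f ->
  (fun n => nrm (adjs bs n f)) @ \oo --> (0 : R).
Proof.
move=> iso dec sf; apply/nonneg_cvg0P => [n|e e0]; first exact: nrm_ge0.
have [D hD] := (nonneg_cvg0P (fun n => nrm_ge0 _)).1 (nrm_tail_cvg sf) (e / 4)
  (divr_gt0 e0 (ltr0n _ 4)).
have {}hD := hD D (leqnn D).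
have st := @l2_trunc _ _ D f.
have str : l2 (fun k => f k - trunc D f k) by exact: l2B.
have [N hN] := (nonneg_cvg0P (fun n => nrm_ge0 _)).1
  (adjs_poly_cvg0 iso dec (@trunc_high _ _ D f)) (e / 4) (divr_gt0 e0 (ltr0n _ 4)).
exists N => n Nn; have -> : f = fun k => trunc D f k + (f k - trunc D f k).
  by apply/funext => k; rewrite addrC subrK.
apply: le_trans (nrm_adjsD_le iso _ st str) _.
have := nrm_adjs_le iso n str; have := hN _ Nn; lra.
Qed.

(** From 1 + x <= e^x at x = a_j - 1, the product is at most exp of minus the partial sum of the 1 -
    a_j. *)
Lemma prod_cvg0 (a : nat -> R) : (forall n, 0 <= a n <= 1) ->
  (\sum_(0 <= n <oo) (1 - a n)%:E = +oo)%E ->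
  (fun n => \prod_(j < n) a j) @ \oo --> (0 : R).
Proof.
move=> a01 soo.
have le_exp n : \prod_(j < n) a j <= expR (- \sum_(0 <= j < n) (1 - a j)).
  elim: n => [|n IH]; first by rewrite big_ord0 big_nil oppr0 expR0.
  have /andP[an0 an1] := a01 n.
  rewrite big_ord_recr big_nat_recr //= opprD expRD; apply: ler_pM => //.
    by apply: prodr_ge0 => j _; case/andP : (a01 j).
  by rewrite opprB; have := expR_ge1Dx (a n - 1); rewrite addrC subrK.
have soo' : (fun n => \sum_(0 <= j < n) (1 - a j)) @ \oo --> +oo.
  have h : (fun n => (\sum_(0 <= j < n) (1 - a j)%:E)%E) @ \oo --> +oo%E.
    rewrite -soo; apply: is_cvg_ereal_nneg_natsum => j _.
    by rewrite lee_fin subr_ge0; case/andP : (a01 j).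
  apply/cvgeryP; rewrite (_ : (fun n => _) = fun n => (\sum_(0 <= j < n) (1 - a j)%:E)%E) //.
  by apply/funext => n; rewrite sumEFin.
have h : (fun n => expR (- \sum_(0 <= j < n) (1 - a j))) @ \oo --> (0 : R).
  exact: (cvg_comp _ _ soo' (@cvgr_expR R)).
apply: squeeze_cvgr (cvg_cst 0) h; apply: nearW => n; rewrite le_exp andbT.
by apply: prodr_ge0 => j _; case/andP : (a01 j).
Qed.

End adjoint_products.

(** * Boundary values and the Hardy space *)

Section riesz_fischer.
Context (dd : measure_display) (X : measurableType dd) (R : realType).
Variable mu : {measure set X -> \bar R}.
Local Notation C := R[i].
Local Notation normc := (@Normc.normc R).

(** e_n = 2c 2^-n is the sum of the remaining gap bounds, so u - e increases, u + e decreases, and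
    their difference tends to 0. *)
Lemma fast_cauchy_cvg (u : nat -> R) (c : R) :
  (forall n, `|u n.+1 - u n| <= c * 2^-1 ^+ n) -> cvgn u.
Proof.
move=> hu; have c0 : 0 <= c by have := hu 0%N; rewrite expr0 mulr1; apply: le_trans.
pose e n : R := c * 2 * 2^-1 ^+ n.
have e0 : e @ \oo --> (0 : R).
  rewrite -(mulr0 (c * 2)); apply: cvgMr; apply: cvg_expr.
  by rewrite ger0_norm ?invr_ge0 // invf_lt1 // ltr1n.
have eS n : e n - e n.+1 = c * 2^-1 ^+ n by rewrite /e exprS; field.
have /nondecreasing_seqP nd : nondecreasing_seq (fun n => u n - e n).
  apply/nondecreasing_seqP => n; have := hu n; rewrite -eS ler_norml => /andP[h _].
  by lra.
have /nonincreasing_seqP ni : nonincreasing_seq (fun n => u n + e n).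
  apply/nonincreasing_seqP => n; have := hu n; rewrite -eS ler_norml => /andP[_ h].
  by lra.
have e_ge0 n : 0 <= e n by rewrite !mulr_ge0 ?exprn_ge0 ?invr_ge0.
have cv : cvgn (fun n => u n - e n).
  apply: nondecreasing_is_cvgn; first exact/nondecreasing_seqP.
  exists (u 0%N + e 0%N) => _ [n _ <-].
  apply: (@le_trans _ _ (u n + e n)); first by have := e_ge0 n; lra.
  by have /nonincreasing_seqP := ni; apply.
rewrite (_ : u = (fun n => (u n - e n) + e n)); last by apply/funext => n; rewrite subrK.
by apply: is_cvgD => //; apply/cvg_ex; exists 0.
Qed.

Lemma limn_einf_le (u : nat -> \bar R) (c : \bar R) (j : nat) :
  (forall i, (j <= i)%N -> (u i <= c)%E) -> (limn_einf u <= c)%E.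
Proof.
move=> uc; rewrite limn_einf_lim; apply: lime_le; first exact: is_cvg_einfs.
exists j => // i /= ji; apply: le_trans (uc i ji).
by apply: ereal_inf_lbound; exists i => //=.
Qed.

Lemma cvg_normc2_sub (u : nat -> C) (l c : C) : ccvg u l ->
  (fun n => normc (u n - c) ^+ 2) @ \oo --> normc (l - c) ^+ 2.
Proof.
move=> ul; have ulc := normc_ccvg (ccvgD ul (ccvg_cst (- c))).
exact: cvgM.
Qed.

(* A subsequence of an L2-Cauchy sequence with summable gaps converges almost
   everywhere, and Fatou's lemma identifies its limit. *)
Lemma riesz_fischer (S : nat -> X -> C) (K : R) : 0 <= K ->
  (forall j, cmeas (S j)) ->
  (forall i j, (j <= i)%N ->
    (\int[mu]_x (normc (S i x - S j x) ^+ 2)%:E <= (K * 16^-1 ^+ j)%:E)%E) ->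
  exists phi : X -> C, cmeas phi /\ forall j,
    (\int[mu]_x (normc (phi x - S j x) ^+ 2)%:E <= (K * 16^-1 ^+ j)%:E)%E.
Proof.
move=> K0 mS cauchyS.
(* The weight 4^j splits the rate 16^-j: the integrals of the terms are at most K 4^-j, of sum below
   2K, while finiteness of G at x still bounds the gaps there by a multiple of 2^-j. *)
pose Gj j x : \bar R := (4 ^+ j * normc (S j.+1 x - S j x) ^+ 2)%:E.
have mGj j : measurable_fun setT (Gj j).
  apply/measurable_EFinP; apply: measurable_funM => //.
  by apply: measurable_normc2; exact: cmeasB.
have Gj0 j x : (0 <= Gj j x)%E by rewrite lee_fin; apply: mulr_ge0; [exact: exprn_ge0|exact: sqr_ge0].
pose G x := (\sum_(0 <= j <oo) Gj j x)%E.
have mG : measurable_fun setT G.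
  by apply: ge0_emeasurable_sum => // k _; exact: mGj.
have G0 x : (0 <= G x)%E by exact: nneseries_ge0.
have intG : (\int[mu]_x G x < +oo)%E.
  rewrite integral_nneseries //.
  apply: (@le_lt_trans _ _ (K * 2)%:E); last exact: ltry.
  apply: lime_le.
    by apply: is_cvg_ereal_nneg_natsum => j _; apply: integral_ge0.
  apply: nearW => n.
  apply: (@le_trans _ _ (\sum_(0 <= j < n) (K * 4^-1 ^+ j)%:E)%E).
    apply: lee_sum => j _; rewrite /Gj; under eq_integral do rewrite EFinM.
    have mD : measurable_fun setT (fun x => (normc (S j.+1 x - S j x) ^+ 2)%:E).
      by apply/measurable_EFinP/measurable_normc2; exact: cmeasB.
    have D0 x : setT x -> (0 <= (normc (S j.+1 x - S j x) ^+ 2)%:E)%E.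
      by rewrite lee_fin sqr_ge0.
    have j0 : (0%R <= (4 ^+ j)%:E :> \bar R)%E by rewrite lee_fin exprn_ge0.
    rewrite (ge0_integralZl mu measurableT mD D0 j0).
    apply: le_trans (lee_wpmul2l _ (cauchyS _ _ (leqnSn j))) _.
      by rewrite lee_fin exprn_ge0.
    rewrite -EFinM lee_fin mulrCA ler_wpM2l // -exprMn.
    by rewrite (_ : 4 * 16^-1 = 4^-1 :> R) //; field.
  rewrite sumEFin lee_fin -mulr_sumr ler_wpM2l //.
  have : \sum_(0 <= j < n) 4^-1 ^+ j <= 4 / 3 * (1 - 4^-1 ^+ n) :> R.
    elim: n => [|n IH]; first by rewrite big_nil expr0; lra.
    have h : 0 <= 4^-1 ^+ n :> R by rewrite exprn_ge0.
    by rewrite big_nat_recr //= exprS; lra.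
  have h : 0 <= 4^-1 ^+ n :> R by rewrite exprn_ge0.
  by lra.
pose A := setT `&` [set x | G x \is a fin_num].
have mA : measurable A by exact: emeasurable_fin_num.
have aeA : {ae mu, forall x, A x}.
  have iG : mu.-integrable setT G.
    apply/integrableP; split => //.
    by under eq_integral do rewrite gee0_abs //.
  have := integrable_ae measurableT iG; apply: filterS => x h.
  by split => //; exact: h.
have cvS x : A x -> exists l, ccvg (S^~ x) l.
  move=> [_ /= Gx]; pose g := fine (G x).
  have gE : G x = g%:E by rewrite fineK.
  have g0 : 0 <= g by rewrite -lee_fin -gE.
  have hj j : normc (S j.+1 x - S j x) <= Num.sqrt g * 2^-1 ^+ j.
    have h : 4 ^+ j * normc (S j.+1 x - S j x) ^+ 2 <= g.
      rewrite -lee_fin -gE; apply: le_trans (nneseries_lim_ge j.+1 _) => //.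
      rewrite big_nat_recr //=; apply: leeDr; exact: sume_ge0.
    have s0 : 0 <= 2^-1 ^+ j :> R by rewrite exprn_ge0 // invr_ge0.
    rewrite -(@ler_sqr R) ?nnegrE ?mulr_ge0 ?sqrtr_ge0 ?normc_ge0 //.
    rewrite exprMn sqr_sqrtr // exprAC (_ : 2^-1 ^+ 2 = 4^-1 :> R); last by field.
    by rewrite exprVn ler_pdivlMr ?exprn_gt0 // mulrC.
  have cRe : cvgn (fun j => complex.Re (S j x)).
    apply: (@fast_cauchy_cvg _ (Num.sqrt g)) => j; apply: le_trans (hj j).
    by rewrite -ReN -ReD; exact: Re_le_normc.
  have cIm : cvgn (fun j => complex.Im (S j x)).
    apply: (@fast_cauchy_cvg _ (Num.sqrt g)) => j; apply: le_trans (hj j).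
    by rewrite -ImN -ImD; exact: Im_le_normc.
  exists (Complex (limn (fun j => complex.Re (S j x))) (limn (fun j => complex.Im (S j x)))).
  by apply/ccvgP.
(* Cutting by the indicator of A makes the sequence converge at every point, so the limit is
   measurable; almost everywhere nothing changes. *)
pose chi x : C := ((\1_A x : R)%:C)%C.
have mchi : cmeas chi by split => //=; exact: measurable_indic.
pose S' j x := chi x * S j x.
have mS' j : cmeas (S' j) by exact: cmeasM.
have /choice[phi hphi] : forall x, exists l, ccvg (S'^~ x) l.
  move=> x; have [Ax|Ax] := pselect (A x).
    by have [l hl] := cvS x Ax; exists (chi x * l); exact: ccvgZ.
  exists 0; rewrite (_ : S'^~ x = fun=> 0); first exact: ccvg_cst.
  by apply/funext => j; rewrite /S' /chi indicE memNset // mul0r.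
have mphi : cmeas phi by apply: (cmeas_cvg mS').
exists phi; split => // j.
have m2 (F H : X -> C) : cmeas F -> cmeas H ->
    measurable_fun setT (fun x => (normc (F x - H x) ^+ 2)%:E).
  by move=> mF mH; apply/measurable_EFinP/measurable_normc2; exact: cmeasB.
have ge0 (F H : X -> C) x : (0 <= (normc (F x - H x) ^+ 2)%:E)%E.
  by rewrite lee_fin sqr_ge0.
have intS' i : (\int[mu]_x (normc (S' i x - S j x) ^+ 2)%:E =
    \int[mu]_x (normc (S i x - S j x) ^+ 2)%:E)%E.
  apply: ge0_ae_eq_integral => //; [exact: m2|exact: m2|].
  apply: filterS aeA => x Ax _.
  by rewrite /S' /chi indicE mem_set // mul1r.
have := @fatou _ _ _ mu setT measurableT (fun i x => (normc (S' i x - S j x) ^+ 2)%:E)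
  (fun i => m2 _ _ (mS' i) (mS j)) (fun i x _ => ge0 _ _ x).
have -> : (\int[mu]_x limn_einf (fun i => (normc (S' i x - S j x) ^+ 2)%:E) =
    \int[mu]_x (normc (phi x - S j x) ^+ 2)%:E)%E.
  apply: eq_integral => x _; apply: (cvg_limn_einf_sup _).1.
  apply: cvg_EFin; first exact: nearW.
  exact: cvg_normc2_sub.
move=> /le_trans; apply; apply: (@limn_einf_le _ _ j) => i ji.
by rewrite intS'; exact: cauchyS.
Qed.

End riesz_fischer.

Section square_integral.
Context (dd : measure_display) (X : measurableType dd) (R : realType).
Variable mu : {measure set X -> \bar R}.
Local Notation C := R[i].
Local Notation normc := (@Normc.normc R).
Implicit Types f g : X -> C.

Definition sqint f : \bar R := (\int[mu]_x (normc (f x) ^+ 2)%:E)%E.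

Lemma sqint_ge0 f : (0 <= sqint f)%E.
Proof. by apply: integral_ge0 => x _; rewrite lee_fin sqr_ge0. Qed.

Lemma sqint_meas f : cmeas f -> measurable_fun setT (fun x => (normc (f x) ^+ 2)%:E).
Proof. by move=> mf; apply/measurable_EFinP/measurable_normc2. Qed.

Lemma sqint_le (f g h : X -> C) (p q : R) : cmeas f -> cmeas g -> cmeas h ->
  0 <= p -> 0 <= q ->
  (forall x, normc (f x) ^+ 2 <= p * normc (g x) ^+ 2 + q * normc (h x) ^+ 2) ->
  (sqint f <= p%:E * sqint g + q%:E * sqint h)%E.
Proof.
move=> mf mg mh p0 q0 fgh; have mf2 := sqint_meas mf; have mg2 := sqint_meas mg.
have mh2 := sqint_meas mh.
have g0 x : setT x -> (0 <= (normc (g x) ^+ 2)%:E)%E by rewrite lee_fin sqr_ge0.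
have h0 x : setT x -> (0 <= (normc (h x) ^+ 2)%:E)%E by rewrite lee_fin sqr_ge0.
have p0' : (0%R <= p%:E :> \bar R)%E by rewrite lee_fin.
have q0' : (0%R <= q%:E :> \bar R)%E by rewrite lee_fin.
rewrite /sqint -(ge0_integralZl mu measurableT mg2 g0 p0').
rewrite -(ge0_integralZl mu measurableT mh2 h0 q0').
rewrite -ge0_integralD //; last 4 first.
- by move=> x _; apply: mule_ge0 => //; exact: g0.
- exact: measurable_funeM.
- by move=> x _; apply: mule_ge0 => //; exact: h0.
- exact: measurable_funeM.
apply: ge0_le_integral => //.
- by move=> x _; rewrite lee_fin sqr_ge0.
- by apply: emeasurable_funD; exact: measurable_funeM.
- by move=> x _; rewrite -!EFinM -EFinD lee_fin.
Qed.

Lemma sqintD_le f g : cmeas f -> cmeas g ->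
  (sqint (fun x => (f x + g x)%R) <= 2%:E * sqint f + 2%:E * sqint g)%E.
Proof.
move=> mf mg; apply: sqint_le => //; first exact: cmeasD.
by move=> x; exact: normcD2.
Qed.

Lemma sqint_hasint f v : hasint mu (fun x => normc (f x) ^+ 2) v -> sqint f = v%:E.
Proof. by case. Qed.

Lemma hasint_sqint f : cmeas f -> (sqint f < +oo)%E ->
  hasint mu (fun x => normc (f x) ^+ 2) (fine (sqint f)).
Proof.
move=> mf foo; split; last by rewrite fineK // ge0_fin_numE // sqint_ge0.
apply/integrableP; split; first exact: sqint_meas.
by under eq_integral do rewrite gee0_abs ?lee_fin ?sqr_ge0 //.
Qed.

(** Young's inequality: the right side minus the left is e^-1 |e w + (w - z)|^2. Unlike in
    [normcD2], the leading factor 1 + e can approach 1, as a limit of norms requires. *)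
Lemma normc2_perturb (z w : C) (e : R) : 0 < e ->
  normc z ^+ 2 <= (1 + e) * normc w ^+ 2 + (1 + e^-1) * normc (w - z) ^+ 2.
Proof.
move=> e0; rewrite !normc2E; case: z w => [a b] [c f] /=; rewrite -subr_ge0.
have -> : (1 + e) * (c ^+ 2 + f ^+ 2) + (1 + e^-1) * ((c - a) ^+ 2 + (f - b) ^+ 2) -
  (a ^+ 2 + b ^+ 2) = e^-1 * ((e * c + (c - a)) ^+ 2 + (e * f + (f - b)) ^+ 2).
  by field; rewrite gt_eqF.
by rewrite mulr_ge0 ?addr_ge0 ?sqr_ge0 // invr_ge0 ltW.
Qed.

(** Norms pass to L2 limits. Square integrability of g is part of the conclusion, hence the work
    with extended integrals. *)
Lemma sqint_cvg (f : nat -> X -> C) (g : X -> C) (s : nat -> R) (S : R) :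
  (forall j, cmeas (f j)) -> cmeas g ->
  (forall j, hasint mu (fun x => normc (f j x) ^+ 2) (s j)) ->
  s @ \oo --> S ->
  (fun j => sqint (fun x => f j x - g x)) @ \oo --> 0%:E ->
  hasint mu (fun x => normc (g x) ^+ 2) S.
Proof.
move=> mf mg hs sS e0.
have he (e : R) : 0 < e ->
    exists N, forall j, (N <= j)%N -> (sqint (fun x => (f j x - g x)%R) <= e%:E)%E.
  move=> ep; have /fine_cvgP[[N1 _ h1] /cvgr0Pnorm_le/(_ e ep)[N2 _ h2]] := e0.
  exists (maxn N1 N2) => j; rewrite geq_max => /andP[j1 j2].
  rewrite -(fineK (h1 _ j1)) lee_fin; apply: le_trans (ler_norm _) (h2 _ j2).
have mfg j : cmeas (fun x => f j x - g x) by exact: cmeasB.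
have s_ge0 j : 0 <= s j by rewrite -lee_fin -(sqint_hasint (hs j)) sqint_ge0.
have gle (e : R) j : 0 < e -> (sqint g <=
    (1 + e)%:E * (s j)%:E + (1 + e^-1)%:E * sqint (fun x => (f j x - g x)%R))%E.
  move=> ep; rewrite -(sqint_hasint (hs j)).
  apply: sqint_le => //; rewrite ?addr_ge0 ?invr_ge0 ?(ltW ep) //.
  by move=> x; exact: normc2_perturb.
have fle (e : R) j : 0 < e -> ((s j)%:E <=
    (1 + e)%:E * sqint g + (1 + e^-1)%:E * sqint (fun x => (f j x - g x)%R))%E.
  move=> ep; rewrite -(sqint_hasint (hs j)).
  apply: sqint_le => //; rewrite ?addr_ge0 ?invr_ge0 ?(ltW ep) //.
  by move=> x; rewrite normcBC; exact: normc2_perturb.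
(* Weight e = 1 and one index N with a finite error suffice for finiteness. *)
have goo : (sqint g < +oo)%E.
  have [N hN] := he 1 ltr01; apply: le_lt_trans (gle 1 N ltr01) _.
  have h1 : ((1 + 1^-1)%:E * sqint (fun x => f N x - g x)%R <= (1 + 1^-1)%:E * 1%:E :> \bar R)%E.
    by apply: lee_wpmul2l; [rewrite lee_fin addr_ge0 ?invr_ge0|exact: hN].
  apply: le_lt_trans (leeD2l _ h1) _.
  by rewrite -!EFinM -EFinD ltry.
have hg := hasint_sqint mg goo; set v := fine (sqint g) in hg *.
have vE := sqint_hasint hg.
have v0 : 0 <= v by rewrite -lee_fin -vE sqint_ge0.
suff sv : s @ \oo --> v by rewrite (cvg_unique _ sS sv).
have S0 : 0 <= S.
  by rewrite -(cvg_lim _ sS) //; apply: limr_ge; [apply/cvg_ex; exists S|exact: nearW].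
apply/subr_cvg0; apply/norm_cvg0P.
apply/nonneg_cvg0P => [n|e ep]; first exact: normr_ge0.
(* With weight d and error at most d^2, both |v - s_j| bounds are at most d max(v, S + 1) + d^2 + d,
   hence at most d K when d <= 1. *)
pose K := v + S + 3; have Kp : 0 < K by rewrite /K; lra.
pose d := Num.min 1 (e / K).
have dp : 0 < d by rewrite lt_min ltr01 divr_gt0.
have d1 : d <= 1 by rewrite ge_min lexx.
have dK : d * K <= e by rewrite -ler_pdivlMr // ge_min lexx orbT.
have [N1 h1] := he (d ^+ 2) (exprn_gt0 _ dp).
have [N2 _ h2] : \forall j \near \oo, s j <= S + 1.
  by apply: (cvgr_le _ sS); rewrite ltrDl.
exists (maxn N1 N2) => j; rewrite geq_max => /andP[j1 j2].
have {}h1 := h1 j j1; have {}h2 : s j <= S + 1 := h2 j j2.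
have q0 : (0 <= (1 + d^-1)%:E :> \bar R)%E by rewrite lee_fin addr_ge0 // invr_ge0 ltW.
have A1 : v <= (1 + d) * s j + (1 + d^-1) * d ^+ 2.
  rewrite -lee_fin -vE; apply: le_trans (gle d j dp) _.
  rewrite [leRHS](_ : _ = (1 + d)%:E * (s j)%:E + (1 + d^-1)%:E * (d ^+ 2)%:E)%E //.
  by apply: leeD2l; exact: lee_wpmul2l.
have A2 : s j <= (1 + d) * v + (1 + d^-1) * d ^+ 2.
  rewrite -lee_fin; apply: le_trans (fle d j dp) _.
  rewrite vE [leRHS](_ : _ = (1 + d)%:E * v%:E + (1 + d^-1)%:E * (d ^+ 2)%:E)%E //.
  by apply: leeD2l; exact: lee_wpmul2l.
have dE : (1 + d^-1) * d ^+ 2 = d ^+ 2 + d by field; rewrite gt_eqF.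
rewrite dE in A1 A2; have sj0 := s_ge0 j.
have d2 : d ^+ 2 <= d by rewrite expr2 ler_piMl // ltW.
have B1 : d * s j <= d * (S + 1) by rewrite ler_pM2l.
have B2 : 0 <= d * v by rewrite mulr_ge0 // ltW.
have B3 : 0 <= d * S by rewrite mulr_ge0 // ltW.
have dKE : d * K = d * v + d * S + 3 * d by rewrite /K; ring.
have B1' : d * (S + 1) = d * S + d by ring.
rewrite ler_norml; apply/andP; split; lra.
Qed.

End square_integral.

(** * Hardy functions, their coefficients and boundary values *)

Section hardy_coefficients.
Variables (R : realType) (d : nat).
Local Notation M := (multinom d).
Local Notation C := R[i].
Local Notation T := (measurableTypeR R).
Local Notation normc := (@Normc.normc R).
Local Notation mu := (angle_measure R d).
Local Notation pid := ((2 * pi : R) ^+ d).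
Implicit Types (a b : M -> C) (F G : ('I_d -> C) -> C) (phi psi : d.-tuple T -> C).

(** The dictionary between H^2 and l2. Equality is imposed on the polydisk alone, the only place
    where the values of F matter. *)
Definition represents F a := l2 a /\ forall z, polydisk z -> F z = ev a z.

Lemma dilate_le a (r : R) k : 0 <= r <= 1 -> normc (dilate a r k) <= normc (a k).
Proof.
move=> /andP[r0 r1]; rewrite Normc.normcM normc_real ler_piMr ?normc_ge0 //.
by rewrite ger0_norm ?exprn_ge0 // exprn_ile1.
Qed.

Lemma l2_dilate a (r : R) : 0 <= r < 1 -> l2 a -> l2 (dilate a r).
Proof.
by move=> /andP[r0 r1]; apply: l2_le => k; apply: dilate_le; rewrite r0 ltW.
Qed.

Lemma csmb_dilate_l2 a (r : R) : 0 <= r < 1 -> l2 a -> csmb (dilate a r).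
Proof.
move=> r01 sa; apply: (@csmb_dilate _ _ _ _ [tuple of nseq d 0]).
by apply: csmb_l2_eva => //; exact: torus_polydisk.
Qed.

Lemma represents_torus F a (r : R) (t : d.-tuple T) : represents F a -> 0 <= r < 1 ->
  F (torus_point r t) = bsum (dilate a r) t.
Proof. by move=> [sa Fa] r01; rewrite Fa ?bsum_dilate //; exact: torus_polydisk. Qed.

(** Below degree N the factor 1 - r^|k| is at most 1 - r^N; above, it is at most 1 and the tail of a
    is small. *)
Lemma dilate_diff_le a (r : R) N : l2 a -> 0 <= r < 1 ->
  nrm (fun k => dilate a r k - a k) <=
    (1 - r ^+ N) ^+ 2 * nrm a + nrm (fun k => a k - trunc N a k).
Proof.
move=> sa r01; have /andP[r0 r1] := r01.
have st : l2 (fun k => a k - trunc N a k) by apply: l2B => //; exact: l2_trunc.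
have sd : l2 (fun k => dilate a r k - a k) by apply: l2B => //; exact: l2_dilate.
rewrite /nrm -totZ // -totD //; last exact: smbZ.
apply: le_tot => // [|k]; first by apply: smbD => //; exact: smbZ.
have -> : dilate a r k - a k = a k * ((r ^+ mdeg k - 1)%:C)%C.
  by rewrite rmorphB rmorph1 mulrBr mulr1.
rewrite Normc.normcM normc_real exprMn mulrC real_normK ?num_real //.
have rk1 n : 0 <= r ^+ n <= 1 by rewrite exprn_ge0 //= exprn_ile1 // ltW.
rewrite /trunc; case: ltnP => kN.
  rewrite subrr Normc.normc0 expr0n addr0; apply: ler_wpM2r; first exact: sqr_ge0.
  have h : r ^+ N <= r ^+ mdeg k by apply: ler_wiXn2l => //; [exact: ltW|exact: ltnW].
  rewrite -[leLHS]sqrrN opprB lerXn2r ?nnegrE ?subr_ge0 ?lerB //.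
  - by case/andP : (rk1 (mdeg k)).
  - by case/andP : (rk1 N).
rewrite subr0 -[leLHS]add0r; apply: lerD; first by rewrite mulr_ge0 ?sqr_ge0.
rewrite ler_piMl ?sqr_ge0 // -sqrrN opprB exprn_ile1 ?subr_ge0 //.
  by case/andP : (rk1 (mdeg k)).
by rewrite gerBl; case/andP : (rk1 (mdeg k)).
Qed.

Lemma eventually_radius (r : nat -> R) : (forall n, r n < 1) -> r @ \oo --> (1 : R) ->
  \forall n \near \oo, 0 <= r n < 1.
Proof.
move=> r1 cr; have h : \forall n \near \oo, 0 < r n by apply: (cvgr_gt _ cr).
by apply: filterS h => n /ltW rn; rewrite rn r1.
Qed.

Lemma dilate_diff_cvg0 a (r : nat -> R) : l2 a -> (forall n, r n < 1) ->
  r @ \oo --> (1 : R) -> (fun n => nrm (fun k => dilate a (r n) k - a k)) @ \oo --> (0 : R).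
Proof.
move=> sa r1 cr; apply/nonneg_cvg0P => [n|e e0]; first exact: nrm_ge0.
have [N hN] := (nonneg_cvg0P (fun n => nrm_ge0 _)).1 (nrm_tail_cvg sa) (e / 2)
  (divr_gt0 e0 (ltr0n _ 2)).
have {}hN := hN N (leqnn N).
have cX n : (fun j => r j ^+ n) @ \oo --> (1 : R).
  rewrite -(expr1n R n); elim: n => [|n IH].
    by under eq_fun do rewrite expr0; exact: cvg_cst.
  by rewrite exprS; under eq_fun do rewrite exprS; apply: cvgM.
have h0 : (fun j => (1 - r j ^+ N) ^+ 2 * nrm a) @ \oo --> (0 : R).
  have h1 : (fun j => 1 - r j ^+ N) @ \oo --> (0 : R).
    by rewrite -(subrr 1); apply: cvgB; [exact: cvg_cst|exact: cX].
  by rewrite -(mul0r (nrm a)); apply: cvgMl; rewrite -(mulr0 0); apply: cvgM.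
have q0 j : 0 <= (1 - r j ^+ N) ^+ 2 * nrm a by rewrite mulr_ge0 ?sqr_ge0 ?nrm_ge0.
have [N1 hN1] := (nonneg_cvg0P q0).1 h0 (e / 2) (divr_gt0 e0 (ltr0n _ 2)).
have [N2 _ hN2] := eventually_radius r1 cr.
exists (maxn N1 N2) => n; rewrite geq_max => /andP[n1 n2].
apply: le_trans (dilate_diff_le N sa (hN2 n n2)) _.
by have := hN1 n n1; lra.
Qed.

Lemma sqint_bsum a : csmb a -> sqint mu (bsum a) = (pid * nrm a)%:E.
Proof. by move=> sa; case: (parseval sa). Qed.

Lemma bsumB a b (t : d.-tuple T) : csmb a -> csmb b ->
  bsum a t - bsum b t = bsum (fun k => a k - b k) t.
Proof. by move=> sa sb; symmetry; apply: evB; exact: csmb_char. Qed.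

Lemma csmb_trunc N a : csmb (trunc N a).
Proof. by case: (@fin_supp_ctot _ _ (trunc N a) N (@trunc_high _ _ N a)). Qed.

(** [boundary_value] is an [xget] with default 0, meaningful only once a boundary function exists.
    The limit of fast truncations, from [riesz_fischer], is compared with the dilations of a. *)
Lemma exists_boundary_function F a : represents F a ->
  exists phi, is_boundary_value F phi.
Proof.
move=> Fa; have [sa _] := Fa.
have /choice[N hN] : forall j, exists N,
    nrm (fun k => a k - trunc N a k) <= (16^-1 : R) ^+ j.
  move=> j; have e0 : 0 < (16^-1 : R) ^+ j by rewrite exprn_gt0 // invr_gt0.
  have [N hN] := (nonneg_cvg0P (fun n => nrm_ge0 _)).1 (nrm_tail_cvg sa) _ e0.
  by exists N; exact: hN.
pose S j := @bsum R d (trunc (N j) a).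
have mS j : cmeas (S j) by apply: cmeas_bsum; exact: csmb_trunc.
have pid0 : 0 <= pid by apply: ltW; exact: pi2d_gt0.
have st j : l2 (fun k => a k - trunc (N j) a k) by apply: l2B => //; exact: l2_trunc.
(* Both tails are at most 16^-j in squared norm, so the gap is at most 2 (16^-j + 16^-i) <= 4 16^-j;
   hence the 4 in K. *)
have [|i j ij|phi [mphi hphi]] := @riesz_fischer _ _ _ mu S (pid * 4) _ mS.
- by rewrite mulr_ge0.
- rewrite (_ : (\int[mu]_x _)%E = sqint mu (bsum (fun k => trunc (N i) a k - trunc (N j) a k))).
    rewrite sqint_bsum; last by apply: csmbB; exact: csmb_trunc.
    rewrite lee_fin -mulrA ler_wpM2l //.
    rewrite (_ : nrm _ = nrm (fun k => (a k - trunc (N j) a k) - (a k - trunc (N i) a k))).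
      rewrite nrmB //; have := nrm_ge0 (fun k => (a k - trunc (N j) a k) + (a k - trunc (N i) a k)).
      rewrite nrmD //.
      have h : (16^-1 : R) ^+ i <= 16^-1 ^+ j.
        by apply: ler_wiXn2l => //; rewrite ?invr_ge0 // invf_le1 // ler1n.
      have := hN i; have := hN j; lra.
    by apply: eq_nrm => k; ring.
  by apply: eq_integral => t _; rewrite bsumB //; exact: csmb_trunc.
exists phi; split; [by case: mphi|by case: mphi|].
apply/cvge_at_leftP => r [r1 cr].
have sd n : 0 <= r n < 1 -> csmb (dilate a (r n)) by move=> h; exact: csmb_dilate_l2.
(* Two uses of |u + v|^2 <= 2|u|^2 + 2|v|^2: dilation to truncation contributes 4 A + 4 16^-n,
   truncation to phi contributes 2 4 16^-n, all times (2 pi)^d. *)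
pose v n : R := 4 * pid * nrm (fun k => dilate a (r n) k - a k) +
  12 * pid * 16^-1 ^+ n.
have v0 : v @ \oo --> (0 : R).
  rewrite -[X in _ --> X](addr0 0); apply: cvgD.
    by rewrite -(mulr0 (4 * pid)); apply: cvgMr; exact: dilate_diff_cvg0.
  rewrite -(mulr0 (12 * pid)); apply: cvgMr; apply: cvg_expr.
  by rewrite ger0_norm ?invr_ge0 // invf_lt1 // ltr1n.
have v0' : (fun n => (v n)%:E) @ \oo --> 0%:E by apply: cvg_EFin => //; exact: nearW.
apply: squeeze_cvge (cvg_cst 0%E) v0'.
have := eventually_radius r1 cr; apply: filterS => n rn.
apply/andP; split; first exact: (sqint_ge0 mu (fun t => F (torus_point (r n) t) - phi t)).
have E1 : (\int[mu]_t (normc (F (torus_point (r n) t) - phi t) ^+ 2)%:E)%E =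
    sqint mu (fun t => bsum (fun k => dilate a (r n) k - trunc (N n) a k) t +
      (- (phi t - S n t))).
  apply: eq_integral => t _; rewrite (represents_torus t Fa rn).
  rewrite -bsumB; [|exact: sd|exact: csmb_trunc].
  by congr (normc _ ^+ 2)%:E; rewrite /S; ring.
rewrite E1.
have sdt : csmb (fun k => dilate a (r n) k - trunc (N n) a k).
  by apply: csmbB; [exact: sd|exact: csmb_trunc].
have mps : cmeas (fun t => phi t - S n t) by exact: cmeasB.
have mneg : cmeas (fun t => - (phi t - S n t)).
  rewrite (_ : (fun t => _) = (fun t => (-1) * (phi t - S n t))).
    by apply: cmeasM => //; exact: cmeas_cst.
  by apply/funext => t; rewrite mulN1r.
apply: le_trans (sqintD_le mu (cmeas_bsum sdt) mneg) _.
rewrite sqint_bsum //.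
have E2 : sqint mu (fun t => - (phi t - S n t)) = sqint mu (fun t => phi t - S n t).
  by apply: eq_integral => t _; rewrite normcNc.
rewrite E2; apply: (@le_trans _ _ (2%:E * (pid * nrm (fun k => dilate a (r n) k - trunc (N n) a k))%:E +
   2%:E * (pid * 4 * 16^-1 ^+ n)%:E)%E).
  by apply: leeD2l; apply: lee_wpmul2l => //; exact: hphi.
rewrite -!EFinM -EFinD lee_fin /v.
have h1 : nrm (fun k => dilate a (r n) k - trunc (N n) a k) <=
    2 * nrm (fun k => dilate a (r n) k - a k) + 2 * nrm (fun k => a k - trunc (N n) a k).
  rewrite (_ : nrm (fun k => _ - trunc (N n) a k) =
     nrm (fun k => (dilate a (r n) k - a k) + (a k - trunc (N n) a k))).
    apply: nrmD_le => //; apply: l2B => //; exact: l2_dilate.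
  by apply: eq_nrm => k; ring.
have h2 : pid * nrm (fun k => dilate a (r n) k - trunc (N n) a k) <=
    pid * (2 * nrm (fun k => dilate a (r n) k - a k) + 2 * 16^-1 ^+ n).
  apply: ler_wpM2l => //; apply: le_trans h1 _; rewrite lerD2l ler_pM2l //.
move: h2; set p : R := pid; set q : R := 16^-1 ^+ n.
set A : R := nrm (fun k => dilate a (r n) k - a k).
set Z : R := nrm _ => h2.
have -> : 2 * (p * Z) + 2 * (p * 4 * q) = 2 * (p * Z) + 8 * (p * q) by ring.
have -> : 4 * p * A + 12 * p * q = 2 * (p * (2 * A + 2 * q)) + 8 * (p * q) by ring.
by rewrite lerD2r ler_pM2l.
Qed.

Lemma boundary_valueP F a : represents F a -> is_boundary_value F (boundary_value F).
Proof. by move=> /exists_boundary_function; exact: xgetPex. Qed.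

Lemma cmeas_boundary F phi : is_boundary_value F phi -> cmeas phi.
Proof. by case. Qed.

Lemma cmeas_torus F a (r : R) : represents F a -> 0 <= r < 1 ->
  cmeas (fun t => F (torus_point r t)).
Proof.
move=> Fa r01; rewrite (_ : (fun t => _) = bsum (dilate a r)).
  by apply: cmeas_bsum; apply: csmb_dilate_l2 => //; case: Fa.
by apply/funext => t; exact: represents_torus Fa r01.
Qed.

(** Any boundary value is allowed, so that the lemma applies to phi + psi and c phi, which need not
    be the functions selected by [boundary_value]. The dilations have known norms, and [sqint_cvg]
    takes the limit. *)
Lemma hasint_boundary F a phi : represents F a -> is_boundary_value F phi ->
  hasint mu (fun t => normc (phi t) ^+ 2) (pid * nrm a).
Proof.
move=> Fa bv; have [sa _] := Fa; have [_ _ /cvge_at_leftP h] := bv.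
have rr j := @radseq01 R j.
have {}h := h (@radseq R) (conj (fun j => (andP (rr j)).2) (@radseq_cvg R)).
apply: (@sqint_cvg _ _ _ mu (fun j t => F (torus_point (radseq R j) t)) phi
  (fun j => pid * nrm (dilate a (radseq R j)))) => //.
- by move=> j; exact: cmeas_torus Fa (rr j).
- exact: cmeas_boundary bv.
- move=> j; apply: hasint_ext (parseval (csmb_dilate_l2 (rr j) sa)) => // t.
  by rewrite (represents_torus t Fa (rr j)).
- apply: cvgMr; apply: nrm_cvg => //; first by move=> j; exact: l2_dilate.
  apply: dilate_diff_cvg0 => //; [by move=> n; case/andP : (rr n)|exact: radseq_cvg].
Qed.

Lemma representsD F G a b : represents F a -> represents G b ->
  represents (fun z => F z + G z) (fun k => a k + b k).
Proof.
move=> [sa Fa] [sb Gb]; split=> [|z zD]; first exact: l2D.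
by rewrite Fa // Gb // evD //; exact: csmb_l2_eva.
Qed.

Lemma representsZ (c : C) F a : represents F a ->
  represents (fun z => c * F z) (fun k => c * a k).
Proof.
move=> [sa Fa]; split=> [|z zD]; first exact: l2Z.
by rewrite Fa // evZ //; exact: csmb_l2_eva.
Qed.

Lemma representsB F G a b : represents F a -> represents G b ->
  represents (fun z => F z - G z) (fun k => a k - b k).
Proof.
move=> [sa Fa] [sb Gb]; split=> [|z zD]; first exact: l2B.
by rewrite Fa // Gb // evB //; exact: csmb_l2_eva.
Qed.

Lemma boundaryD F G a b phi psi : represents F a -> represents G b ->
  is_boundary_value F phi -> is_boundary_value G psi ->
  is_boundary_value (fun z => F z + G z) (fun t => phi t + psi t).
Proof.
move=> Fa Gb bF bG; have mF := cmeas_boundary bF; have mG := cmeas_boundary bG.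
have [mr mi] := cmeasD mF mG; split => //.
have [_ _ /cvge_at_leftP hF] := bF; have [_ _ /cvge_at_leftP hG] := bG.
apply/cvge_at_leftP => r rr; have {}hF := hF r rr; have {}hG := hG r rr.
have h : (fun n => 2%:E * sqint mu (fun t => (F (torus_point (r n) t) - phi t)%R) +
    2%:E * sqint mu (fun t => (G (torus_point (r n) t) - psi t)%R))%E @ \oo --> (0%:E : \bar R).
  rewrite (_ : 0%:E = (2%:E * 0 + 2%:E * 0)%E); last by rewrite !mule0 adde0.
  by apply: cvgeD; [by rewrite !mule0|exact: cvgeZl|exact: cvgeZl].
apply: squeeze_cvge (cvg_cst 0%E) h.
have [r1 cr] := rr; have := eventually_radius r1 cr; apply: filterS => n rn.
apply/andP; split.
  exact: (sqint_ge0 mu (fun t => F (torus_point (r n) t) + G (torus_point (r n) t) - (phi t + psi t))).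
have mFr : cmeas (fun t => F (torus_point (r n) t) - phi t).
  by apply: cmeasB => //; exact: cmeas_torus Fa rn.
have mGr : cmeas (fun t => G (torus_point (r n) t) - psi t).
  by apply: cmeasB => //; exact: cmeas_torus Gb rn.
apply: le_trans (sqintD_le mu mFr mGr); rewrite le_eqVlt; apply/orP; left; apply/eqP.
by apply: eq_integral => t _; congr (normc _ ^+ 2)%:E; ring.
Qed.

Lemma boundaryZ (c : C) F a phi : represents F a -> is_boundary_value F phi ->
  is_boundary_value (fun z => c * F z) (fun t => c * phi t).
Proof.
move=> Fa bF; have mF := cmeas_boundary bF.
have [mr mi] := cmeasM (cmeas_cst _ c) mF; split => //.
have [_ _ /cvge_at_leftP hF] := bF.
apply/cvge_at_leftP => r rr; have {}hF := hF r rr.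
(* The summand with factor 0 only fits the two-term form of [sqint_le]. *)
have h : (fun n => (normc c ^+ 2)%:E * sqint mu (fun t => (F (torus_point (r n) t) - phi t)%R) +
    0%:E * sqint mu (fun t => (F (torus_point (r n) t) - phi t)%R))%E @ \oo --> (0%:E : \bar R).
  rewrite [X in _ --> X](_ : _ = ((normc c ^+ 2)%:E * 0 + 0%:E * 0)%E); last by rewrite !mule0 adde0.
  by apply: cvgeD; [by rewrite !mule0|exact: cvgeZl|exact: cvgeZl].
apply: squeeze_cvge (cvg_cst 0%E) h.
have [r1 cr] := rr; have := eventually_radius r1 cr; apply: filterS => n rn.
apply/andP; split.
  exact: (sqint_ge0 mu (fun t => c * F (torus_point (r n) t) - c * phi t)).
have mFr : cmeas (fun t => F (torus_point (r n) t) - phi t).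
  by apply: cmeasB => //; exact: cmeas_torus Fa rn.
have mcF : cmeas (fun t => c * F (torus_point (r n) t) - c * phi t).
  apply: cmeasB; apply: cmeasM => //; try exact: cmeas_cst.
  exact: cmeas_torus Fa rn.
apply: sqint_le => // [|t]; first exact: sqr_ge0.
by rewrite mul0r addr0 -mulrBr Normc.normcM exprMn.
Qed.

(** Polarization: 2 Re (phi conj(psi)) = |phi + psi|^2 - |phi|^2 - |psi|^2, the same identity
    holding for [nrm] and [dot]. *)
Lemma Re_hasint_boundary F G a b phi psi : represents F a -> represents G b ->
  is_boundary_value F phi -> is_boundary_value G psi ->
  hasint mu (fun t => complex.Re (phi t * conjc (psi t))) (pid * complex.Re (dot a b)).
Proof.
move=> Fa Gb bF bG; have [sa _] := Fa; have [sb _] := Gb.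
have h1 := hasint_boundary Fa bF; have h2 := hasint_boundary Gb bG.
have h3 := hasint_boundary (representsD Fa Gb) (boundaryD Fa Gb bF bG).
have := hasintZ (2^-1) (hasintD h3 (hasintZ (-1) (hasintD h1 h2))).
apply: hasint_ext => [t|]; last by rewrite nrmD //; field.
by rewrite !normc2E; case: (phi t) (psi t) => [x y] [u v] /=; field.
Qed.

Lemma hardy_innerE F G a b : represents F a -> represents G b -> hardy_inner F G = dot a b.
Proof.
move=> Fa Gb; have [sa _] := Fa; have [sb _] := Gb.
have bF := boundary_valueP Fa; have bG := boundary_valueP Gb.
have hR := Re_hasint_boundary Fa Gb bF bG.
have hI : hasint mu (fun t => complex.Im (boundary_value F t * conjc (boundary_value G t)))
    (pid * complex.Im (dot a b)).
  have := Re_hasint_boundary Fa (representsZ (Complex 0 1) Gb) bF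
    (boundaryZ (Complex 0 1) Gb bG).
  apply: hasint_ext => [t|]; last by rewrite Im_dot.
  by case: (boundary_value F t) (boundary_value G t) => [x y] [u v] /=; ring.
rewrite /hardy_inner /angle_integral.
have -> : Rintegral mu setT (fun t => complex.Re (boundary_value F t * conjc (boundary_value G t))) =
    pid * complex.Re (dot a b) by rewrite /Rintegral hR.2.
have -> : Rintegral mu setT (fun t => complex.Im (boundary_value F t * conjc (boundary_value G t))) =
    pid * complex.Im (dot a b) by rewrite /Rintegral hI.2.
have p0 : pid != 0 by rewrite gt_eqF // pi2d_gt0.
apply: eq_ReIm; rewrite ?cReM ?cImM.
  by rewrite [complex.Im _%:C%C]/= [complex.Re _%:C%C]/= mul0r subr0 mulKf.
by rewrite [complex.Im _%:C%C]/= [complex.Re _%:C%C]/= mul0r addr0 mulKf.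
Qed.

Lemma nrm_coef_bound (x : nat -> M -> C) a B :
  (forall k, ccvg (x^~ k) (a k)) -> (forall j N, tsum N (fun k => normc (x j k) ^+ 2) <= B) ->
  l2 a /\ nrm a <= B.
Proof.
move=> xa xB; apply: nrm_fatou => N.
have h : (fun j => tsum N (fun k => normc (x j k) ^+ 2)) @ \oo -->
    tsum N (fun k => normc (a k) ^+ 2).
  rewrite /tsum; elim: (index_enum _) => [|k r IH].
    by rewrite big_nil; under eq_fun do rewrite big_nil; exact: cvg_cst.
  rewrite big_cons; under eq_fun do rewrite big_cons.
  by apply: cvgD => //; apply: cvgM; apply: normc_ccvg.
rewrite -(cvg_lim _ h) //; apply: limr_le; last exact: nearW.
by apply/cvg_ex; eexists; exact: h.
Qed.

(** At radius r_j the bounded means are (2 pi)^d times the squared norm of the dilated coefficients;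
    as r_j -> 1 these converge coefficientwise and the bound survives. *)
Lemma hardy2P F : hardy2 F <-> exists a, represents F a.
Proof.
split=> [[/holomorphicP[a ha] [B hB]]|[a [sa Fa]]].
  exists a; split=> [|z /ha[]//].
  have rr j := @radseq01 R j.
  have sd j : csmb (dilate a (radseq R j)).
    apply: (@csmb_dilate _ _ _ _ [tuple of nseq d 0]).
    by case: (ha _ (torus_polydisk [tuple of nseq d 0] (rr j))).
  apply: (proj1 (@nrm_coef_bound (fun j => dilate a (radseq R j)) a (pid^-1 * B) _ _)).
    by move=> k; exact: dilate_ccvg.
  move=> j N; apply: le_trans (tsum_le_nrm N (csmb_l2 (sd j))) _.
  rewrite mulrC ler_pdivlMr ?pi2d_gt0 // mulrC -lee_fin -(sqint_bsum (sd j)).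
  apply: le_trans (hB _ (rr j)); rewrite le_eqVlt; apply/orP; left; apply/eqP.
  apply: eq_integral => t _; case: (ha _ (torus_polydisk t (rr j))) => _ ->.
  by rewrite bsum_dilate.
split; first by apply/holomorphicP; exists a => z zD; split; [exact: csmb_l2_eva|exact: Fa].
exists (pid * nrm a) => r r01.
have sd : csmb (dilate a r) by exact: csmb_dilate_l2.
rewrite (_ : (\int[mu]_t _)%E = sqint mu (bsum (dilate a r))); last first.
  by apply: eq_integral => t _; rewrite (@represents_torus F a).
rewrite sqint_bsum // lee_fin ler_pM2l ?pi2d_gt0 //.
apply: le_tot => // [|k]; first exact: csmb_l2 sd.
rewrite lerXn2r ?nnegrE ?normc_ge0 //; apply: dilate_le.
by case/andP : r01 => -> /ltW ->.
Qed.

(* Parseval on the torus of radius r forces the coefficients to vanish. *)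
Lemma ev_inj a b : (forall z, polydisk z -> csmb (eva a z)) ->
  (forall z, polydisk z -> csmb (eva b z)) ->
  (forall z, polydisk z -> ev a z = ev b z) -> forall k, a k = b k.
Proof.
move=> sa sb ab k; pose t0 : d.-tuple T := [tuple of nseq d 0].
pose r : R := 2^-1; have r01 : 0 <= r < 1 by rewrite /r invr_ge0 ler0n /= invf_lt1 // ltr1n.
pose c j := a j - b j.
have sc z : polydisk z -> csmb (eva c z).
  move=> zD; apply: csmb_le (csmbB (sa z zD) (sb z zD)) => j.
  by rewrite /eva /c mulrBl.
have sd : csmb (dilate c r) by apply: (csmb_dilate (t := t0)); apply: sc; exact: torus_polydisk.
have n0 : nrm (dilate c r) = 0.
  have e : sqint mu (bsum (dilate c r)) = 0%E.
    rewrite /sqint; under eq_integral.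
      move=> t _; rewrite bsum_dilate (_ : ev c _ = 0); last first.
        have tD := torus_polydisk t r01.
        by rewrite /c evB ?ab ?subrr //; [exact: sa|exact: sb].
      rewrite Normc.normc0 expr0n.
      over.
    exact: integral0.
  rewrite sqint_bsum // in e; case: e => /eqP; rewrite mulf_eq0 gt_eqF ?pi2d_gt0 //=.
  by move/eqP.
have := nrm_eq0 (csmb_l2 sd) n0 k => /eqP; rewrite mulf_eq0 => /orP[|].
  by rewrite subr_eq0 => /eqP.
rewrite -normc_eq0 normc_real normr_eq0 expf_eq0 /r invr_eq0 pnatr_eq0 andbF //.
Qed.

End hardy_coefficients.

(** * The expansion *)

Section inner_multiplication.
Variables (R : realType) (d : nat).
Local Notation M := (multinom d).
Local Notation C := R[i].
Local Notation T := (measurableTypeR R).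
Local Notation normc := (@Normc.normc R).
Implicit Types (a h : M -> C) (F G : ('I_d -> C) -> C).

Lemma represents_ext F G a : represents F a -> (forall z, polydisk z -> G z = F z) ->
  represents G a.
Proof. by move=> [sa Fa] GF; split=> // z zD; rewrite GF // Fa. Qed.

Lemma represents_ev a : l2 a -> represents (ev a) a.
Proof. by move=> sa; split. Qed.

Lemma represents_eq F a b : represents F a -> (forall k, a k = b k) -> represents F b.
Proof. by move=> Fa /funext <-. Qed.

(** b is the image of the constant 1, so its squared norm is 1, which dominates |b_0|^2. *)
Lemma isometric_coef0_le1 (b : M -> C) : isometric b -> normc (b (@mnm0 d)) <= 1.
Proof.
move=> iso; have sb := l2_isometric_coef iso.
have s1 : l2 (fpoly (1 : mpoly d C)) by apply/csmb_l2/csmb_poly.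
have n1 : nrm (fpoly (1 : mpoly d C)) = 1.
  rewrite /nrm; case: (@fin_supp_tot _ _ (fun k => normc (fpoly (1 : mpoly d C) k) ^+ 2) 1).
    move=> k k1; rewrite /fpoly mcoeff1; case: eqP => [k0|_]; first by rewrite k0 mdeg0 in k1.
    by rewrite Normc.normc0 expr0n.
  move=> _ ->; have h0 : (mdeg (@mnm0 d) < 1)%N by rewrite mdeg0.
  rewrite /tsum (bigD1 (BMultinom h0)) //= big1 ?addr0.
    by rewrite /fpoly mcoeff1 eqxx Normc.normc1 expr1n.
  move=> k; rewrite -val_eqE /fpoly mcoeff1 /= => /negbTE ->.
  by rewrite Normc.normc0 expr0n.
have e : fmul b (fpoly 1) = b by apply/funext => k; rewrite fmulC fmul1.
have := nrm_iso iso s1; rewrite e n1 => nb.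
have h := le_term_tot (@mnm0 d) (fun k => sqr_ge0 (normc (b k))) sb.
rewrite -(@ler_sqr R) ?nnegrE ?normc_ge0 // expr1n -nb; exact: h.
Qed.

Variable P : mpoly d C.
Hypothesis P_class : poly_class P.

Let P_neq0 z : (@polydisk R d `|` @distinguished_boundary R d) z -> meval z P != 0.
Proof. by case: P_class => _ h _; exact: h. Qed.

Let b := inner_coef P.
Let B := inner_quotient P.

Lemma inner_isometric : isometric b.
Proof. by move=> h sh; split; [exact: l2_inner|exact: inner_isometry]. Qed.

Lemma represents_inner_mul F a : represents F a ->
  represents (fun z => B z * F z) (fmul b a).
Proof.
move=> [sa Fa]; have sba := l2_iso inner_isometric sa; split=> // z zD.
rewrite Fa // ev_inner //; exact: csmb_l2_eva.
Qed.

Let V := hardy_orth (hardy_mul B).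

Lemma hardy_orthP G a : represents G a ->
  V G <-> forall h, l2 h -> dot a (fmul b h) = 0.
Proof.
move=> Ga; split=> [[_ GV] h sh|ah].
  have rH := represents_inner_mul (represents_ev sh).
  rewrite -(hardy_innerE Ga rH); apply: GV.
  by exists (ev h) => //; apply/hardy2P; exists h; exact: represents_ev.
split; first by apply/hardy2P; exists a.
move=> H [H0 /hardy2P[h H0h] HE].
have rH := represents_ext (represents_inner_mul H0h) HE.
by rewrite (hardy_innerE Ga rH); apply: ah; case: H0h.
Qed.

(** [ev c] shows that a projection exists, so [xget] returns some projection. The difference of the
    two lies in V and is orthogonal to itself, so the coefficients agree. *)
Lemma represents_proj F a : represents F a ->
  represents (hardy_proj F V) (fun k => a k - fmul b (adj b a) k).
Proof.
move=> Fa; have [sa _] := Fa; have iso := inner_isometric.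
have sad := l2_adj iso sa; have sb := l2_iso iso sad.
pose c k := a k - fmul b (adj b a) k; have sc : l2 c by exact: l2B.
have orthc h : l2 h -> dot c (fmul b h) = 0 by move=> sh; exact: residual_orth.
have rG0 := represents_ev sc.
have G0V : V (ev c) by apply/(hardy_orthP rG0).
have orthV H : V H -> hardy_inner (fun z => F z - ev c z) H = 0.
  move=> HV; have [/hardy2P[h Hh] _] := HV; have [sh _] := Hh.
  have rD : represents (fun z => F z - ev c z) (fmul b (adj b a)).
    by apply: represents_eq (representsB Fa rG0) _ => k; rewrite /c subKr.
  rewrite (hardy_innerE rD Hh) (dotC sh sb).
  by rewrite ((hardy_orthP Hh).1 HV) // conjc0.
have [GV Gorth] : V (hardy_proj F V) /\
    forall H, V H -> hardy_inner (fun z => F z - hardy_proj F V z) H = 0.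
  rewrite /hardy_proj; apply: (@xgetPex _ (fun=> 0)
    [set G | V G /\ forall H, V H -> hardy_inner (fun z => F z - G z) H = 0]).
  by exists (ev c).
have [/hardy2P[g Gg] _] := GV; have [sg _] := Gg.
apply: (represents_eq Gg) => k; apply/eqP; rewrite -subr_eq0; apply/eqP.
move: k; have sgc : l2 (fun k => g k - c k) by exact: l2B.
apply: nrm_eq0 => //.
have rgc := representsB Gg rG0.
have DV : V (fun z => hardy_proj F V z - ev c z).
  apply/(hardy_orthP rgc) => h sh; have sbh := l2_iso iso sh.
  by rewrite (dotBl sg sc sbh) (orthc h sh) ((hardy_orthP Gg).1 GV h sh) subr0.
have h1 := orthV _ DV; have h2 := Gorth _ DV.
rewrite (hardy_innerE (representsB Fa rG0) rgc) in h1.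
rewrite (hardy_innerE (representsB Fa Gg) rgc) in h2.
have : dot (fun k => g k - c k) (fun k => g k - c k) = 0.
  have -> : dot (fun k => g k - c k) (fun k => g k - c k) =
      dot (fun k => (a k - c k) - (a k - g k)) (fun k => g k - c k).
    by apply: eq_dot => // k; ring.
  by rewrite dotBl ?h1 ?h2 ?subrr //; exact: l2B.
by rewrite dotaa => /(congr1 (@complex.Re R)).
Qed.

Lemma reflect_neq0 : reflect_poly P != 0.
Proof.
pose t0 : d.-tuple T := [tuple of nseq d 0].
apply/eqP => P0; have := meval_reflect P t0; rewrite P0 meval0 Normc.normc0 => /esym/eqP.
by rewrite normc_eq0 (negbTE (meval_torus_neq0 P_neq0 t0)).
Qed.

(** The selected quotient H is only known to be holomorphic. Multiplying B H = F by P gives P* h =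
    P* a between formal series, and P*, being nonzero, cancels. *)
Lemma represents_div F a : represents F (fmul b a) -> l2 a ->
  represents (holomorphic_div F B) a.
Proof.
move=> Fba sa; have [sba Fev] := Fba.
have rH0 := represents_ev sa.
have [holH HE] : holomorphic (holomorphic_div F B) /\
    forall z, polydisk z -> B z * holomorphic_div F B z = F z.
  rewrite /holomorphic_div; apply: (@xgetPex _ (fun=> 0)
    [set H | holomorphic H /\ forall z, polydisk z -> B z * H z = F z]).
  have [holo _] := (hardy2P _).2 (ex_intro _ a rH0).
  exists (ev a); split=> // z zD; rewrite Fev //.
  by have [_ ->] := represents_inner_mul rH0.
have [h hH] := (holomorphicP _).1 holH.
split=> // z zD; have [_ ->] := hH z zD; congr ev; apply/funext.
have e1 : forall k, fmul (fpoly (reflect_poly P)) h k = fmul (fpoly (reflect_poly P)) a k.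
  apply: ev_inj => w wD.
  - by apply: csmb_eva_fmul; case: (hH w wD).
  - by apply: csmb_eva_fmul; exact: csmb_l2_eva.
  have [sh Hw] := hH w wD; have Pw : meval w P != 0 by apply: P_neq0; left.
  rewrite ev_fmul // -Hw.
  have -> : ev (fmul (fpoly (reflect_poly P)) a) w = ev (fmul (fpoly P) (fmul b a)) w.
    by apply: ev_ext => k; rewrite fmul_inner_poly.
  rewrite ev_fmul; last exact: csmb_l2_eva.
  rewrite -Fev // -HE // /B /inner_quotient mulrA mulrCA divff // mulr1 //.
move=> k; apply/eqP; rewrite -subr_eq0; apply/eqP; move: k.
apply: (fmul_fpoly_inj reflect_neq0) => k.
by rewrite fmulBr e1 subrr.
Qed.

End inner_multiplication.

(** * Products of isometric multiplications and orthogonality of the terms *)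

Section expansion.
Variables (R : realType) (d : nat).
Local Notation M := (multinom d).
Local Notation C := R[i].
Local Notation normc := (@Normc.normc R).
Variable bs : nat -> M -> C.
Hypothesis iso : forall n, isometric (bs n).
Implicit Types (a h : M -> C).

(** The last index is innermost, opposite to [adjs], so that [muls k] stays outside and can be split
    off from [muls l] for k < l. *)
Fixpoint muls n h : M -> C := if n is m.+1 then muls m (fmul (bs m) h) else h.

Lemma dot_muls n a h : l2 a -> l2 h -> dot (muls n a) (muls n h) = dot a h.
Proof.
elim: n a h => //= n IH a h sa sh.
have sa' := l2_iso (iso n) sa; have sh' := l2_iso (iso n) sh.
by rewrite (IH _ _ sa' sh') (dot_iso (iso n)).
Qed.

(** Once the common isometry [muls k] is removed, orthogonality to any later term is orthogonality
    of the k-th residual to multiples of b_k. *)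
Lemma muls_factor k l h : (k < l)%N -> l2 h ->
  exists h', l2 h' /\ muls l h = muls k (fmul (bs k) h').
Proof.
elim: l h => // l IH h; rewrite ltnS leq_eqVlt => /orP[/eqP ->|kl] sh.
  by exists h.
exact: (IH (fmul (bs l) h) kl (l2_iso (iso l) sh)).
Qed.

Definition residual n a : M -> C :=
  fun k => adjs bs n a k - fmul (bs n) (adjs bs n.+1 a) k.

Lemma l2_residual n a : l2 a -> l2 (residual n a).
Proof.
move=> sa; apply: l2B; first exact: l2_adjs.
by apply: l2_iso => //; exact: l2_adjs.
Qed.

Lemma residual_muls_orth k l a h : (k < l)%N -> l2 a -> l2 h ->
  dot (muls k (residual k a)) (muls l h) = 0.
Proof.
move=> kl sa sh; have [h' [sh' ->]] := muls_factor kl sh.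
have sb := l2_iso (iso k) sh'; have sr := l2_residual k sa.
rewrite dot_muls //; apply: residual_orth => //; exact: l2_adjs.
Qed.

End expansion.

Lemma divergent_tail (R : realType) (u : nat -> R) m : (forall n, (1 <= n)%N -> 0 <= u n) ->
  (\sum_(1 <= n <oo) (u n)%:E = +oo)%E ->
  (\sum_(0 <= j <oo) (u (m + j).+1)%:E = +oo)%E.
Proof.
(* Index 0 is outside the sum and u is unconstrained there; 0 replaces it to have a series
   nonnegative everywhere. *)
move=> u0 uoo; pose f n : \bar R := if n is 0%N then 0%E else (u n)%:E.
have f0 n : (0 <= f n)%E by case: n => //= n; rewrite lee_fin u0.
have foo : (\sum_(1 <= n <oo) f n = +oo)%E.
  rewrite -uoo; congr (limn _); apply/funext => n.
  by apply: eq_big_nat => -[].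
rewrite (nneseries_split 1 m) // in foo.
have fin : (\sum_(1 <= k < 1 + m) f k)%E \is a fin_num.
  by apply/sum_fin_numP => -[|k] //.
rewrite -(nneseries_addn (1 + m)) // in foo.
rewrite (_ : (\sum_(0 <= j <oo) _)%E = (\sum_(0 <= i <oo) f (i + (1 + m))%N)%E); last first.
  by apply: eq_eseriesr => j _; rewrite add1n addnS addnC.
by move: foo fin; case: (\sum_(0 <= i <oo) f (i + (1 + m))%N)%E => // [r|];
  case: (\sum_(1 <= k < 1 + m) f k)%E.
Qed.

Theorem mainTheorem5 (R : realType) (d : nat) (hd : (1 <= d)%N)
    (P : nat -> mpoly d R[i])
    (hP : forall n, (1 <= n)%N -> poly_class (P n))
    (hdiv : (\sum_(1 <= n <oo) (1 - Normc.normc (alpha (P n)))%:E = +oo)%E)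
    (B : nat -> ('I_d -> R[i]) -> R[i])
    (hB : forall n, (1 <= n)%N -> B n = inner_quotient (P n))
    (f : ('I_d -> R[i]) -> R[i]) (hf : hardy2 f)
    (f_ g_ : nat -> ('I_d -> R[i]) -> R[i])
    (hf0 : f_ 0%N = f)
    (hg : forall n, g_ n = hardy_proj (f_ n) (hardy_orth (hardy_mul (B n.+1))))
    (hfS : forall n,
      f_ n.+1 = holomorphic_div (fun z => f_ n z - g_ n z) (B n.+1)) :
  let term n := fun z => (\prod_(1 <= j < n.+1) B j z) * g_ n z in
  let rest n := fun z => (\prod_(1 <= j < n.+2) B j z) * f_ n.+1 z in
  (forall n : nat,
    [/\ (forall k, (k <= n)%N -> hardy2 (term k)) /\ hardy2 (rest n),
        forall z, polydisk z -> f z = \sum_(0 <= k < n.+1) term k z + rest n z,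
        forall k l, (k <= n)%N -> (l <= n)%N -> k <> l ->
          hardy_inner (term k) (term l) = 0 &
        forall k, (k <= n)%N -> hardy_inner (term k) (rest n) = 0]) /\
  [/\ forall k, hardy2 (term k),
      forall k l, k <> l -> hardy_inner (term k) (term l) = 0 &
      (fun N => hardy_norm (fun z => f z - \sum_(0 <= k < N) term k z))
        @ \oo --> (0 : R)].
Proof.
move=> term rest.
have [a fa] := (hardy2P f).1 hf; have [sa _] := fa.
(* Index shift: the sequence P starts at 1, so [bs n] holds the coefficients of B_{n+1}. *)
pose bs n := inner_coef (P n.+1).
have clP n : poly_class (P n.+1) by exact: hP.
have iso n : isometric (bs n) by exact: inner_isometric (clP n).
have decay : decaying bs.
  move=> m; apply: (@prod_cvg0 _ (fun j => Normc.normc (bs (m + j)%N (@mnm0 d)))).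
    move=> n; rewrite normc_ge0 /=; exact: isometric_coef0_le1 (iso _).
  have e j : bs j (@mnm0 d) = alpha (P j.+1).
    by apply: inner_coef0; case: (clP j).
  have u0 n : (1 <= n)%N -> 0 <= 1 - Normc.normc (alpha (P n)).
    by case: n => // n _; rewrite -e subr_ge0; exact: isometric_coef0_le1 (iso n).
  rewrite -[RHS](@divergent_tail R _ m u0 hdiv).
  by apply: eq_eseriesr => j _; rewrite e.
have rmul n F h : represents F h -> represents (fun z => B n.+1 z * F z) (fmul (bs n) h).
  by move=> Fh; rewrite hB //; exact: represents_inner_mul (clP n) _ _ Fh.
have rproj n F : represents F (adjs bs n a) ->
    represents (hardy_proj F (hardy_orth (hardy_mul (inner_quotient (P n.+1)))))
      (residual bs n a).
  exact: (represents_proj (clP n)).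
(* The invariant that absorbs all choices made by [xget]: g_n is the residual f_n - B T f_n, so f_n
   - g_n = B T f_n and the quotient is T f_n. *)
have rf n : represents (f_ n) (adjs bs n a) /\ represents (g_ n) (residual bs n a).
  elim: n => [|n [IH1 IH2]].
    split; first by rewrite hf0.
    by rewrite hg hf0 (hB 1%N isT); exact: (rproj 0%N).
  have rS : represents (f_ n.+1) (adjs bs n.+1 a).
    rewrite hfS hB //; apply: (represents_div (clP n)); last exact: l2_adjs.
    by apply: represents_eq (representsB IH1 IH2) _ => k; rewrite /residual subKr.
  split; first exact: rS.
  by rewrite hg (hB n.+2 isT); exact: (rproj n.+1).
have rprod n F h : represents F h ->
    represents (fun z => (\prod_(1 <= j < n.+1) B j z) * F z) (muls bs n h).
  elim: n F h => [|n IH] F h Fh.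
    by apply: represents_ext Fh _ => z _; rewrite big_geq // mul1r.
  apply: represents_ext (IH _ _ (rmul n _ _ Fh)) _ => z _.
  by rewrite big_nat_recr //= mulrA.
have rterm k : represents (term k) (muls bs k (residual bs k a)).
  by apply: rprod; case: (rf k).
have rrest n : represents (rest n) (muls bs n.+1 (adjs bs n.+1 a)).
  by apply: rprod; case: (rf n.+1).
have sadj n : l2 (adjs bs n a) by exact: l2_adjs.
have sres n : l2 (residual bs n a) by exact: l2_residual.
(* Obtained from coefficients rather than from the defining property of the quotient, the invariant
   giving all four functions. *)
have step n z : polydisk z -> f_ n z = g_ n z + B n.+1 z * f_ n.+1 z.
  move=> zD; have [r1 r2] := rf n; have [r3 _] := rf n.+1.
  have r4 := representsD r2 (rmul n _ _ r3).
  rewrite (r4.2 z zD) (r1.2 z zD); apply: ev_ext => k.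
  by rewrite /residual subrK.
have expand n z : polydisk z ->
    f z = \sum_(0 <= k < n) term k z + (\prod_(1 <= j < n.+1) B j z) * f_ n z.
  move=> zD; elim: n => [|n IH]; first by rewrite !big_geq // add0r mul1r hf0.
  rewrite IH (step n z zD) mulrDr addrA.
  rewrite [X in _ = X + _]big_nat_recr // [X in _ = _ + X * _]big_nat_recr //=.
  by rewrite mulrA.
have orth_lt k l : (k < l)%N -> hardy_inner (term k) (term l) = 0.
  by move=> kl; rewrite (hardy_innerE (rterm k) (rterm l)); exact: residual_muls_orth.
have orth k l : k <> l -> hardy_inner (term k) (term l) = 0.
  move=> /eqP; rewrite neq_ltn => /orP[|lk]; first exact: orth_lt.
  rewrite (hardy_innerE (rterm k) (rterm l)) dotC; last 2 first.
  - by case: (rterm l).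
  - by case: (rterm k).
  by rewrite -(hardy_innerE (rterm l) (rterm k)) orth_lt // conjc0.
have h2term k : hardy2 (term k) by apply/hardy2P; eexists; exact: rterm k.
split=> [n|].
  split.
  - by split=> //; apply/hardy2P; eexists; exact: rrest n.
  - by move=> z zD; exact: expand.
  - by move=> k l _ _; exact: orth.
  - move=> k kn; rewrite (hardy_innerE (rterm k) (rrest n)).
    exact: residual_muls_orth.
split=> //.
(* The error after N terms is B_1 ... B_N f_N, which has the same norm as f_N because the product is
   isometric. *)
have nE N : hardy_norm (fun z => f z - \sum_(0 <= k < N) term k z) =
    Num.sqrt (nrm (adjs bs N a)).
  have rN : represents (fun z => f z - \sum_(0 <= k < N) term k z) (muls bs N (adjs bs N a)).
    apply: represents_ext (rprod N _ _ (rf N).1) _ => z zD.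
    by rewrite (expand N z zD) addrC addKr.
  by rewrite /hardy_norm (hardy_innerE rN rN) dot_muls // dotaa.
under eq_fun do rewrite nE.
rewrite -(sqrtr0 R); apply: (continuous_cvg _ (@sqrt_continuous R _)).
exact: adjs_cvg0.
Qed.
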